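(* For $i\in\{1,2\}$, let $\beta_i>1$ be such that the generating sequence $g(\beta_i)$ is eventually periodic but not periodic, let $n_i,p_i$ be minimal such that $g(\beta_i)=g^i_1\cdots g^i_{n_i}(g^i_{n_i+1}\cdots g^i_{n_i+p_i})^\infty$, let $S_i=\sum_{j=1}^{p_i}g^i_{n_i+j}$, and let $(P_{\beta_i},\mathcal{L}_{P_{\beta_i}})$ be the fiber product cover of $\mathsf{X}_{\beta_i}$. Then there is a flow equivalence $\Phi\colon S\mathsf{X}_{P_{\beta_1}}\to S\mathsf{X}_{P_{\beta_2}}$ which commutes with the $\mathbb{Z}/2\mathbb{Z}$ actions induced by the labels if and only if $S_1=S_2$.
   Context: Let $\beta>1$. For $t\in[0,1]$ put $r_1(t)=\langle\beta t\rangle$, $x_1(t)=\lfloor\beta t\rfloor$, $r_n(t)=\langle\beta r_{n-1}(t)\rangle$, $x_n(t)=\lfloor\beta r_{n-1}(t)\rfloor$ ($\lfloor\cdot\rfloor$ integer part, $\langle\cdot\rangle$ fractional part). The sequence $x_1(t)x_2(t)\cdots$ is the $\beta$-expansion of $t$, and $e(\beta)$ is the $\beta$-expansion of $1$; it is finite if its terms are eventually $0$. The generating sequence is $g(\beta)=e(\beta)$ if $e(\beta)$ is not finite, and $g(\beta)=(a_1\cdots a_{k-1}(a_k-1))^\infty$ if $e(\beta)=a_1\cdots a_k00\cdots$ with $a_k\ne0$. The beta-shift $\mathsf{X}_\beta$ is the two-sided shift space whose language is the set of finite factors of $\beta$-expansions of $t\in[0,1)$; equivalently (Rényi) it consists of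 the $x\in\{0,\ldots,\lceil\beta\rceil-1\}^{\mathbb{Z}}$ with $x_kx_{k+1}\cdots\le g(\beta)$ lexicographically for all $k$. It is irreducible; it is sofic iff $g(\beta)$ is eventually periodic and of finite type iff $g(\beta)$ is periodic. The right Fischer cover $(F,\mathcal{L}_F)$ of an irreducible sofic shift is its right-resolving presentation (no vertex emits two edges with the same label) with the minimal number of vertices. The fiber product graph has vertex set $F^0\times F^0$ and an edge labelled $a$ from $(u_1,v_1)$ to $(u_2,v_2)$ iff $F$ has edges labelled $a$ from $u_1$ to $u_2$ and from $v_1$ to $v_2$. The fiber product cover $(P,\mathcal{L}_P)$ is its maximal essential subgraph (every vertex emits and receives an edge). $\mathsf{X}_P$ is the edge shift of biinfinite paths in $P$. The $\mathbb{Z}/2\mathbb{Z}$ action on $\mathsf{X}_P$ induced by the labels: the nontrivial element maps a biinfinite path through vertices $(u_i,v_i)$ with labels $(a_i)_{i}$ to the biinfinite path through the vertices $(v_i,u_i)$ with the same labels; this is a continuous shift-commuting involution $\varphi$ of $\mathsf{X}_P$, and it induces the action $[\lambda,t]\mapsto[\varphi(\lambda),t]$ on the suspension. The suspension flow of a shift space $(X,\sigma)$ is $SX=X\times\mathbb{R}/{\sim}$ with $(x,t)\sim(\sigma(x),t-1)$ and $[x,t]+r=[x,t+r]$. A homeomorphism $\Phi\colon SX\to SY$ is a flow equivalence if for each $z\in SX$ there is a monotonically increasing map $\varphi_z\colon\mathbb{R}\to\mathbb{R}$ with $\Phi(z+r)=\Phi(z)+\varphi_z(r)$ for all $r\in\mathbb{R}$.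 *)

(* Defs.v *)
From HB Require Import structures.
From Stdlib Require Import Relation_Operators Operators_Properties.
From mathcomp Require Import all_boot all_order all_algebra.
From mathcomp Require Import all_classical reals topology.

Set Implicit Arguments.
Unset Strict Implicit.
Unset Printing Implicit Defensive.

Import Order.TTheory GRing.Theory Num.Theory.
Import numFieldTopology.Exports.

Local Open Scope classical_set_scope.
Local Open Scope quotient_scope.
Local Open Scope ring_scope.

Section beta_expansion.
Context {R : realType}.
Implicit Types beta t x : R.

Definition frac x : R := x - (Num.floor x)%:~R.

Definition remainder beta t (n : nat) : R :=
  iter n (fun r => frac (beta * r)) t.

(* All sequences are indexed from 0: [digit beta t n] is x_(n+1)(t). *)
Definition digit beta t (n : nat) : nat :=
  `|Num.floor (beta * remainder beta t n)|%N.

Definition expansion1 beta : nat -> nat := digit beta 1.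

(* From index [n] on the sequence vanishes; the least such [n] is the length
   k of a_1 ... a_k 0 0 ... with a_k <> 0. *)
Definition zero_from (e : nat -> nat) (n : nat) : bool :=
  `[< forall m : nat, (n <= m)%N -> e m = 0%N >].

Definition finite_expansion (e : nat -> nat) : Prop := exists n, zero_from e n.

Definition generating_seq beta : nat -> nat :=
  let e := expansion1 beta in
  match pselect (finite_expansion e) with
  | left fin_e =>
      let k := ex_minn fin_e in
      fun n => let j := (n %% k)%N in if j == k.-1 then (e j).-1 else e j
  | right _ => e
  end.

Definition alphabet_size beta : nat := `|Num.ceil beta|%N.

Definition beta_language beta (w : seq nat) : Prop :=
  exists2 t : R, 0 <= t < 1 &
    exists m : nat, w = [seq digit beta t (m + j)%N | j <- iota 0 (size w)].

(* The two-sided shift space whose language is [beta_language beta]. *)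
Definition beta_shift beta : set (int -> 'I_(alphabet_size beta)) :=
  [set x | forall (i : int) (n : nat),
     beta_language beta [seq nat_of_ord (x (i + j%:Z)) | j <- iota 0 n]].

End beta_expansion.

Arguments beta_shift {R} beta.

(* u = u_0 ... u_(n-1) (u_n ... u_(n+p-1))^oo *)
Definition ultimately_periodic (u : nat -> nat) (n p : nat) : Prop :=
  (0 < p)%N /\ forall m : nat, (n <= m)%N -> u (m + p)%N = u m.

Definition eventually_periodic (u : nat -> nat) : Prop :=
  exists n p : nat, ultimately_periodic u n p.

Definition periodic (u : nat -> nat) : Prop :=
  exists p : nat, ultimately_periodic u 0 p.

Definition minimal_ultimately_periodic (u : nat -> nat) (n p : nat) : Prop :=
  ultimately_periodic u n p /\
  forall n' p' : nat, ultimately_periodic u n' p' -> (n <= n')%N /\ (p <= p')%N.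

(* An edge is a triple (source, label, target), so parallel edges carry
   distinct labels; this is automatic in right-resolving graphs and in their
   fiber products. *)
Definition src (V A : Type) (e : V * A * V) : V := e.1.1.
Definition lab (V A : Type) (e : V * A * V) : A := e.1.2.
Definition tgt (V A : Type) (e : V * A * V) : V := e.2.

Record lgraph (A V : finType) := LGraph {
  vertices : {set V};
  edges : {set V * A * V};
  edges_endpoints : forall e : V * A * V, e \in edges ->
    (src e \in vertices) && (tgt e \in vertices) }.

Section labelled_graphs.
Context {A V : finType}.
Implicit Types G H : lgraph A V.

Definition subgraph H G : Prop :=
  (vertices H \subset vertices G) && (edges H \subset edges G).

Definition essential G : Prop :=
  forall v, v \in vertices G ->
    (exists2 e, e \in edges G & src e = v) /\
    (exists2 e, e \in edges G & tgt e = v).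

Definition right_resolving G : Prop :=
  forall e f, e \in edges G -> f \in edges G ->
    src e = src f -> lab e = lab f -> e = f.

Definition edge_shift G : set {ptws int -> discrete_topology (V * A * V)%type} :=
  [set x | forall i : int, x i \in edges G /\ tgt (x i) = src (x (i + 1))].

Definition label_seq (x : int -> V * A * V) : int -> A := fun i => lab (x i).

Definition presents G (X : set (int -> A)) : Prop :=
  [set label_seq x | x in edge_shift G] = X.

(* The maximal essential subgraph is the union of all essential subgraphs; see
   [max_essential_subgraphP]. *)
Definition max_ess_vertices G : {set V} :=
  [set v | `[< exists H, [/\ subgraph H G, essential H & v \in vertices H] >]].

Definition max_ess_edges G : {set V * A * V} :=
  [set e | `[< exists H, [/\ subgraph H G, essential H & e \in edges H] >]].

Fact max_ess_endpoints G (e : V * A * V) : e \in max_ess_edges G ->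
  (src e \in max_ess_vertices G) && (tgt e \in max_ess_vertices G).
Proof.
rewrite inE => /asboolP[H [sHG essH eH]].
have /andP[se te] := edges_endpoints eH.
by apply/andP; split; rewrite inE; apply/asboolP; exists H.
Qed.

Definition max_essential_subgraph G : lgraph A V :=
  LGraph (@max_ess_endpoints G).

Lemma max_essential_subgraphP G :
  [/\ subgraph (max_essential_subgraph G) G,
      essential (max_essential_subgraph G) &
      forall H, subgraph H G -> essential H ->
        subgraph H (max_essential_subgraph G)].
Proof.
split.
- by apply/andP; split; apply/fintype.subsetP => v; rewrite inE;
    move=> /asboolP[H [/andP[/fintype.subsetP sv /fintype.subsetP se] _ hv]];
    [exact: sv|exact: se].
- move=> v; rewrite inE => /asboolP[H [sHG essH vH]].
  have [[e eH ev] [f fH fv]] := essH v vH.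
  by split; [exists e|exists f] => //; rewrite inE; apply/asboolP; exists H.
- by move=> H sHG essH; apply/andP; split; apply/fintype.subsetP => v vH;
    rewrite inE; apply/asboolP; exists H.
Qed.

Definition edge_shift_shift_fun (x : int -> V * A * V) : int -> V * A * V :=
  fun i => x (i + 1).

Fact edge_shift_shift_subproof G (x : edge_shift G) :
  edge_shift_shift_fun (set_val x) \in edge_shift G.
Proof.
by apply/mem_set => i; have /set_mem := valP x; apply.
Qed.

Definition edge_shift_shift G (x : edge_shift G) : edge_shift G :=
  Sub (edge_shift_shift_fun (set_val x)) (edge_shift_shift_subproof x).

End labelled_graphs.

Definition right_fischer_cover (A V : finType) (F : lgraph A V)
    (X : set (int -> A)) : Prop :=
  [/\ presents F X, right_resolving F &
      forall (W : finType) (G : lgraph A W),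
        presents G X -> right_resolving G ->
        (#|vertices F| <= #|vertices G|)%N].

Section fiber_product.
Context {A V : finType}.
Implicit Type F : lgraph A V.

Definition fiber_product_edges F : {set (V * V) * A * (V * V)} :=
  [set e | ((src e).1, lab e, (tgt e).1) \in edges F &
           ((src e).2, lab e, (tgt e).2) \in edges F].

Fact fiber_product_endpoints F (e : (V * V) * A * (V * V)) :
  e \in fiber_product_edges F ->
  (src e \in finset.setX (vertices F) (vertices F)) &&
  (tgt e \in finset.setX (vertices F) (vertices F)).
Proof.
by rewrite !inE => /andP[/edges_endpoints/andP[-> ->]
                        /edges_endpoints/andP[-> ->]].
Qed.

Definition fiber_product_graph F : lgraph A (V * V)%type :=
  LGraph (@fiber_product_endpoints F).

Definition fiber_product_cover F : lgraph A (V * V)%type :=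
  max_essential_subgraph (fiber_product_graph F).

Definition swap_vertex (v : V * V) : V * V := (v.2, v.1).

Definition swap_edge (e : (V * V) * A * (V * V)) : (V * V) * A * (V * V) :=
  (swap_vertex (src e), lab e, swap_vertex (tgt e)).

Lemma swap_vertexK : involutive swap_vertex. Proof. by case. Qed.

Lemma swap_edgeK : involutive swap_edge.
Proof. by move=> [[[? ?] ?] [? ?]]. Qed.

Fact swap_graph_endpoints (H : lgraph A (V * V)%type) e :
  e \in swap_edge @: edges H ->
  (src e \in swap_vertex @: vertices H) &&
  (tgt e \in swap_vertex @: vertices H).
Proof.
case/imsetP => f /edges_endpoints/andP[sf tf] ->.
by apply/andP; split; [exact: (imset_f _ sf)|exact: (imset_f _ tf)].
Qed.

Lemma swap_edge_cover F e : e \in edges (fiber_product_cover F) ->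
  swap_edge e \in edges (fiber_product_cover F).
Proof.
rewrite inE => /asboolP[H [/andP[/fintype.subsetP sv /fintype.subsetP se]]].
move=> essH eH; rewrite inE; apply/asboolP; exists (LGraph (@swap_graph_endpoints H)).
split; last by rewrite /= imset_f.
- apply/andP; split; apply/fintype.subsetP => _ /imsetP[v vH ->].
    by move: (sv _ vH); rewrite !inE andbC.
  by move: (se _ vH); rewrite !inE andbC.
- move=> _ /imsetP[v vH ->]; have [[f fH fv] [g gH gv]] := essH v vH.
  split; [exists (swap_edge f); last by rewrite -fv
         |exists (swap_edge g); last by rewrite -gv]; exact: imset_f.
Qed.

Definition swap_path_fun (x : int -> (V * V) * A * (V * V)) :
  int -> (V * V) * A * (V * V) := fun i => swap_edge (x i).

Fact swap_path_subproof F (x : edge_shift (fiber_product_cover F)) :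
  swap_path_fun (set_val x) \in edge_shift (fiber_product_cover F).
Proof.
apply/mem_set => i; have /set_mem/(_ i)[xi xi1] := valP x.
split; first exact: swap_edge_cover.
by rewrite /swap_path_fun /swap_edge /= /tgt /src /= -/(tgt _) -/(src _) xi1.
Qed.

Definition swap_path F (x : edge_shift (fiber_product_cover F)) :
    edge_shift (fiber_product_cover F) :=
  Sub (swap_path_fun (set_val x)) (swap_path_subproof x).

Lemma swap_pathK F : involutive (@swap_path F).
Proof. by move=> x; apply/val_inj/funext => i; exact: swap_edgeK. Qed.

Lemma swap_path_shift F x :
  swap_path (edge_shift_shift x) = edge_shift_shift (@swap_path F x).
Proof. exact/val_inj. Qed.

End fiber_product.

Section suspension.
Context (R : realType) (X : topologicalType) (sigma : X -> X).

Definition susp_step (p q : X * R) : Prop := q = (sigma p.1, p.2 - 1).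

(* The least equivalence relation with (x, t) ~ (sigma x, t - 1). *)
Definition susp_rel (p q : X * R) : bool :=
  `[< clos_refl_sym_trans (X * R) susp_step p q >].

Fact susp_rel_refl : reflexive susp_rel.
Proof. by move=> p; apply/asboolP; exact: rst_refl. Qed.

Fact susp_rel_sym : symmetric susp_rel.
Proof.
by move=> p q; apply/idP/idP => /asboolP pq; apply/asboolP; exact: rst_sym.
Qed.

Fact susp_rel_trans : transitive susp_rel.
Proof.
move=> q p r /asboolP pq /asboolP qr; apply/asboolP.
exact: rst_trans pq qr.
Qed.

Canonical susp_equiv_rel :=
  EquivRel susp_rel susp_rel_refl susp_rel_sym susp_rel_trans.

Definition suspension : topologicalType :=
  quotient_topology {eq_quot susp_equiv_rel}.

Definition susp_pi (p : X * R) : suspension := \pi_{eq_quot susp_equiv_rel} p.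

Definition susp_repr (z : suspension) : X * R :=
  repr (z : {eq_quot susp_equiv_rel}).

Lemma susp_reprK : cancel susp_repr susp_pi.
Proof. exact: reprK. Qed.

Lemma susp_piP (p q : X * R) :
  susp_pi p = susp_pi q <-> clos_refl_sym_trans (X * R) susp_step p q.
Proof.
split; first by move=> /eqquotP /asboolP.
by move=> pq; apply/eqquotP/asboolP.
Qed.

Lemma susp_pi_repr (p : X * R) :
  clos_refl_sym_trans (X * R) susp_step (susp_repr (susp_pi p)) p.
Proof. by apply/susp_piP; rewrite susp_reprK. Qed.

(* Well defined on classes: see [susp_flowE] and [susp_mapE]. *)
Definition susp_flow (z : suspension) (r : R) : suspension :=
  susp_pi ((susp_repr z).1, (susp_repr z).2 + r).

Definition susp_map (f : X -> X) (z : suspension) : suspension :=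
  susp_pi (f (susp_repr z).1, (susp_repr z).2).

Lemma susp_flowE (p : X * R) (r : R) :
  susp_flow (susp_pi p) r = susp_pi (p.1, p.2 + r).
Proof.
apply/susp_piP; move: (susp_repr _) (susp_pi_repr p) => q; elim.
- by move=> ? ? ->; apply: rst_step; rewrite /susp_step /= addrAC.
- by move=> ?; exact: rst_refl.
- by move=> ? ? _; exact: rst_sym.
- by move=> ? ? ? _ h1 _; exact: rst_trans.
Qed.

Lemma susp_mapE (f : X -> X) (p : X * R) :
  (forall x, f (sigma x) = sigma (f x)) ->
  susp_map f (susp_pi p) = susp_pi (f p.1, p.2).
Proof.
move=> fC; apply/susp_piP; move: (susp_repr _) (susp_pi_repr p) => q; elim.
- by move=> ? ? ->; apply: rst_step; rewrite /susp_step /= fC.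
- by move=> ?; exact: rst_refl.
- by move=> ? ? _; exact: rst_sym.
- by move=> ? ? ? _ h1 _; exact: rst_trans.
Qed.

End suspension.

Definition homeomorphism (S T : topologicalType) (f : S -> T) : Prop :=
  continuous f /\
  exists g : T -> S, [/\ cancel f g, cancel g f & continuous g].

Definition flow_equivalence (R : realType) (X Y : topologicalType)
    (sigma : X -> X) (tau : Y -> Y)
    (Phi : suspension R sigma -> suspension R tau) : Prop :=
  homeomorphism Phi /\
  forall z, exists phi : R -> R,
    {homo phi : r s / r < s} /\
    forall r, Phi (susp_flow z r) = susp_flow (Phi z) (phi r).

Definition susp_cover (R : realType) (A V : finType) (F : lgraph A V) :
    topologicalType :=
  suspension R (@edge_shift_shift _ _ (fiber_product_cover F)).

(* [susp_swap] is the nontrivial element of Z/2Z acting on the suspension; since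
   it is an involution, commuting with it is equivariance. *)
Definition susp_swap (R : realType) (A V : finType) (F : lgraph A V)
    (z : susp_cover R F) : susp_cover R F :=
  susp_map (@swap_path _ _ F) z.

(* Main.v *)
(** The states of the right Fischer cover are the remainders of the expansion
    of 1: in state [i] every digit below [g_i] leads back to state 0 and [g_i]
    leads to the next state.  Off the diagonal of the fiber product, a
    biinfinite path has always been in the loop of length [p] in one coordinate,
    with a fixed partner in the other, until it leaves by one of the [S] digits
    that fall below the loop; from there on it is on the diagonal.  Recoding by
    substitutions, each of which is an equivariant flow equivalence, turns the
    cover into the full shift on [S + 1] letters together with two copies, swapped
    by the involution, of the points that are left asymptotic to one fixed point.
    This depends only on [S].

    Conversely, an equivariant flow equivalence restricts to the fixed points of
    the involutions, that is to the suspensions of the full shifts on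
    [k_i = S_i + 1] letters.  Lifting paths yields a locally constant integer
    cocycle on the first shift whose sum over a closed orbit is the period of the
    image orbit.  After adding a coboundary it is nonnegative and defines a
    transition matrix [M] with entries in Z[X], where a transition of weight [e]
    counts as [X^e].  Counting periodic points of the second shift along those of
    the first and integrating Jacobi's formula gives
    [det (1 - M) = d (1 - k_2 X)] with [d = 1] or [-1].  At [X = 1] the weights
    disappear, so [1 - k_1] and [1 - k_2] agree up to sign and [S_1 = S_2]; this
    is the argument of Parry and Sullivan. *)

From HB Require Import structures.
From Stdlib Require Import Relation_Operators Operators_Properties.
Require Import Defs.
From mathcomp Require Import all_boot all_order all_algebra.
From mathcomp Require Import all_classical reals topology normedtype.
From mathcomp Require Import perm zify ring lra.

Set Implicit Arguments.
Unset Strict Implicit.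
Unset Printing Implicit Defensive.

Import Order.TTheory GRing.Theory Num.Theory.
Import numFieldTopology.Exports numFieldNormedType.Exports.

Local Open Scope classical_set_scope.
Local Open Scope ring_scope.

(** * Points and suspensions *)

(** State 0 has remainder 1, the largest, and reading a common digit preserves the order of
    remainders. So the coordinate of an off-diagonal pair with the smaller remainder was never in
    state 0 in the past, which confines it to the loop. If it had two possible partners, the lower
    one would be confined to the loop as well, and its gap to the given coordinate would grow by the
    factor b at each step and yet recur after p steps.

    The reparametrisations of a flow equivalence are only strictly increasing: on a closed orbit
    they may jump by periods, so they need not be lifts. Continuous lifts are rebuilt from
    continuity and compactness, and monotonicity serves to show that closed orbits keep their
    direction.

    At X = 1 the determinant no longer sees the weights, so the same count, applied to the first
    shift and itself, evaluates it as 1 - k_1 up to sign. The factor d is a unit because transitions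
    of weight 0 admit no closed walk. The signs are harmless since 1 - k_i = - S_i. *)

Definition agree (T : Type) (N : nat) (x y : int -> T) : Prop :=
  forall i : int, (`|i| <= N)%N -> x i = y i.

Lemma agreeW (T : Type) N M (x y : int -> T) :
  (N <= M)%N -> agree M x y -> agree N x y.
Proof. by move=> NM xy i iN; apply: xy; lia. Qed.

Lemma agree_refl (T : Type) N (x : int -> T) : agree N x x.
Proof. by []. Qed.

Lemma agree_sym (T : Type) N (x y : int -> T) : agree N x y -> agree N y x.
Proof. by move=> xy i iN; rewrite xy. Qed.

Lemma agree_trans (T : Type) N (x y z : int -> T) :
  agree N x y -> agree N y z -> agree N x z.
Proof. by move=> xy yz i iN; rewrite xy // yz. Qed.

(** The fields [pts], [step] and [flip] are carried along rather than derived from [adj] and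
    [flipl], so that [susp_cover] is by conversion the suspension of an instance, [cover_sys]. *)
Record sys := Sys {
  alph : finType;
  pts : set {ptws int -> discrete_topology alph};
  adj : rel alph;
  step : pts -> pts;
  flip : pts -> pts;
  flipl : alph -> alph;
  ptsP : forall x : int -> alph, pts x <-> forall i, adj (x i) (x (i + 1));
  stepE : forall (x : pts) i, set_val (step x) i = set_val x (i + 1);
  flipE : forall (x : pts) i, set_val (flip x) i = flipl (set_val x i) }.

Arguments pts : clear implicits.

Section points.
Variable X : sys.
Implicit Types x y : pts X.

Definition sv x : int -> alph X := set_val x.

Lemma sv_inj : injective sv.
Proof. exact: val_inj. Qed.

Lemma sv_adj x i : adj (sv x i) (sv x (i + 1)).
Proof. by have /ptsP := set_mem (valP x); exact. Qed.

Definition mkpt (f : int -> alph X) (fP : forall i, adj (f i) (f (i + 1))) :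
  pts X := SigSub (mem_set ((ptsP f).2 fP)).

Lemma shift_subproof x (n i : int) : adj (sv x (i + n)) (sv x (i + 1 + n)).
Proof. by rewrite addrAC; exact: sv_adj. Qed.

Definition shift (n : int) x : pts X :=
  mkpt (fun i => shift_subproof x n i).

Lemma sv_shift n x i : sv (shift n x) i = sv x (i + n).
Proof. by []. Qed.

Lemma shift0 x : shift 0 x = x.
Proof. by apply: sv_inj; apply/funext => i; rewrite sv_shift addr0. Qed.

Lemma shiftD m n x : shift m (shift n x) = shift (n + m) x.
Proof.
by apply: sv_inj; apply/funext => i; rewrite !sv_shift addrAC addrA.
Qed.

Lemma shift_inj n : injective (shift n).
Proof.
move=> x y /(congr1 (shift (- n))); rewrite !shiftD addrN !shift0; exact.
Qed.

Lemma step_shift x : step x = shift 1 x.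
Proof. by apply: sv_inj; apply/funext => i; rewrite /sv stepE. Qed.

Lemma sv_flip x i : sv (flip x) i = flipl (sv x i).
Proof. exact: flipE. Qed.

Lemma flip_shift n x : flip (shift n x) = shift n (flip x).
Proof.
by apply: sv_inj; apply/funext => i; rewrite !(sv_shift, sv_flip).
Qed.

Lemma agree_shift N n x y :
  agree (N + `|n|) (sv x) (sv y) -> agree N (sv (shift n x)) (sv (shift n y)).
Proof. by move=> xy i iN; rewrite !sv_shift; apply: xy; lia. Qed.

Lemma nbhs_ptsP x (U : set (pts X)) :
  nbhs x U <-> exists N, forall y, agree N (sv x) (sv y) -> U y.
Proof.
split.
- pose T : topologicalType := {ptws int -> discrete_topology (alph X)}.
  pose F : set_system T :=
    [set V | exists N, forall y : int -> alph X, agree N (sv x) y -> V y].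
  have FF : Filter F.
    split.
    + by exists 0%N.
    + move=> P Q [N PN] [M QM]; exists (maxn N M) => y xy.
      by split; [apply: PN|apply: QM]; apply: agreeW xy;
        rewrite ?leq_maxl ?leq_maxr.
    + by move=> P Q PQ [N PN]; exists N => y /PN /PQ.
  have cF : F --> (set_val x : T).
    apply/cvg_sup => i V [W [[W' oW' <-] Wx] WV].
    exists `|i|%N => y xy; apply: WV.
    by rewrite /= /proj -(xy i) //.
  case=> W [[V oV VW] Wx] WU.
  have VF : nbhs (set_val x : T) V.
    by apply: open_nbhs_nbhs; split => //; move: Wx; rewrite -VW.
  have [N NV] := cF _ VF.
  by exists N => y /NV Vy; apply: WU; rewrite -VW.
- case=> N NU; suff h : nbhs x [set y : pts X | agree N (sv x) (sv y)].
    by apply: filterS h => y; exact: NU.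
  have nx i : nbhs x [set y : pts X | sv x i = sv y i].
    have ci : {for x, continuous
        (fun y : pts X => (sv y i : discrete_topology (alph X)))}.
      apply: (@continuous_comp _ _ _
        (set_val : pts X -> {ptws int -> discrete_topology (alph X)})
        (fun f => f i)).
        exact: (@initial_continuous (pts X)
          {ptws int -> discrete_topology (alph X)} set_val).
      exact: (@proj_continuous _ (fun=> discrete_topology (alph X))).
    have h : nbhs x [set y : pts X | [set sv x i] (sv y i)] := ci _ (discrete_set1 _).
    by apply: filterS h => y /= ->.
  elim: N {NU} => [|N IH].
    have h := nx 0; apply: (filterS _ h) => y /= xy i.
    by rewrite leqn0 absz_eq0 => /eqP ->.
  apply: filterS (filterI IH (filterI (nx N.+1%:Z) (nx (- N.+1%:Z)))).
  move=> y [xy [y1 y2]] i iN.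
  have [/xy//|Ni] := leqP `|i| N.
  have [->//|->//] : i = N.+1%:Z \/ i = - N.+1%:Z by lia.
Qed.

Local Notation T := {ptws int -> discrete_topology (alph X)}.

(** The points form a closed set in a compact product: a sequence outside it breaks [adj] at one
    place, and so does every sequence that agrees with it at two coordinates. *)
Lemma pts_compact : compact [set: pts X].
Proof.
have cT : compact [set: T].
  have -> : [set: T] = [set f : T | forall i, setT (f i)].
    by apply/seteqP; split.
  apply: (@tychonoff _ (fun _ : int => discrete_topology (alph X)) (fun=> setT)).
  by move=> i; apply: finite_compact; exact: finite_finset.
have nT (f : T) i : nbhs f [set f' : T | f i = f' i].
  have ci : {for f, continuous (fun f' : T => f' i)}.
    exact: (@proj_continuous _ (fun=> discrete_topology (alph X))).
  have h : nbhs f [set f' : T | [set f i] (f' i)] := ci _ (discrete_set1 _).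
  apply: (@filterS _ (nbhs f) (nbhs_filter f) _ _ _ h) => y /= ->.
  by [].
apply/compact_near_coveringP => I F P FF cov.
have key : forall f : T, setT f -> \forall f' \near f & i \near F,
  (fun i (f : T) => forall x : pts X, sv x = f -> P i x) i f'.
  move=> f _ /=; have [pf|nx] := pselect (pts X f).
    pose x : pts X := SigSub (mem_set pf).
    have [[U G] /= [nU FG] UG] := cov x Logic.I.
    have [V [[W oW WV] Vx] VU] := nU.
    exists (W, G); first split=> //=.
      by apply: open_nbhs_nbhs; split => //; move: Vx; rewrite -WV.
    move=> [f' i] /= [Wf' Gi] y yf'; apply: (UG (y, i)); split => //=.
    by apply: VU; rewrite -WV /= -/(sv y) yf'.
  have [i /negP ni] : exists i, ~ adj (f i) (f (i + 1)).
    by apply/existsNP => h; apply: nx; apply/ptsP.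
  exists ([set f' : T | f i = f' i] `&` [set f' : T | f (i + 1) = f' (i + 1)], setT).
    by split => /=; [apply: filterI; exact: nT|exact: filterT].
  move=> [f' j] /= [[e1 e2] _] y yf'; exfalso; move: ni.
  by rewrite e1 e2 -yf' sv_adj.
have /compact_near_coveringP/(_ I F _ FF key) h := cT.
by apply: (@filterS _ F FF _ _ _ h) => i {}h x _; exact: (h (sv x) Logic.I x erefl).
Qed.

End points.

Section suspension_points.
Variables (R : realType) (X : sys).
Implicit Types (x y : pts X) (s t r : R) (m n : int).

Definition susp : topologicalType := suspension R (@step X).

Definition spi x t : susp := susp_pi (@step X) (x, t).

Definition sflow (z : susp) r : susp := susp_flow z r.

Definition sflip (z : susp) : susp := susp_map (@flip X) z.

Lemma spi_shift n x t : spi (shift n x) (t - n%:~R) = spi x t.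
Proof.
have step1 y u : spi (shift 1 y) (u - 1) = spi y u.
  by apply/esym/susp_piP/rst_step; rewrite /susp_step /= step_shift.
have nat_case (k : nat) y u : spi (shift k%:Z y) (u - k%:Z%:~R) = spi y u.
  elim: k y u => [|k IH] y u; first by rewrite shift0 subr0.
  rewrite -[RHS](IH y u) -[RHS]step1 shiftD; congr (spi (shift _ _) _); first by lia.
  by rewrite intS intrD; lra.
case: (intP n) => [|k|k].
- by rewrite shift0 subr0.
- exact: nat_case.
- rewrite -[LHS](nat_case k.+1) shiftD addNr shift0; congr spi.
  by rewrite mulrNz; lra.
Qed.

Lemma spi_eq x y t s :
  spi x t = spi y s <-> exists n, y = shift n x /\ s = t - n%:~R.
Proof.
split=> [/susp_piP|[n [-> ->]]]; last by rewrite spi_shift.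
suff h p q : clos_refl_sym_trans (pts X * R) (susp_step (@step X)) p q ->
    exists n, q.1 = shift n p.1 /\ q.2 = p.2 - n%:~R by move=> /h.
elim=> {p q}.
- by move=> p q ->; exists 1; rewrite step_shift.
- by move=> p; exists 0; rewrite shift0 subr0.
- move=> p q _ [n [-> ->]]; exists (- n).
  by rewrite shiftD subrr shift0 mulrNz opprK subrK.
- move=> p q r _ [n [-> ->]] _ [m [-> ->]]; exists (n + m).
  by rewrite shiftD intrD; split => //; lra.
Qed.

Lemma spi_eq_same x y t : spi x t = spi y t -> x = y.
Proof.
move=> /spi_eq[n [->]] h; have : n%:~R = 0 :> R by lra.
by move=> /eqP; rewrite intr_eq0 => /eqP ->; rewrite shift0.
Qed.

Lemma spi_surj z : exists x t, z = spi x t.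
Proof.
exists (susp_repr z).1, (susp_repr z).2; rewrite /spi -surjective_pairing.
by rewrite susp_reprK.
Qed.

Lemma spi_surj_near z s : exists x t, z = spi x t /\ s <= t < s + 1.
Proof.
have [x [t ->]] := spi_surj z.
exists (shift (Num.floor (t - s)) x), (t - (Num.floor (t - s))%:~R).
split; first by rewrite spi_shift.
have := floor_itv (t - s); rewrite intrD; lra.
Qed.

Lemma sflowE x t r : sflow (spi x t) r = spi x (t + r).
Proof. exact: susp_flowE. Qed.

Lemma sflowD z r s : sflow (sflow z r) s = sflow z (r + s).
Proof. by have [x [t ->]] := spi_surj z; rewrite !sflowE addrA. Qed.

Lemma sflow0 z : sflow z 0 = z.
Proof. by have [x [t ->]] := spi_surj z; rewrite !sflowE addr0. Qed.

Lemma sflipE x t : sflip (spi x t) = spi (flip x) t.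
Proof.
rewrite /sflip /spi susp_mapE // => y.
by rewrite !step_shift flip_shift.
Qed.

Lemma nbhs_prodP x t (U : set (pts X * R)) : nbhs (x, t) U <->
  exists N, exists2 e, 0 < e & forall y s, agree N (sv x) (sv y) ->
    `|s - t| < e -> U (y, s).
Proof.
split.
  case=> -[A B] /= [/nbhs_ptsP[N NA] /nbhs_ballP[e /= e0 eB]] AB.
  exists N; exists e => // y s xy st; apply: AB; split => /=; first exact: NA.
  by apply: eB; rewrite /ball /= distrC.
case=> N [e e0 h]; exists ([set y | agree N (sv x) (sv y)], ball t e).
  by split => /=; [apply/nbhs_ptsP; exists N|exact: nbhsx_ballx].
by move=> [y s] [/= xy st]; apply: h => //; rewrite distrC.
Qed.

Lemma open_suspP (U : set susp) : open U <->
  forall x t, U (spi x t) -> exists N, exists2 e, 0 < e &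
    forall y s, agree N (sv x) (sv y) -> `|s - t| < e -> U (spi y s).
Proof.
split.
  move=> oU x t Ux; have {}oU : open [set p : pts X * R | U (spi p.1 p.2)].
    rewrite (_ : [set p | _] = (fun p => susp_pi (@step X) p) @^-1` U) //.
    by apply/seteqP; split => -[].
  by move: oU; rewrite openE => /(_ (x, t) Ux) /nbhs_prodP.
move=> h; change (open [set p : pts X * R | U (susp_pi (@step X) p)]).
rewrite openE => -[x t] /= Ux; apply/nbhs_prodP.
exact: h.
Qed.

Lemma nbhs_suspP x t (U : set susp) : nbhs (spi x t) U <->
  exists N, exists2 e, 0 < e &
    forall y s, agree N (sv x) (sv y) -> `|s - t| < e -> U (spi y s).
Proof.
split.
  rewrite nbhsE => -[V [/open_suspP oV Vx] VU].
  have [N [e e0 h]] := oV _ _ Vx.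
  by exists N; exists e => // y s xy st; apply: VU; exact: h.
case=> N [e e0 h]; rewrite nbhsE.
exists [set z | exists y s, [/\ z = spi y s, agree N (sv x) (sv y) & `|s - t| < e]].
  split; last by exists x, t; rewrite subrr normr0.
  apply/open_suspP => y s [y' [s' [/spi_eq[n [-> ->]] xy st]]].
  exists (N + `|n|)%N; exists (e - `|s - n%:~R - t|); first by rewrite subr_gt0.
  move=> a b ya ba; exists (shift n a), (b - n%:~R).
  rewrite spi_shift; split => //.
    exact/(agree_trans xy)/agree_shift.
  rewrite (_ : b - n%:~R - t = (b - s) + (s - n%:~R - t)); last by ring.
  by apply: (le_lt_trans (ler_normD _ _)); rewrite -ltrBrDr.
by move=> _ [y [s [-> xy st]]]; exact: h.
Qed.

Lemma susp_compact : compact [set: susp].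
Proof.
have -> : [set: susp] =
    (fun p => susp_pi (@step X) p) @` ([set: pts X] `*` `[0 : R, 1]%classic).
  apply/seteqP; split=> // z _; have [x [t [-> t01]]] := spi_surj_near z 0.
  by exists (x, t) => //; split => //=; rewrite in_itv /=; lra.
apply: continuous_compact.
  by apply: continuous_subspaceT; exact: pi_continuous.
by apply: compact_setX; [exact: pts_compact|exact: segment_compact].
Qed.

Lemma small_int (n : int) : `|n%:~R| < 1 :> R -> n = 0.
Proof. by rewrite -intr_norm -[1]/(1%:~R) ltr_int; lia. Qed.

Lemma agree_neq x y : x <> y -> exists N, ~ agree N (sv x) (sv y).
Proof.
move=> xy; apply/existsNP => h; apply/xy/sv_inj/funext => i.
exact: (h `|i|%N).
Qed.

Lemma susp_hausdorff : hausdorff_space susp.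
Proof.
rewrite open_hausdorff => z w /eqP zw.
have nbhs_open (x : pts X) t N (e : R) : 0 < e ->
    nbhs (spi x t) [set z | exists y s, [/\ z = spi y s, agree N (sv x) (sv y) & `|s - t| < e]].
  by move=> e0; apply/nbhs_suspP; exists N; exists e => // y s xy st; exists y, s.
suff [P [Q [nP nQ PQ]]] : exists P Q, [/\ nbhs z P, nbhs w Q & P `&` Q = set0].
  move: nP nQ; rewrite !nbhsE => -[P' [oP Pz] PP] [Q' [oQ Qz] QQ].
  exists (P', Q') => /=; first by rewrite !inE.
  split => //; apply/eqP; rewrite -subset0 => v [/PP Pv /QQ Qv].
  by rewrite -PQ.
(* With the height of [w] chosen within 1/2 of that of [z], nearby representatives of a common point
   differ by less than 1 in height, which forces the shift between them to vanish. *)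
have [x [t tz]] := spi_surj z; have [y [s [sw st]]] := spi_surj_near w (t - 2^-1).
have [ts|ts] := eqVneq t s.
  subst s; have [N xyN] : exists N, ~ agree N (sv x) (sv y).
    by apply: agree_neq => xy; apply: zw; rewrite tz sw xy.
  exists [set z | exists x' s, [/\ z = spi x' s, agree N (sv x) (sv x') & `|s - t| < 4^-1]].
  exists [set z | exists y' s, [/\ z = spi y' s, agree N (sv y) (sv y') & `|s - t| < 4^-1]].
  rewrite tz sw; split; [by apply: nbhs_open; lra..|].
  rewrite -subset0 => v [[a [u [-> xa ut]]] [b [u' [/spi_eq[n [-> e]] yb ut']]]].
  have n0 : n = 0 by apply: small_int; move: ut ut'; rewrite e !ltr_norml; lra.
  apply: xyN; apply: agree_trans xa _; apply: agree_sym.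
  by move: yb; rewrite n0 shift0.
have [d dE] : exists d, d = `|s - t| by exists `|s - t|.
have d0 : 0 < d by rewrite dE normr_gt0 subr_eq0 eq_sym.
have d1 : d <= 2^-1 by rewrite dE ler_norml; lra.
exists [set z | exists x' s, [/\ z = spi x' s, agree 0 (sv x) (sv x') & `|s - t| < d / 2]].
exists [set z | exists y' s', [/\ z = spi y' s', agree 0 (sv y) (sv y') & `|s' - s| < d / 2]].
rewrite tz sw; split; [by apply: nbhs_open; lra..|].
rewrite -subset0 => v [[a [u [-> xa ut]]] [b [u' [/spi_eq[n [-> e]] yb ut']]]].
have n0 : n = 0.
  have /ler_normlP[h1 h2] : `|s - t| <= d by rewrite dE.
  by apply: small_int; move: ut ut'; rewrite e !ltr_norml; lra.
move: ut ut'; rewrite e n0 subr0; rewrite !ltr_norml => /andP[? ?] /andP[? ?].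
have : `|s - t| < d by rewrite ltr_norml; lra.
by rewrite dE ltxx.
Qed.

End suspension_points.

(** * Equivariant flow equivalence *)

Section signed_sums.
Implicit Types (f : int -> int) (n : int).

Definition csum f n : int :=
  match n with
  | Posz k => \sum_(i < k) f i%:Z
  | Negz k => - \sum_(i < k.+1) f (- i.+1%:Z)
  end.

Lemma csum0 f : csum f 0 = 0.
Proof. exact: big_ord0. Qed.

Lemma csumS f n : csum f (n + 1) = csum f n + f n.
Proof.
case: n => [k|[|k]].
- by rewrite -PoszD addn1 /= big_ord_recr.
- by rewrite /= big_ord0 big_ord1 addNr.
- have -> : Negz k.+1 + 1 = Negz k by rewrite !NegzE; lia.
  by rewrite /= [X in _ = - X + _]big_ord_recr /= NegzE opprD subrK.
Qed.

Lemma int_ind (P : int -> Prop) : P 0 -> (forall n, P n -> P (n + 1)) ->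
  (forall n, P (n + 1) -> P n) -> forall n, P n.
Proof.
move=> P0 Pp Pn [k|k].
  by elim: k => // k IH; rewrite intS addrC; exact: Pp.
by elim: k => [|k IH]; apply: Pn => //; move: IH; congr P; lia.
Qed.

Lemma csum_uniq f (F : int -> int) : F 0 = 0 ->
  (forall n, F (n + 1) = F n + f n) -> forall n, F n = csum f n.
Proof.
move=> F0 FS; apply: int_ind => [|n|n]; first by rewrite F0 csum0.
  by move=> e; rewrite FS csumS e.
by rewrite FS csumS; lia.
Qed.

Lemma csumD f m n : csum f (m + n) = csum f m + csum (fun i => f (m + i)) n.
Proof.
suff <- : csum f (m + n) - csum f m = csum (fun i => f (m + i)) n.
  by rewrite [RHS]addrC subrK.
apply: (@csum_uniq (fun i => f (m + i)) (fun n => csum f (m + n) - csum f m)).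
  by rewrite addr0 subrr.
by move=> k; rewrite addrA csumS addrAC.
Qed.

Lemma csum_bounds f (b c : int) m n : (forall i, b <= f i <= c) -> m <= n ->
  b * (n - m) <= csum f n - csum f m <= c * (n - m).
Proof.
move=> fb mn; have [k ->] : exists k : nat, n = m + k%:Z by exists `|n - m|%N; lia.
elim: k => [|k IH]; first by rewrite addr0 !subrr; lia.
have e : m + k.+1%:Z = (m + k%:Z) + 1 by lia.
by rewrite e csumS; have := fb (m + k%:Z); move: IH; nia.
Qed.

Lemma eq_csum f g n : (forall i, (`|i| <= `|n|)%N -> f i = g i) ->
  csum f n = csum g n.
Proof.
by case: n => k fg; rewrite /=; [|congr (- _)]; apply: eq_bigr => -[i /= ik] _;
  apply: fg; lia.
Qed.

End signed_sums.

Section flow_eq.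
Variable R : realType.

(* Unlike in [flow_equivalence], the reparametrisations are bijective, which
   makes the relation symmetric. *)
Definition fe (X Y : sys) : Prop := exists Phi : susp R X -> susp R Y,
  [/\ homeomorphism Phi,
      forall z, exists phi psi : R -> R,
        [/\ {homo phi : r s / r < s}, cancel psi phi &
            forall r, Phi (sflow z r) = sflow (Phi z) (phi r)] &
      forall z, Phi (sflip z) = sflip (Phi z)].

Lemma fe_sym X Y : fe X Y -> fe Y X.
Proof.
case=> Phi [[cP [g [Pg gP cg]]] fP sP].
exists g; split.
- by split=> //; exists Phi.
- move=> w; have [phi [psi [mphi psiK e]]] := fP (g w).
  have phi_inj : injective phi.
    move=> r s e1; case: (ltgtP r s) => // /mphi; by rewrite e1 ltxx.
  exists psi, phi; split.
  + move=> r s rs; rewrite ltNge; apply/negP; rewrite le_eqVlt.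
    case/orP=> [/eqP h|/mphi]; last by rewrite !psiK ltNge (ltW rs).
    by move: rs; rewrite -[r]psiK -[s]psiK h ltxx.
  + by move=> r; apply: phi_inj; rewrite psiK.
  + move=> r; apply: (can_inj Pg); rewrite gP e psiK.
    by rewrite gP.
- by move=> w; apply: (can_inj Pg); rewrite sP !gP.
Qed.

Lemma homeo_comp (S T U : topologicalType) (f : S -> T) (g : T -> U) :
  homeomorphism f -> homeomorphism g -> homeomorphism (g \o f).
Proof.
case=> cf [f' [ff' f'f cf']] [cg [g' [gg' g'g cg']]]; split.
  by move=> x; apply: continuous_comp; [exact: cf|exact: cg].
exists (f' \o g'); split.
- by move=> x /=; rewrite gg' ff'.
- by move=> x /=; rewrite f'f g'g.
- by move=> x; apply: continuous_comp; [exact: cg'|exact: cf'].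
Qed.

Lemma fe_trans X Y Z : fe X Y -> fe Y Z -> fe X Z.
Proof.
case=> P [hP fP sP] [Q [hQ fQ sQ]]; exists (Q \o P); split.
- exact: homeo_comp.
- move=> z; have [f [f' [mf fK fe]]] := fP z; have [g [g' [mg gK ge]]] := fQ (P z).
  exists (g \o f), (f' \o g'); split.
  + by move=> r s /mf /mg.
  + by move=> r /=; rewrite fK gK.
  + by move=> r /=; rewrite fe ge.
- by move=> z /=; rewrite sP sQ.
Qed.

Lemma compact_homeo (S T : topologicalType) (f : S -> T) :
  compact [set: S] -> hausdorff_space T -> continuous f ->
  injective f -> (forall y, exists x, f x = y) -> homeomorphism f.
Proof.
move=> cS hT cf fi fs; split => //.
have /choice[g fg] := fs.
exists g; split => //; first by move=> x; apply: fi; rewrite fg.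
apply/continuous_closedP => A cA.
have -> : g @^-1` A = f @` A.
  apply/seteqP; split=> y /=; first by move=> Ay; exists (g y).
  by move=> [x Ax <-]; rewrite (_ : g (f x) = x) //; apply: fi; rewrite fg.
apply: compact_closed => //; apply: continuous_compact.
  exact: continuous_subspaceT.
exact: (subclosed_compact cA cS).
Qed.

End flow_eq.

(** * Time changes by an integer roof function *)

Section tower.
Variables (R : realType) (X Y : sys) (iota : pts X -> pts Y) (r : alph X -> nat).
Implicit Types (q : pts X) (t s : R) (n : int).

Hypothesis r_gt0 : forall a, (0 < r a)%N.
Hypothesis r_flip : forall a, r (flipl a) = r a.
Hypothesis iota_shift : forall q, iota (shift 1 q) = shift (r (sv q 0))%:Z (iota q).
Hypothesis iota_flip : forall q, iota (flip q) = flip (iota q).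
Hypothesis iota_cont : forall N, exists M, forall q q',
  agree M (sv q) (sv q') -> agree N (sv (iota q)) (sv (iota q')).
Hypothesis tower_inj : forall q q' (j j' : nat),
  (j < r (sv q 0))%N -> (j' < r (sv q' 0))%N ->
  shift j%:Z (iota q) = shift j'%:Z (iota q') -> q = q' /\ j = j'.
Hypothesis tower_surj : forall x, exists q (j : nat),
  (j < r (sv q 0))%N /\ x = shift j%:Z (iota q).

Let roof q n : int := (r (sv q n))%:Z.
Let rmax : nat := \max_a r a.

Let roofP q n : 1 <= roof q n <= rmax%:Z.
Proof. by rewrite /roof !lez_nat r_gt0 /= leq_bigmax. Qed.

Let hgt q n : int := csum (roof q) n.

Let hgt_shift m q n : hgt (shift m q) n = hgt q (m + n) - hgt q m.
Proof.
rewrite /hgt csumD addrAC subrr add0r; apply: eq_csum => i _.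
by rewrite /roof sv_shift addrC.
Qed.

Lemma iota_shiftn q n : iota (shift n q) = shift (hgt q n) (iota q).
Proof.
move: n; apply: int_ind => [|n e|n].
- by rewrite /hgt csum0 !shift0.
- by rewrite -shiftD iota_shift e shiftD /hgt csumS /roof sv_shift add0r.
- rewrite -shiftD iota_shift /hgt csumS -shiftD /roof sv_shift add0r.
  exact: shift_inj.
Qed.

(** The piecewise linear primitive of the roof: it converts time over [q] into time over [iota q],
    one unit over the letter [a] being stretched to length [r a]. *)
Let tau q t : R :=
  (hgt q (Num.floor t))%:~R + (t - (Num.floor t)%:~R) * (roof q (Num.floor t))%:~R.

Let tau_int q n t : n%:~R <= t <= n%:~R + 1 ->
  tau q t = (hgt q n)%:~R + (t - n%:~R) * (roof q n)%:~R.
Proof.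
move=> /andP[nt tn]; rewrite /tau.
have [tn1|tn1] := eqVneq t (n%:~R + 1).
  have -> : Num.floor t = n + 1.
    by rewrite tn1 -[1]/(1%:~R) -intrD intrKfloor.
  by rewrite tn1 -[1]/(1%:~R) -intrD /hgt csumS !intrD; ring.
have -> // : Num.floor t = n.
by apply: floor_def; rewrite nt intrD lt_neqAle tn1.
Qed.

Let tau_shift m q t : tau (shift m q) (t - m%:~R) = tau q t - (hgt q m)%:~R.
Proof.
have -> : t - m%:~R = t + (- m)%:~R by rewrite mulrNz.
rewrite /tau floorDrz ?intr_int // intrKfloor.
rewrite hgt_shift /roof sv_shift.
have e : m + (Num.floor t - m) = Num.floor t by lia.
rewrite ?e [_ - m + m]subrK !intrD !mulrNz.
ring.
Qed.

(** Slopes between 1 and [rmax] make [tau q] strictly increasing, Lipschitz and onto. *)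
Let tau_bounds q s t : s <= t -> t - s <= tau q t - tau q s <= rmax%:R * (t - s).
Proof.
have onestep n u v : n%:~R <= u -> u <= v -> v <= n%:~R + 1 ->
    v - u <= tau q v - tau q u <= rmax%:R * (v - u).
  move=> nu uv vn; rewrite !(@tau_int q n) ?nu ?vn ?(le_trans nu) ?(le_trans uv) //.
  have /andP[h1 h2] := roofP q n.
  have {}h1 : 1 <= (roof q n)%:~R :> R by rewrite -[1]/(1%:~R) ler_int.
  have {}h2 : (roof q n)%:~R <= rmax%:R :> R.
    by rewrite -[rmax%:R]/(rmax%:Z%:~R) ler_int.
  by apply/andP; split; nra.
move=> st; set m := Num.floor s; set n := Num.floor t.
have mn : m <= n by exact: le_floor.
have := floor_itv s; have := floor_itv t; rewrite -/m -/n !intrD mulr1z => /andP[nt tn] /andP[ms sm].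
have [mn1|mn1] := eqVneq m n.
  by apply: (onestep m) => //; rewrite mn1; lra.
have {mn1 mn} mn : m + 1 <= n by lia.
have mnR : (m + 1)%:~R <= n%:~R :> R by rewrite ler_int.
have /andP[a1 a2] : (m + 1)%:~R - s <= tau q (m + 1)%:~R - tau q s <= rmax%:R * ((m + 1)%:~R - s).
  by apply: (onestep m); rewrite ?intrD ?mulr1z //; lra.
have /andP[a3 a4] : t - n%:~R <= tau q t - tau q n%:~R <= rmax%:R * (t - n%:~R).
  by apply: (onestep n) => //; lra.
have tauz k : tau q k%:~R = (hgt q k)%:~R.
  by rewrite (@tau_int q k) ?lexx ?lerDl ?ler01 // subrr mul0r addr0.
have /andP[] := csum_bounds (roofP q) mn; rewrite -!/(hgt _ _).
rewrite -(ler_int R) -[_ <= rmax%:Z * _](ler_int R) !rmorphM !rmorphB /= -!tauz.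
rewrite mul1r -[rmax%:~R]/(rmax%:R) => a5 a6; apply/andP; split; nra.
Qed.

Let pre (p : pts X * R) : susp R Y := spi (iota p.1) (tau p.1 p.2).

Definition tower_map (z : susp R X) : susp R Y := pre (susp_repr z).

Lemma tower_mapE q t : tower_map (spi q t) = spi (iota q) (tau q t).
Proof.
rewrite /tower_map; have [q' [t' e]] : exists q' t', susp_repr (spi q t) = (q', t').
  by exists (susp_repr (spi q t)).1, (susp_repr (spi q t)).2; case: (susp_repr _).
have h : spi q' t' = spi q t by rewrite /spi -e susp_reprK.
rewrite e /pre /=; move/spi_eq: h => [n [-> ->]].
by rewrite iota_shiftn tau_shift spi_shift.
Qed.

Let tau_incr q s t : s < t -> tau q s < tau q t.
Proof. by move=> st; have /andP[] := tau_bounds q (ltW st); lra. Qed.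

Let tau0 q : tau q 0 = 0.
Proof.
by rewrite (@tau_int q 0) ?lexx ?lerDl ?ler01 // /hgt csum0 subrr mul0r addr0.
Qed.

Let tau_continuous q : continuous (tau q).
Proof.
move=> t; apply/cvgrPdist_lt => e e0; apply/nbhs_ballP.
exists (e / (rmax.+1)%:R) => [|s h]; first by rewrite /= divr_gt0.
have {}h : `|t - s| < e / (rmax.+1)%:R := h.
have r0 : 0 < rmax.+1%:R :> R by [].
move: h; rewrite ltr_pdivlMr // => h.
have n1 : rmax.+1%:R = rmax%:R + 1 :> R by rewrite -addn1 natrD.
have rm0 : 0 <= rmax%:R :> R by [].
have [st|/ltW st] := leP s t.
- have /andP[] := tau_bounds q st; rewrite n1 ger0_norm ?subr_ge0 // in h.
  by move=> h1 h2; rewrite ltr_norml; apply/andP; split; nra.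
- have /andP[] := tau_bounds q st; rewrite n1 distrC ger0_norm ?subr_ge0 // in h.
  by move=> h1 h2; rewrite ltr_norml; apply/andP; split; nra.
Qed.

Let tau_onto q u : exists t, tau q t = u.
Proof.
have u0 : 0 <= `|u| by [].
have [] := @IVT R (tau q) (- `|u|) `|u| u.
- by lra.
- exact/continuous_subspaceT/tau_continuous.
- rewrite ge_min le_max.
  have /andP[h1 _] : 0 - - `|u| <= tau q 0 - tau q (- `|u|) <= rmax%:R * (0 - - `|u|).
    by apply: tau_bounds; lra.
  have /andP[h2 _] : `|u| - 0 <= tau q `|u| - tau q 0 <= rmax%:R * (`|u| - 0).
    by apply: tau_bounds; lra.
  have /ler_normlP[h3 h4] := lexx `|u|; rewrite tau0 in h1 h2.
  by apply/andP; split; apply/orP; [left|right]; lra.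
by move=> t _ <-; exists t.
Qed.

(** The hypotheses present [Y] as a tower over [X] with roof [r]. Stretching time linearly is then a
    continuous bijection of suspensions, and compactness together with the Hausdorff property
    supplies the continuous inverse. *)
Lemma tower_fe : fe R X Y.
Proof.
exists tower_map; split.
- apply: compact_homeo.
  + exact: susp_compact.
  + exact: susp_hausdorff.
  + move=> z; have [q [t ->]] := spi_surj z; rewrite /continuous_at tower_mapE.
    move=> U /nbhs_suspP[N [e e0 NU]].
    have [M hM] := iota_cont N.
    apply/nbhs_suspP.
    have [d d0 hd] : exists2 d, 0 < d & forall s, `|s - t| < d -> `|tau q s - tau q t| < e.
      have /cvgrPdist_lt/(_ e e0)/nbhs_ballP[d /= d0 hd] := @tau_continuous q t.
      by exists d => // s st; rewrite distrC; apply: hd; rewrite /ball /= distrC.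
    (* For [s] within 1 of [t] the time change reads only letters at distance at most
       [|floor t| + 1], so it is the same for [q] and [q']. *)
    exists (maxn M (`|Num.floor t| + 2)%N); exists (Num.min d 1); first by rewrite lt_min d0 ltr01.
    move=> q' s qq'; rewrite lt_min => /andP[sd s1].
    rewrite /= tower_mapE; apply: NU.
      by apply: hM; apply: agreeW qq'; rewrite leq_maxl.
    rewrite (_ : tau q' s = tau q s); first exact: hd.
    have hf : (`|Num.floor s| <= `|Num.floor t| + 1)%N.
      move: s1; rewrite ltr_norml; have := floor_itv t; have := floor_itv s; rewrite !intrD mulr1z.
      move=> /andP[h1 h2] /andP[h3 h4] /andP[h5 h6].
      have : (Num.floor s)%:~R < (Num.floor t + 2)%:~R :> R by rewrite intrD -[2%:~R]/(2%:R : R); lra.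
      have : (Num.floor t)%:~R < (Num.floor s + 2)%:~R :> R by rewrite intrD -[2%:~R]/(2%:R : R); lra.
      by rewrite !ltr_int; lia.
    rewrite /tau /hgt (@eq_csum (roof q') (roof q)).
      by rewrite /roof [sv q' _](_ : _ = sv q (Num.floor s)) //; apply/esym/qq'; lia.
    by move=> i iN; rewrite /roof -qq' //; lia.
  + move=> z w; have [q [t [-> t01]]] := spi_surj_near z 0.
    have [q' [t' [-> t01']]] := spi_surj_near w 0.
    rewrite !tower_mapE !(@tau_int _ 0) /hgt ?csum0 ?subr0 ?add0r; [|lra..].
    rewrite add0r in t01 t01'.
    move=> /spi_eq[n [e1 e2]].
    (* The integer part of the stretched height is the level in the tower, to which [tower_inj]
       applies. *)
    have dig (u : R) (p : pts X) : 0 <= u < 1 -> exists j : nat,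
        (j < r (sv p 0))%N /\ Num.floor (u * (roof p 0)%:~R) = j%:Z.
      move=> /andP[u0 u1].
      have [r1 _] := andP (roofP p 0).
      have f0 : 0 <= Num.floor (u * (roof p 0)%:~R).
        by rewrite floor_ge0 mulr_ge0 // ler0z; lia.
      exists `|Num.floor (u * (roof p 0)%:~R)|%N; split; last by lia.
      rewrite -ltz_nat gez0_abs // floor_lt_int.
      by rewrite -[ltRHS]mul1r ltr_pM2r // ltr0z -/(roof p 0); lia.
    have [j [jr je]] := dig t q t01; have [j' [jr' je']] := dig t' q' t01'.
    have e3 : j%:Z = j'%:Z + n.
      by rewrite -je -je' e2 -[_ - n%:~R]/(_ + - n%:~R) -mulrNz floorDrz ?intr_int // intrKfloor subrK.
    have [] := @tower_inj q q' j j' jr jr'.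
      by rewrite e1 shiftD e3 addrC.
    move=> qq jj; subst q' j'.
    have n0 : n = 0 by lia.
    congr spi; move: e2; rewrite n0 subr0 => /mulIf -> //.
    by rewrite intr_eq0; have := roofP q 0; lia.
  + move=> z; have [x [t ->]] := spi_surj z.
    have [q [j [jr ->]]] := tower_surj x.
    have [u e] := tau_onto q (t + j%:Z%:~R).
    exists (spi q u); rewrite tower_mapE e; apply/spi_eq; exists j%:Z.
    by split=> //; ring.
- move=> z; have [q [t ->]] := spi_surj z.
  have [psi psiK] : exists psi, forall u, tau q (psi u) = u.
    by have /choice[psi h] := tau_onto q; exists psi.
  exists (fun u => tau q (t + u) - tau q t), (fun u => psi (u + tau q t) - t).
  split.
  + by move=> a b ab; have := @tau_incr q (t + a) (t + b); rewrite ltrD2l => /(_ ab); lra.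
  + by move=> u; rewrite [t + _]addrC subrK psiK addrK.
  + move=> u; rewrite sflowE !tower_mapE sflowE; congr spi; lra.
- move=> z; have [q [t ->]] := spi_surj z.
  rewrite sflipE !tower_mapE sflipE iota_flip; congr spi.
  have roof_flip : roof (flip q) = roof q.
    by apply/funext => n; rewrite /roof sv_flip r_flip.
  by rewrite /tau /hgt roof_flip.
Qed.

End tower.

(** * Substitutions *)

Section increasing_enumeration.
Implicit Types (c : int -> int) (m n t : int).

Lemma incr_lt c m n : (forall k, c k < c (k + 1)) -> m < n -> c m < c n.
Proof.
move=> ci mn; have [k ->] : exists k : nat, n = m + 1 + k%:Z.
  by exists (absz (n - m - 1)%R); lia.
elim: k => [|k IH]; first by rewrite addr0.
have -> : m + 1 + k.+1%:Z = m + 1 + k%:Z + 1 by lia.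
exact: (lt_trans IH).
Qed.

Lemma incr_lt_inv c m n : (forall k, c k < c (k + 1)) -> c m < c n -> m < n.
Proof.
move=> ci mn; rewrite ltNge; apply/negP; rewrite le_eqVlt => /orP[/eqP e|h].
  by move: mn; rewrite e ltxx.
by have := incr_lt ci h; lia.
Qed.

Lemma incr_loc c : (forall k, c k < c (k + 1)) -> c 0 = 0 ->
  forall t, exists n, c n <= t < c (n + 1).
Proof.
move=> ci c0; apply: int_ind => [|t [n h]|t [n h]].
- by exists 0; have := ci 0; lia.
- have [h1|h1] := leP (c (n + 1)) (t + 1); last by exists n; lia.
  by exists (n + 1); have := ci (n + 1); lia.
- have [h1|h1] := leP (c n) t; first by exists n; lia.
  by exists (n - 1); have := ci (n - 1); rewrite subrK; lia.
Qed.

Lemma incr_loc_uniq c m n t : (forall k, c k < c (k + 1)) ->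
  c m <= t < c (m + 1) -> c n <= t < c (n + 1) -> m = n.
Proof.
move=> ci hm hn; have : m < n + 1 by apply: (incr_lt_inv ci); lia.
have : n < m + 1 by apply: (incr_lt_inv ci); lia.
lia.
Qed.

Lemma incr_eq c d : (forall k, c k < c (k + 1)) -> (forall k, d k < d (k + 1)) ->
  c 0 = d 0 -> (forall n, exists m, c n = d m) -> (forall n, exists m, d n = c m) ->
  forall n, c n = d n.
Proof.
move=> ci di e0 cd dc.
have up (a b : int -> int) n : (forall k, a k < a (k + 1)) ->
    (forall k, b k < b (k + 1)) -> (forall n, exists m, a n = b m) ->
    a n = b n -> b (n + 1) <= a (n + 1).
  move=> ai bi ab en; have [m e] := ab (n + 1).
  have : n < m by apply: (incr_lt_inv bi); have := ai n; lia.
  rewrite e le_eqVlt; have [->|/eqP mn] := eqVneq m (n + 1); first by rewrite eqxx.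
  by move=> nm; rewrite (@incr_lt b) ?orbT //; lia.
have dn (a b : int -> int) n : (forall k, a k < a (k + 1)) ->
    (forall k, b k < b (k + 1)) -> (forall n, exists m, a n = b m) ->
    a (n + 1) = b (n + 1) -> a n <= b n.
  move=> ai bi ab en; have [m e] := ab n.
  have : m < n + 1 by apply: (incr_lt_inv bi); have := ai n; lia.
  rewrite e le_eqVlt; have [->|/eqP mn] := eqVneq m n; first by rewrite eqxx.
  by move=> nm; rewrite (@incr_lt b) ?orbT //; lia.
apply: (@int_ind (fun n => c n = d n)) => // n e; apply/eqP; rewrite eq_le.
  by rewrite (up d c n di ci dc (esym e)) (up c d n ci di cd e).
by rewrite (dn c d n ci di cd e) (dn d c n di ci dc (esym e)).
Qed.

Lemma incr_enum (P : int -> bool) : P 0 -> (forall t, exists k : nat, P (t + 1 + k%:Z)) ->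
  (forall t, exists k : nat, P (t - 1 - k%:Z)) ->
  exists c, [/\ c 0 = 0, forall k, c k < c (k + 1) & forall t, P t <-> exists n, t = c n].
Proof.
move=> P0 Pn Pp.
pose nx t := t + 1 + (ex_minn (Pn t))%:Z.
pose pv t := t - 1 - (ex_minn (Pp t))%:Z.
pose c n := match n with Posz k => iter k nx 0 | Negz k => iter k.+1 pv 0 end.
have nxP t : [/\ P (nx t), t < nx t & forall s, t < s -> P s -> nx t <= s].
  rewrite /nx; case: ex_minnP => k Pk kmin; split => //; first by lia.
  move=> s ts Ps; have := kmin (absz (s - t - 1)%R).
  by rewrite (_ : t + 1 + _ = s); [move=> /(_ Ps)|]; lia.
have pvP t : [/\ P (pv t), pv t < t & forall s, s < t -> P s -> s <= pv t].
  rewrite /pv; case: ex_minnP => k Pk kmin; split => //; first by lia.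
  move=> s ts Ps; have := kmin (absz (t - s - 1)%R).
  by rewrite (_ : t - 1 - _ = s); [move=> /(_ Ps)|]; lia.
have Pc n : P (c n).
  case: n => -[|k]; rewrite /c; [exact: P0|by have [] := nxP (iter k nx 0)|
    by have [] := pvP 0|by have [] := pvP (iter k.+1 pv 0)].
have cS n : c (n + 1) = nx (c n).
  case: n => k; first by rewrite -PoszD addn1.
  have nxpv t : P t -> nx (pv t) = t.
    move=> Pt; have [h1 h2 h3] := nxP (pv t); have [h4 h5 h6] := pvP t.
    apply/eqP; rewrite eq_le h3 //= leNgt; apply/negP => h.
    by have := h6 _ h h1; lia.
  case: k => [|k]; first by rewrite /= nxpv.
  have -> : Negz k.+1 + 1 = Negz k by rewrite !NegzE; lia.
  by rewrite /= nxpv //; exact: (Pc (Negz k)).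
have ci k : c k < c (k + 1) by rewrite cS; have [] := nxP (c k).
exists c; split => // t; split; last by move=> [n ->].
move=> Pt; have [n /andP[h1 h2]] := incr_loc ci (erefl : c 0 = 0) t.
exists n; move: h1; rewrite le_eqVlt => /orP[/eqP//|h1].
by have [_ _ /(_ t h1 Pt)] := nxP (c n); rewrite -cS; lia.
Qed.

End increasing_enumeration.

(* Each letter of [X] is expanded to a word of [Y] whose first letter is the
   only cut; conversely every point of [Y] is cut into such words. *)
Section substitution.
Variables (R : realType) (X Y : sys) (cut : pred (alph Y)).
Variables (hd : alph X -> alph Y) (tl : alph X -> seq (alph Y)).
Implicit Types (a b : alph X) (q : pts X) (x : pts Y) (t n : int).

Let r a := (size (tl a)).+1.
Let lt_ a j := nth (hd a) (hd a :: tl a) j.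

Hypothesis hd_cut : forall a, cut (hd a).
Hypothesis tl_cut : forall a, all (predC cut) (tl a).
Hypothesis tl_path : forall a, path (@adj Y) (hd a) (tl a).
Hypothesis adj_lw : forall a b, adj a b = adj (last (hd a) (tl a)) (hd b).
Hypothesis lw_inj : forall a b a' b', adj a a' -> adj b b' ->
  hd a = hd b -> tl a = tl b -> a = b.
Hypothesis parse : forall x, cut (sv x 0) -> exists a,
  (forall j : nat, (j < r a)%N -> sv x j%:Z = lt_ a j) /\ cut (sv x (r a)%:Z).
Hypothesis cut_past : forall x, exists j : nat, cut (sv x (- j%:Z)).
Hypothesis hd_flip : forall a, hd (flipl a) = flipl (hd a).
Hypothesis tl_flip : forall a, tl (flipl a) = map (@flipl Y) (tl a).

Let hgt q n : int := csum (fun n => (r (sv q n))%:Z) n.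

Let hgtS q n : hgt q (n + 1) = hgt q n + (r (sv q n))%:Z.
Proof. exact: csumS. Qed.

Let hgt0 q : hgt q 0 = 0.
Proof. exact: csum0. Qed.

Let hgt_incr q n : hgt q n < hgt q (n + 1).
Proof. by rewrite hgtS ltrDl ltz_nat. Qed.

Let loc_ex q t : exists n, hgt q n <= t < hgt q (n + 1).
Proof. exact: (incr_loc (hgt_incr q) (hgt0 q)). Qed.

Let loc q t : int := proj1_sig (cid (loc_ex q t)).

Let locP q t : hgt q (loc q t) <= t < hgt q (loc q t + 1).
Proof. exact: (proj2_sig (cid (loc_ex q t))). Qed.

Let expand q t : alph Y :=
  lt_ (sv q (loc q t)) `|t - hgt q (loc q t)|%N.

Let expandE q n (j : nat) : (j < r (sv q n))%N ->
  expand q (hgt q n + j%:Z) = lt_ (sv q n) j.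
Proof.
move=> jr; have e : loc q (hgt q n + j%:Z) = n.
  by apply: (incr_loc_uniq (hgt_incr q) (locP _ _)); rewrite hgtS; lia.
by rewrite /expand e; congr lt_; lia.
Qed.

Let expand_ind q (P : int -> Prop) :
  (forall n (j : nat), (j < r (sv q n))%N -> P (hgt q n + j%:Z)) -> forall t, P t.
Proof.
move=> h t; have := locP q t; rewrite hgtS => h1.
have := h (loc q t) `|t - hgt q (loc q t)|%N.
by rewrite (_ : hgt q (loc q t) + _ = t); [apply|]; lia.
Qed.

Let expand_adj q t : adj (expand q t) (expand q (t + 1)).
Proof.
move: t; apply: (@expand_ind q) => n j jr.
rewrite expandE // -addrA.
have [jr1|jr1] := ltnP j.+1 (r (sv q n)).
  rewrite (_ : j%:Z + 1 = j.+1%:Z) ?expandE //; last by lia.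
  have /pathP := tl_path (sv q n) => /(_ (hd (sv q n)) j); apply.
  by move: jr1; rewrite /r; lia.
have je : j = size (tl (sv q n)) by move: jr jr1; rewrite /r; lia.
rewrite (_ : hgt q n + (j%:Z + 1) = hgt q (n + 1) + 0%:Z); last first.
  by rewrite hgtS je /r; lia.
rewrite expandE // /lt_ /= je -/(lt_ _ _).
by rewrite /lt_ nth_last /= -adj_lw; exact: sv_adj.
Qed.

Let iota q : pts Y := mkpt (expand_adj q).

Let sv_iota q : sv (iota q) = expand q. Proof. by []. Qed.

Let expand_uniq q (f : int -> alph Y) :
  (forall n (j : nat), (j < r (sv q n))%N -> f (hgt q n + j%:Z) = lt_ (sv q n) j) ->
  f = expand q.
Proof.
move=> h; apply/funext; apply: (@expand_ind q) => n j jr.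
by rewrite h // expandE.
Qed.

Let cut_expand q t : cut (expand q t) <-> exists n, t = hgt q n.
Proof.
split; last first.
  by move=> [n ->]; rewrite -[hgt q n]addr0 (@expandE q n 0) //; exact: hd_cut.
move: t; apply: (@expand_ind q) => n [|j] jr; first by exists n; rewrite addr0.
rewrite expandE // /lt_ /= => h; exfalso.
have /(mem_nth (hd (sv q n)))/(allP (tl_cut (sv q n))) : (j < size (tl (sv q n)))%N by [].
by rewrite /= h.
Qed.

Let iota_shift q : iota (shift 1 q) = shift (r (sv q 0))%:Z (iota q).
Proof.
apply: sv_inj; apply/esym; rewrite [RHS]sv_iota; apply: expand_uniq => n j.
rewrite sv_shift !sv_shift => jr; rewrite sv_iota.
have e : hgt (shift 1 q) n = hgt q (n + 1) - (r (sv q 0))%:Z.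
  have -> : (r (sv q 0))%:Z = hgt q 1 by have := hgtS q 0; rewrite hgt0 !add0r.
  rewrite [n + 1]addrC /hgt csumD [X in _ = X]addrAC subrr add0r.
  by apply: eq_csum => i _; rewrite sv_shift addrC.
by rewrite e addrAC subrK expandE.
Qed.

Let iota_flip q : iota (flip q) = flip (iota q).
Proof.
apply: sv_inj; apply/esym; rewrite [RHS]sv_iota; apply: expand_uniq => n j.
rewrite sv_flip => jr; rewrite sv_flip sv_iota.
have rf a : r (flipl a) = r a by rewrite /r tl_flip size_map.
have -> : hgt (flip q) n = hgt q n.
  by apply: eq_csum => i _; rewrite sv_flip rf.
rewrite rf in jr; rewrite expandE // /lt_ hd_flip tl_flip.
by rewrite -[flipl _ :: _]/(map (@flipl Y) (hd (sv q n) :: tl (sv q n))) (nth_map (hd (sv q n))).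
Qed.

Let iota_cont N : exists M, forall q q',
  agree M (sv q) (sv q') -> agree N (sv (iota q)) (sv (iota q')).
Proof.
exists N.+1 => q q' qq' t tN; rewrite !sv_iota.
have := locP q t; set n := loc q t => ht.
(* Words are nonempty, so the word covering position [t] has an index at most [|t|] in absolute
   value. *)
have nN : (`|n| <= N)%N.
  have rb i : 1 <= (r (sv q i))%:Z <= (\max_a r a)%:Z by rewrite !lez_nat leq_bigmax.
  have [n0|n0] := leP 0 n.
    by have := csum_bounds rb n0; rewrite -!/(hgt _ _) hgt0; lia.
  have n1 : n + 1 <= 0 by lia.
  by have := csum_bounds rb n1; rewrite -!/(hgt _ _) hgt0; lia.
have hE : hgt q' n = hgt q n by apply: eq_csum => i iN; rewrite qq' //; lia.
have hn : sv q n = sv q' n by apply: qq'; lia.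
move: ht; rewrite hgtS => ht.
have [j je] : exists j : nat, t = hgt q n + j%:Z by exists `|t - hgt q n|%N; lia.
have jr : (j < r (sv q n))%N by lia.
by rewrite je expandE // -hE expandE -?hn.
Qed.

Let tower_inj q q' (j j' : nat) :
  (j < r (sv q 0))%N -> (j' < r (sv q' 0))%N ->
  shift j%:Z (iota q) = shift j'%:Z (iota q') -> q = q' /\ j = j'.
Proof.
(* If the levels differed, the cut at the start of [p] would fall strictly inside the first word of
   [p']. *)
have aux p p' (i i' : nat) : (i' < r (sv p' 0))%N ->
    shift i%:Z (iota p) = shift i'%:Z (iota p') -> ~ (i < i')%N.
  move=> ir e ii; have /cut_expand : exists n, 0 = hgt p n by exists 0.
  have := congr1 (fun x => sv x (- i%:Z)) e; rewrite !sv_shift !sv_iota addNr => ->.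
  have -> : - i%:Z + i'%:Z = hgt p' 0 + (i' - i)%N%:Z by rewrite hgt0; lia.
  move=> /cut_expand[n]; rewrite hgt0 add0r => h.
  have n1 : 0 < n by apply: (incr_lt_inv (hgt_incr p')); rewrite hgt0; lia.
  have : n < 0 + 1.
    apply: (incr_lt_inv (hgt_incr p')).
    by rewrite hgtS hgt0 -h add0r ltz_nat; exact: leq_ltn_trans (leq_subr _ _) ir.
  by lia.
move=> jr jr' e.
have ej : j = j'.
  by have := aux _ _ _ _ jr' e; have := aux _ _ _ _ jr (esym e); lia.
split=> //; subst j'; have {}e : expand q = expand q'.
  by rewrite -!sv_iota; congr sv; exact: shift_inj e.
have hh : forall n, hgt q n = hgt q' n.
  apply: incr_eq => //; rewrite ?hgt0 // => n.
    by apply/cut_expand; rewrite -e; apply/cut_expand; exists n.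
  by apply/cut_expand; rewrite e; apply/cut_expand; exists n.
apply: sv_inj; apply/funext => n.
have rr : r (sv q n) = r (sv q' n).
  by have := hh (n + 1); rewrite !hgtS hh; lia.
have lt_e i : (i < r (sv q n))%N -> lt_ (sv q n) i = lt_ (sv q' n) i.
  by move=> ir; rewrite -!expandE -?rr // e hh.
apply: (lw_inj (sv_adj q n) (sv_adj q' n)); first exact: (lt_e 0).
apply: (@eq_from_nth _ (hd (sv q n))); first by case: rr.
move=> i ir; have := lt_e i.+1 ir; rewrite /lt_ /= => ->.
by apply: set_nth_default; case: rr => <-.
Qed.

Let cut_future x : cut (sv x 0) -> exists k : nat, cut (sv x (1 + k%:Z)).
Proof.
by move=> /parse[a [_]]; rewrite /r intS => h; exists (size (tl a)).
Qed.

Let tower_surj x : exists q (j : nat), (j < r (sv q 0))%N /\ x = shift j%:Z (iota q).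
Proof.
have [j cj jmin] := ex_minnP (cut_past x).
pose y := shift (- j%:Z) x.
have y0 : cut (sv y 0) by rewrite sv_shift add0r.
have past t : exists k : nat, cut (sv y (t - 1 - k%:Z)).
  have [k h] := cut_past (shift (t - 1) y); exists k.
  by move: h; rewrite sv_shift addrC.
(* Start from a cut before [t + 1] and follow the parsed words: each one shortens the remaining
   distance until a cut beyond [t] is met. *)
have future t : exists k : nat, cut (sv y (t + 1 + k%:Z)).
  have [k h] := past (t + 1); rewrite addrK in h.
  suff [i [h1 h2]] : exists i, t < i /\ cut (sv y i).
    by exists (absz (i - t - 1)%R); rewrite (_ : t + 1 + _ = i) //; lia.
  elim/ltn_ind: k h => k IH h.
  have c0 : cut (sv (shift (t - k%:Z) y) 0) by rewrite sv_shift add0r.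
  have [m] := cut_future c0; rewrite sv_shift => hm.
  have [mk|mk] := ltnP k m.+1; first by exists (1 + m%:Z + (t - k%:Z)); split => //; lia.
  apply: (IH (k - m.+1)%N); first by lia.
  by move: hm; congr (cut (sv y _)); lia.
have [c [c0 ci cP]] := @incr_enum (fun t => cut (sv y t)) y0 future past.
have cutc n : cut (sv (shift (c n) y) 0).
  by rewrite sv_shift add0r; apply/cP; exists n.
have /choice[f fP] : forall n, exists a,
    [/\ forall i : nat, (i < r a)%N -> sv y (c n + i%:Z) = lt_ a i & c (n + 1) = c n + (r a)%:Z].
  move=> n; have [a [h1 h2]] := parse (cutc n); exists a; split.
    by move=> i /h1 <-; rewrite sv_shift addrC.
  move: h2; rewrite sv_shift => /cP[m hm].
  have mn : n < m by apply: (incr_lt_inv ci); rewrite -hm ltrDr ltz_nat.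
  have [/eqP nm|nm] := eqVneq m (n + 1); first by rewrite -(eqP nm) -hm addrC.
  have h3 : n + 1 < m by lia.
  have := incr_lt ci h3; rewrite -hm => h4; have h5 := ci n.
  have h6 : (`|c (n + 1)%R - c n| < r a)%N by lia.
  have := h1 _ h6; rewrite sv_shift (_ : _ + c n = c (n + 1)); last by lia.
  have : cut (sv y (c (n + 1))) by apply/cP; exists (n + 1).
  move=> + e; rewrite e; case e' : `|_|%N => [|i]; first by lia.
  rewrite /lt_ /= => h; have /(mem_nth (hd a))/(allP (tl_cut a)) : (i < size (tl a))%N.
    by move: h6; rewrite e' /r; lia.
  by rewrite /= h.
have fadj n : adj (f n) (f (n + 1)).
  have [h1 h2] := fP n; have [h3 _] := fP (n + 1).
  rewrite adj_lw; have := h1 (size (tl (f n))) (ltnSn _).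
  rewrite /lt_ -[X in nth _ _ X]/((size (hd (f n) :: tl (f n))).-1) nth_last /= => <-.
  have := h3 0 (ltn0Sn _); rewrite /lt_ addr0 /= => <-.
  by have := sv_adj y (c n + (size (tl (f n)))%:Z); rewrite -addrA h2 /r; congr (adj _ (sv _ (_ + _))); lia.
pose q := mkpt fadj; exists q, j.
have hc n : c n = hgt q n.
  by apply: csum_uniq => // m; have [] := fP m.
have yq : y = iota q.
  apply: sv_inj; rewrite sv_iota; apply: expand_uniq => n i ir.
  by have [h _] := fP n; rewrite -hc h.
split; last by rewrite -yq shiftD addNr shift0.
(* A first word of length at most [j] would end at a cut that is nearer to 0 than the chosen one but
   not beyond it. *)
rewrite ltnNge; apply/negP => rj.
have {}rj : (r (f 0) <= j)%N := rj.
have := jmin (j - r (f 0))%N; suff h : cut (sv x (- (j - r (f 0))%N%:Z)).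
  have r0 : (0 < r (f 0))%N by [].
  by move=> /(_ h); move: rj r0; move: (r (f 0)) => k; lia.
have : cut (sv y (c 1)) by apply/cP; exists 1.
have [_] := fP 0; rewrite add0r => ->; rewrite c0 add0r sv_shift.
by congr (cut (sv x _)); move: rj; move: (r (f 0)) => k; lia.
Qed.

Theorem substitution_fe : fe R X Y.
Proof.
apply: (@tower_fe R X Y iota r) => //.
by move=> a; rewrite /r tl_flip size_map.
Qed.

End substitution.

(** * Loop systems *)

Section sft.
Variables (E : finType) (A : rel E) (th : E -> E).
Hypothesis A_th : forall e f, A e f -> A (th e) (th f).

Definition sft_pts : set {ptws int -> discrete_topology E} :=
  [set x | forall i, A (x i) (x (i + 1))].

Fact sft_step_subproof (x : sft_pts) :
  (fun i => set_val x (i + 1)) \in sft_pts.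
Proof. by apply/mem_set => i; have := set_mem (valP x); exact. Qed.

Fact sft_flip_subproof (x : sft_pts) : (fun i => th (set_val x i)) \in sft_pts.
Proof. by apply/mem_set => i; apply: A_th; have := set_mem (valP x); exact. Qed.

Definition sft : sys := @Sys E sft_pts A
  (fun x => SigSub (sft_step_subproof x)) (fun x => SigSub (sft_flip_subproof x))
  th (fun=> conj id id) (fun _ _ => erefl) (fun _ _ => erefl).

End sft.

(* Vertices [inl false] = A, [inl true] = B, [inr b] = C_b.  The letters
   [inl (inl o)], [inl (inr o)], [inr (b, o)] start at A, B, C_b; for
   [o = None] they lead to B, B, C_b and for [o = Some _] to A. *)
Section loop_system.
Variables J I : finType.

Definition qalph : finType := ((option J + option I) + bool * option I)%type.

Definition qsrc (e : qalph) : bool + bool :=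
  match e with inl (inl _) => inl false | inl (inr _) => inl true | inr (b, _) => inr b end.

Definition qtgt (e : qalph) : bool + bool :=
  match e with
  | inl (inl (Some _)) | inl (inr (Some _)) | inr (_, Some _) => inl false
  | inr (b, None) => inr b
  | _ => inl true
  end.

Definition qadj : rel qalph := fun e f => qtgt e == qsrc f.

Definition qflip (e : qalph) : qalph :=
  match e with inr (b, o) => inr (~~ b, o) | _ => e end.

Fact qadj_flip e f : qadj e f -> qadj (qflip e) (qflip f).
Proof.
by move: e f => [[[j|]|[i|]]|[b [i|]]] [[[j'|]|[i'|]]|[b' [i'|]]] //=;
  rewrite /qadj /= => /eqP // -[->].
Qed.

Definition loop_sys : sys := sft qadj_flip.

Definition yalph : finType := (option I + bool * option I)%type.

Definition yadj : rel yalph := fun e f =>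
  match e, f with
  | inl _, inl _ | inr (_, Some _), inl _ => true
  | inr (b, None), inr (b', _) => b == b'
  | _, _ => false
  end.

Definition yflip (e : yalph) : yalph :=
  match e with inr (b, o) => inr (~~ b, o) | _ => e end.

Fact yadj_flip e f : yadj e f -> yadj (yflip e) (yflip f).
Proof. by move: e f => [e|[b [i|]]] [f|[b' [i'|]]] //= /eqP ->. Qed.

(* The full shift on [option I] together with two copies, labelled by a boolean,
   of the points that are left asymptotic to the fixed point [None]. *)
Definition tail_sys : sys := sft yadj_flip.

End loop_system.

Section flow_moves.
Variable R : realType.

(** Injectivity is required only of letters that have a successor, so that letters occurring in no
    point may all share one image. *)
Lemma relabel_fe (X Y : sys) (f : alph X -> alph Y) :
  (forall a b a' b', adj a a' -> adj b b' -> f a = f b -> a = b) ->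
  (forall a b, adj (f a) (f b) = adj a b) ->
  (forall x : pts Y, exists a, sv x 0 = f a) ->
  (forall a, f (flipl a) = flipl (f a)) -> fe R X Y.
Proof.
move=> fi fadj fs ff.
apply: (@substitution_fe R X Y predT f (fun=> [::])) => //.
- by move=> a b /=; rewrite fadj.
- by move=> a b a' b' aa bb ab _; exact: (fi a b a' b').
- by move=> x _; have [a xa] := fs x; exists a; split=> // -[].
- by move=> x; exists 0.
Qed.

Lemma loop_sys_relabel (J J' I I' : finType) :
  #|J| = #|J'| -> #|I| = #|I'| -> fe R (loop_sys J I) (loop_sys J' I').
Proof.
move=> eJ eI.
have bij (T T' : finType) : #|T| = #|T'| -> exists2 f : T -> T', injective f &
    forall y, exists x, y = f x.
  move=> e; exists (fun x => enum_val (cast_ord e (enum_rank x))).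
    by move=> x y /enum_val_inj /cast_ord_inj /enum_rank_inj.
  move=> y; exists (enum_val (cast_ord (esym e) (enum_rank y))).
  by rewrite enum_valK cast_ordKV enum_rankK.
have [f fi fs] := bij _ _ eJ; have [h hi hs] := bij _ _ eI.
pose F (e : qalph J I) : qalph J' I' :=
  match e with
  | inl (inl o) => inl (inl (omap f o)) | inl (inr o) => inl (inr (omap h o))
  | inr (b, o) => inr (b, omap h o)
  end.
apply: (@relabel_fe (loop_sys J I) (loop_sys J' I') F).
- move=> [[[j|]|[i|]]|[b [i|]]] [[[j'|]|[i'|]]|[b' [i'|]]] ? ? _ _ //=.
  + by move=> [] /fi ->.
  + by move=> [] /hi ->.
  + by move=> [] -> /hi ->.
  + by move=> [] ->.
- by move=> [[[j|]|[i|]]|[b [i|]]] [[[j'|]|[i'|]]|[b' [i'|]]].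
- move=> x; case: (sv x 0) => [[[j|]|[i|]]|[b [i|]]].
  + by have [j' ->] := fs j; exists (inl (inl (Some j'))).
  + by exists (inl (inl None)).
  + by have [i' ->] := hs i; exists (inl (inr (Some i'))).
  + by exists (inl (inr None)).
  + by have [i' ->] := hs i; exists (inr (b, Some i')).
  + by exists (inr (b, None)).
- by move=> [[[j|]|[i|]]|[b [i|]]].
Qed.

(* Merging the exit [i0] with the letter before it: from A it becomes a new
   loop at A, after the loop at B it becomes the new exit [i0]. *)
Lemma loop_sys_option (J I : finType) (i0 : I) :
  fe R (loop_sys (option J) I) (loop_sys J I).
Proof.
pose e0 : qalph J I := inl (inr (Some i0)).
pose hd (a : qalph (option J) I) : qalph J I :=
  match a with
  | inl (inl (Some (Some j))) => inl (inl (Some j))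
  | inl (inl _) => inl (inl None)
  | inl (inr (Some i)) => if i == i0 then inl (inr None) else inl (inr (Some i))
  | inl (inr None) => inl (inr None)
  | inr x => inr x
  end.
pose tl (a : qalph (option J) I) : seq (qalph J I) :=
  match a with
  | inl (inl (Some None)) => [:: e0]
  | inl (inr (Some i)) => if i == i0 then [:: e0] else [::]
  | _ => [::]
  end.
apply: (@substitution_fe R (loop_sys (option J) I) (loop_sys J I)
  (fun e => e != e0) hd tl).
- move=> [[[[j|]|]|[i|]]|[b [i|]]] //=.
  by case: (eqVneq i i0) => // ii; rewrite /e0; apply/eqP => -[] /eqP; apply/negP.
- move=> [[[[j|]|]|[i|]]|[b [i|]]] //=; first by rewrite eqxx.
  by case: (eqVneq i i0) => //= _; rewrite eqxx.
- move=> [[[[j|]|]|[i|]]|[b [i|]]] //=.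
  by case: (eqVneq i i0).
- move=> a b; have lastE : qtgt (last (hd a) (tl a)) = qtgt a.
    by move: a => [[[[j|]|]|[i|]]|[b' [i|]]] //=; case: (eqVneq i i0).
  have hdE : qsrc (hd b) = qsrc b.
    by move: b => [[[[j|]|]|[i|]]|[b' [i|]]] //=; case: (eqVneq i i0).
  by rewrite /= /qadj lastE hdE.
- pose dec (h : qalph J I) (t : seq (qalph J I)) : qalph (option J) I :=
    match h, t with
    | inl (inl None), [::] => inl (inl None)
    | inl (inl None), _ => inl (inl (Some None))
    | inl (inr None), [::] => inl (inr None)
    | inl (inr None), _ => inl (inr (Some i0))
    | inl (inl (Some j)), _ => inl (inl (Some (Some j)))
    | inl (inr (Some i)), _ => inl (inr (Some i))
    | inr y, _ => inr y
    end.
  have hdK a : dec (hd a) (tl a) = a.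
    by move: a => [[[[j|]|]|[i|]]|[b [i|]]] //=; case: (eqVneq i i0) => [->|].
  by move=> a b a' b' _ _ e1 e2; rewrite -(hdK a) e1 e2 hdK.
- move=> x x0.
  have := sv_adj x 0; rewrite /= add0r; set e := sv x 0 in x0 *; set f := sv x 1.
  rewrite /qadj; have [fe0|fe0] := eqVneq f e0.
    have x2 : sv x 2 != e0.
      have := sv_adj x 1; rewrite (fe0 : sv x 1 = e0) /= /qadj /=.
      by case: (eqVneq (sv x (1 + 1)) e0) => [->|].
    have two : forall j : nat, (j < 2)%N -> j = 0 \/ j = 1 by move=> [|[]] //; [left|right].
    rewrite fe0 /= => /eqP; case ee : e => [[[j|]|[i|]]|[b [i|]]] // _.
    + exists (inl (inl (Some None))) => /=; split => // j /two[->|->] /=; [exact: ee|exact: fe0].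
    + exists (inl (inr (Some i0))) => /=; rewrite eqxx /=; split => // j /two[->|->] /=; [exact: ee|exact: fe0].
  have one : forall j : nat, (j < 1)%N -> j = 0 by case.
  move=> _; exists (match e with
    | inl (inl (Some j)) => inl (inl (Some (Some j))) | inl (inl None) => inl (inl None)
    | inl (inr o) => inl (inr o) | inr y => inr y end).
  case ee : e x0 => [[[j|]|[i|]]|[b [i|]]] /= x0; rewrite -/f; split => //.
  1,2,5,6,7: by move=> j' /one ->; exact: ee.
  + have -> : (i == i0) = false by apply/eqP => ii; move: x0; rewrite ii eqxx.
    by move=> j' /one ->; exact: ee.
  + by have -> : (i == i0) = false by apply/eqP => ii; move: x0; rewrite ii eqxx.
- move=> x; have [x0|x0] := eqVneq (sv x 0) e0; last by exists 0.
  exists 1%N; have := sv_adj x (- 1); rewrite /= addNr x0 /qadj /=.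
  by case: (eqVneq (sv x (- 1)) e0) => [->|].
- by move=> [[[[j|]|]|[i|]]|[b [i|]]] //=; case: (eqVneq i i0).
- by move=> [[[[j|]|]|[i|]]|[b [i|]]] //=; case: (eqVneq i i0).
Qed.

Lemma loop_sys_void (J I : finType) : (0 < #|I|)%N ->
  fe R (loop_sys J I) (loop_sys void 'I_#|I|).
Proof.
case/card_gt0P => i0 _.
have red (n : nat) : fe R (loop_sys 'I_n I) (loop_sys void 'I_#|I|).
  elim: n => [|n IH].
    by apply: loop_sys_relabel; rewrite card_ord ?card_void.
  apply: fe_trans IH; apply: fe_trans (loop_sys_option 'I_n i0).
  by apply: loop_sys_relabel; rewrite // card_option !card_ord.
apply: fe_trans (red #|J|).
by apply: loop_sys_relabel; rewrite // card_ord.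
Qed.

(** Without loops at A, the only letter starting there is [e0]; it is glued to the end of every
    letter that leads to A. *)
Lemma tail_sys_fe (I : finType) : fe R (tail_sys I) (loop_sys void I).
Proof.
pose e0 : qalph void I := inl (inl None).
pose hd (a : yalph I) : qalph void I :=
  match a with inl o => inl (inr o) | inr x => inr x end.
pose tl (a : yalph I) : seq (qalph void I) :=
  match a with inl (Some _) | inr (_, Some _) => [:: e0] | _ => [::] end.
apply: (@substitution_fe R (tail_sys I) (loop_sys void I) (fun e => e != e0) hd tl).
- by move=> [o|[b o]].
- by move=> [[i|]|[b [i|]]] //=; rewrite eqxx.
- by move=> [[i|]|[b [i|]]].
- by move=> [[i|]|[b [i|]]] [[i'|]|[b' [i'|]]].
- by move=> [[i|]|[b [i|]]] [[i'|]|[b' [i'|]]] ? ? _ _ //= [] // -> // ->.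
- move=> x x0.
  have := sv_adj x 0; rewrite /= add0r => /eqP; set e := sv x 0 in x0 *; set f := sv x 1.
  have one : forall j : nat, (j < 1)%N -> j = 0 by case.
  have two : forall j : nat, (j < 2)%N -> j = 0 \/ j = 1 by move=> [|[]] //; [left|right].
  have x2 : f = e0 -> sv x 2 != e0.
    move=> fe0; have := sv_adj x 1; rewrite (fe0 : sv x 1 = e0) /= /qadj /=.
    by case: (eqVneq (sv x (1 + 1)) e0) => [->|].
  case ee : e x0 => [[[[]|]|[i|]]|[b [i|]]] /=.
  + by move=> /eqP.
  + case ff : f x2 => [[[[]|]|[i'|]]|[b' [i'|]]] // /(_ erefl) x2 _ _.
    exists (inl (Some i)) => /=; split => // j /two[->|->] /=; [exact: ee|exact: ff].
  + case ff : f => [[[[]|]|[i'|]]|[b' [i'|]]] // _ _;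
      (exists (inl None) => /=; split => [j /one ->|]; [exact: ee|by rewrite (ff : sv x 1 = _)]).
  + case ff : f x2 => [[[[]|]|[i'|]]|[b' [i'|]]] // /(_ erefl) x2 _ _.
    exists (inr (b, Some i)) => /=; split => // j /two[->|->] /=; [exact: ee|exact: ff].
  + case ff : f => [[[[]|]|[i'|]]|[b' [i'|]]] // _ _;
      (exists (inr (b, None)) => /=; split => [j /one ->|]; [exact: ee|by rewrite (ff : sv x 1 = _)]).
- move=> x; have [x0|x0] := eqVneq (sv x 0) e0; last by exists 0.
  exists 1%N; have := sv_adj x (- 1); rewrite /= addNr x0 /qadj /=.
  by case: (eqVneq (sv x (- 1)) e0) => [->|].
- by move=> [[i|]|[b [i|]]].
- by move=> [[i|]|[b [i|]]].
Qed.

End flow_moves.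

(** * Chains of states as a loop system *)

Section standard_system.
Variables (k : nat) (g : nat -> 'I_k) (n p : nat).
Hypotheses (n_gt0 : (0 < n)%N) (p_gt0 : (0 < p)%N).

(* The vertices of the loop system name three kinds of chains: the transient
   part A of the graph, its loop B, and two more copies C_b of the loop.  A state
   is a chain together with a depth. *)
Definition chlen (c : bool + bool) : nat := if c is inl false then n else p.

Definition chdigit (c : bool + bool) (d : nat) : 'I_k :=
  g (if c is inl false then d else n + d)%N.

Definition chsucc (c : bool + bool) : bool + bool :=
  if c is inl false then inl true else c.

Definition chnext (c : bool + bool) (d : nat) (a : 'I_k) : (bool + bool) * nat :=
  if (a < chdigit c d)%N then (inl false, 0%N)
  else if (d.+1 < chlen c)%N then (c, d.+1) else (chsucc c, 0%N).

Definition salph : finType := ((bool + bool) * 'I_(n + p).+1 * 'I_k)%type.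

Definition svalid (e : salph) : bool :=
  (e.1.2 < chlen e.1.1)%N && (e.2 <= chdigit e.1.1 e.1.2)%N.

Definition sadj : rel salph := fun e f =>
  [&& svalid e, svalid f & (f.1.1, f.1.2 : nat) == chnext e.1.1 e.1.2 e.2].

Definition chflip (c : bool + bool) : bool + bool :=
  if c is inr b then inr (~~ b) else c.

Definition sflipl (e : salph) : salph := (chflip e.1.1, e.1.2, e.2).

Lemma chlen_flip c : chlen (chflip c) = chlen c.
Proof. by case: c => -[]. Qed.

Lemma chdigit_flip c d : chdigit (chflip c) d = chdigit c d.
Proof. by case: c => -[]. Qed.

Lemma chnext_flip c d a :
  chnext (chflip c) d a = (chflip (chnext c d a).1, (chnext c d a).2).
Proof.
rewrite /chnext chdigit_flip chlen_flip; case: ifP => // _.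
by case: ifP => // _; case: c => -[].
Qed.

Lemma svalid_flip e : svalid (sflipl e) = svalid e.
Proof. by rewrite /svalid /= chlen_flip chdigit_flip. Qed.

Fact sadj_flip e f : sadj e f -> sadj (sflipl e) (sflipl f).
Proof.
rewrite /sadj !svalid_flip => /and3P[-> -> /eqP h] /=.
by rewrite chnext_flip -h.
Qed.

Definition std_sys : sys := sft sadj_flip.

Definition loop_falls : finType := {x : 'I_p * 'I_k | (x.2 < g (n + x.1))%N}.
Definition trans_falls : finType := {x : 'I_n * 'I_k | (x.2 < g x.1)%N}.

Let qa := qalph trans_falls loop_falls.

(** A letter of the loop system stands for a run along one chain from depth 0. It reads the largest
    digits up to depth [qdepth], where it falls by the digit [qlab] or, for [None], completes the
    chain. *)
Let qdepth (e : qa) : nat :=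
  match e with
  | inl (inl (Some x)) => (val x).1
  | inl (inr (Some x)) | inr (_, Some x) => (val x).1
  | inl (inl None) => n.-1
  | _ => p.-1
  end.

Let qlab (e : qa) : 'I_k :=
  match e with
  | inl (inl (Some x)) => (val x).2
  | inl (inr (Some x)) | inr (_, Some x) => (val x).2
  | _ => chdigit (qsrc e) (qdepth e)
  end.

Let qletter (e : qa) (t : nat) : salph :=
  (qsrc e, inord t, if t == qdepth e then qlab e else chdigit (qsrc e) t).

Let qdepth_lt e : (qdepth e < chlen (qsrc e))%N.
Proof.
move: e => [[[[[m a] h]|]|[[[m a] h]|]]|[b [[[m a] h]|]]] //=; by rewrite prednK.
Qed.

Let chlen_le c : (chlen c <= n + p)%N.
Proof. by case: c => -[] /=; rewrite ?leq_addl ?leq_addr. Qed.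

Let qletter_depth e t : (t <= qdepth e)%N -> (qletter e t).1.2 = t :> nat.
Proof.
by move=> te /=; rewrite inordK //; have := qdepth_lt e; have := chlen_le (qsrc e); lia.
Qed.

Let qlab_le e : (qlab e <= chdigit (qsrc e) (qdepth e))%N.
Proof.
by move: e => [[[[[m a] h]|]|[[[m a] h]|]]|[b [[[m a] h]|]]] //=; exact: ltnW.
Qed.

Let qletter_valid e t : (t <= qdepth e)%N -> svalid (qletter e t).
Proof.
move=> te; rewrite /svalid qletter_depth // (leq_ltn_trans te (qdepth_lt e)) /=.
by case: eqP => [->|//]; exact: qlab_le.
Qed.

Let qnext_end e : chnext (qsrc e) (qdepth e) (qlab e) = (qtgt e, 0%N).
Proof.
rewrite /chnext; move: e => [[[[[m a] h]|]|[[[m a] h]|]]|[b [[[m a] h]|]]] //=;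
  by rewrite ?h // ltnn prednK // ltnn.
Qed.

Let qnext_run e t : (t < qdepth e)%N ->
  chnext (qsrc e) t (chdigit (qsrc e) t) = (qsrc e, t.+1).
Proof.
by move=> te; rewrite /chnext ltnn (leq_ltn_trans te (qdepth_lt e)).
Qed.

Let qsrc_depth_inj e f : qsrc e = qsrc f -> qdepth e = qdepth f ->
  qlab e = qlab f -> e = f.
Proof.
have vi (T : finType) (P : pred T) (x y : {z | P z}) : val x = val y -> x = y.
  exact: val_inj.
have pe m (x y : 'I_m * 'I_k) : x.1 = y.1 :> nat -> x.2 = y.2 -> x = y.
  by move: x y => [a b] [a' b'] /= /val_inj -> ->.
move: e f => [[[x|]|[x|]]|[b [x|]]] [[[y|]|[y|]]|[b' [y|]]] //=.
- move=> _ h1 h2; congr (inl (inl (Some _))); exact/vi/pe.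
- by move=> _ h1 h2; have := valP x; rewrite /= h2 h1 /chdigit /= ltnn.
- by move=> _ h1 h2; have := valP y; rewrite /= -h2 -h1 /chdigit /= ltnn.
- move=> _ h1 h2; congr (inl (inr (Some _))); exact/vi/pe.
- by move=> _ h1 h2; have := valP x; rewrite /= h2 h1 /chdigit /= ltnn.
- by move=> _ h1 h2; have := valP y; rewrite /= -h2 -h1 /chdigit /= ltnn.
- move=> [->] h1 h2; congr (inr (_, Some _)); exact/vi/pe.
- by move=> _ h1 h2; have := valP x; rewrite /= h2 h1 /chdigit /= ltnn.
- by move=> _ h1 h2; have := valP y; rewrite /= -h2 -h1 /chdigit /= ltnn.
- by move=> [->].
Qed.

Let qfall c m (a : 'I_k) : (m < chlen c)%N -> (a < chdigit c m)%N ->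
  exists e : qa, [/\ qsrc e = c, qdepth e = m & qlab e = a].
Proof.
move: c => [[]|b] /= mc am.
- have h : ((Ordinal mc, a).2 < g (n + (Ordinal mc, a).1))%N by [].
  by exists (inl (inr (Some (exist (fun x : 'I_p * 'I_k => x.2 < g (n + x.1))%N _ h)))).
- have h : ((Ordinal mc, a).2 < g ((Ordinal mc, a).1))%N by [].
  by exists (inl (inl (Some (exist (fun x : 'I_n * 'I_k => x.2 < g x.1)%N _ h)))).
- have h : ((Ordinal mc, a).2 < g (n + (Ordinal mc, a).1))%N by [].
  by exists (inr (b, Some (exist (fun x : 'I_p * 'I_k => x.2 < g (n + x.1))%N _ h))).
Qed.

Let qrun c : exists e : qa,
  [/\ qsrc e = c, qdepth e = (chlen c).-1 & qlab e = chdigit c (chlen c).-1].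
Proof.
by move: c => [[]|b]; [exists (inl (inr None))|exists (inl (inl None))|exists (inr (b, None))].
Qed.

Let salph_ext (u v : salph) :
  u.1.1 = v.1.1 -> u.1.2 = v.1.2 :> nat -> u.2 = v.2 -> u = v.
Proof. by move: u v => [[c d] a] [[c' d'] a'] /= -> /val_inj -> ->. Qed.

Lemma loop_std_fe (R : realType) : fe R (loop_sys trans_falls loop_falls) std_sys.
Proof.
pose cut (e : salph) := e.1.2 == 0%N :> nat.
pose tl (e : qa) := [seq qletter e t | t <- iota 1 (qdepth e)].
have ltE (e : qa) j : (j < (size (tl e)).+1)%N ->
    nth (qletter e 0) (qletter e 0 :: tl e) j = qletter e j.
  rewrite size_map size_iota; case: j => // j jm.
  by rewrite /= (nth_map 0%N) ?size_iota // nth_iota.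
have lastE (e : qa) : last (qletter e 0) (tl e) = qletter e (qdepth e).
  rewrite -[LHS](nth_last (qletter e 0) (qletter e 0 :: tl e)) /=.
  by rewrite ltE // size_map size_iota.
apply: (@substitution_fe R (loop_sys trans_falls loop_falls) std_sys cut
  (fun e => qletter e 0) tl).
- by move=> e; rewrite /cut qletter_depth.
- move=> e; apply/allP => _ /mapP[t + ->]; rewrite mem_iota => /andP[t0 te].
  by rewrite /= /cut qletter_depth; lia.
- move=> e; apply/(pathP (qletter e 0)) => j jt.
  rewrite (ltE e j) ?(leqW jt) //.
  have -> : nth (qletter e 0) (tl e) j = qletter e j.+1 by rewrite -(ltE e j.+1).
  move: jt; rewrite size_map size_iota => jt.
  apply/and3P; split; [exact/qletter_valid/ltnW|exact: qletter_valid|].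
  rewrite qletter_depth // qletter_depth; last exact: ltnW.
  by rewrite /= (ltn_eqF jt) qnext_run.
- move=> e f; rewrite lastE; apply/esym.
  have h : chnext (qletter e (qdepth e)).1.1 (qletter e (qdepth e)).1.2
      (qletter e (qdepth e)).2 = (qtgt e, 0%N).
    by rewrite qletter_depth // /qletter /= eqxx qnext_end.
  rewrite [LHS]/(sadj _ _) /sadj !qletter_valid // h (@qletter_depth f 0) //=.
  by rewrite /qadj eq_sym xpair_eqE eqxx andbT.
- move=> e f e' f' _ _ h1 h2.
  have ed : qdepth e = qdepth f.
    by have := congr1 size h2; rewrite !size_map !size_iota.
  have h3 : qletter e (qdepth e) = qletter f (qdepth f).
    by rewrite -!lastE h1 h2.
  apply: qsrc_depth_inj => //; first by case: h1.
  by move: h3; rewrite /qletter !eqxx => -[].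
- move=> x; rewrite /cut => /eqP x0.
  have xv t : svalid (sv x t) by have := sv_adj x t; case/and3P.
  have xn t : ((sv x (t + 1)).1.1, (sv x (t + 1)).1.2 : nat) =
      chnext (sv x t).1.1 (sv x t).1.2 (sv x t).2.
    by have := sv_adj x t; case/and3P => _ _ /eqP.
  pose c := (sv x 0).1.1.
  (* The run that starts at this cut ends at the first fall, or else at the end of the chain. *)
  have ex : exists m : nat, ((sv x m).2 < chdigit c m)%N || (m == (chlen c).-1).
    by exists (chlen c).-1; rewrite eqxx orbT.
  have [m mP mmin] := ex_minnP ex.
  have ml : (m <= (chlen c).-1)%N by apply: mmin; rewrite eqxx orbT.
  have cl : (0 < chlen c)%N by case: (c) => -[].
  have run (t : nat) : (t <= m)%N -> (sv x t).1.1 = c /\ (sv x t).1.2 = t :> nat.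
    elim: t => // t IH tm; have [h1 h2] := IH (ltnW tm).
    have := xn t; rewrite h1 h2; rewrite (_ : t%:Z + 1 = t.+1%:Z); last by lia.
    have : ~~ ((sv x t).2 < chdigit c t)%N.
      by apply/negP => h; have := mmin t; rewrite h /=; lia.
    rewrite /chnext => /negbTE ->; rewrite ifT; last by lia.
    by case.
  have lab (t : nat) : (t < m)%N -> (sv x t).2 = chdigit c t.
    move=> tm; have [h1 h2] := run t (ltnW tm).
    have : ~~ ((sv x t).2 < chdigit c t)%N.
      by apply/negP => h; have := mmin t; rewrite h /=; lia.
    have := xv t; rewrite /svalid h1 h2 => /andP[_ h3 h4].
    by apply/val_inj/eqP; rewrite eqn_leq h3 leqNgt h4.
  have mc : (m < chlen c)%N by lia.
  have [e [e1 e2 e3]] : exists e : qa, [/\ qsrc e = c, qdepth e = m & qlab e = (sv x m).2].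
    have [h|h] := ltnP (sv x m).2 (chdigit c m); first exact: qfall.
    have [e [e1 e2 e3]] := qrun c; exists e; rewrite e1 e2 e3.
    have mE : m = (chlen c).-1 by move: mP; rewrite ltnNge h /= => /eqP.
    split=> //; apply/val_inj/eqP; rewrite -mE eqn_leq h.
    by have := xv m; rewrite /svalid; have [-> ->] := run m (leqnn m); case/andP.
  have xe (t : nat) : (t <= m)%N -> sv x t = qletter e t.
    move=> tm; have [h1 h2] := run t tm.
    apply: salph_ext; first by rewrite h1.
      by rewrite qletter_depth ?h2 ?e2.
    rewrite /= e1 e2 e3.
    by case: (eqVneq t m) => [->//|tm']; apply: lab; lia.
  exists e; rewrite size_map size_iota e2; split.
    by move=> j jm; rewrite xe // ltE // size_map size_iota e2.
  have := xn m; rewrite (_ : m%:Z + 1 = m.+1%:Z); last by lia.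
  rewrite (xe m) // -e2 qletter_depth // /qletter /= eqxx qnext_end.
  by case=> _ ->.
- move=> x; have [d dE] : exists d : nat, (sv x 0).1.2 = d :> nat by exists (sv x 0).1.2.
  elim: d x dE => [|d IH] x dE; first by exists 0%N; rewrite /cut oppr0 dE.
  have := sv_adj x (-1); rewrite addNr => /and3P[_ _ /eqP].
  have [j] : exists j : nat, cut (sv (shift (-1) x) (- j%:Z)) .
    apply: IH; rewrite sv_shift add0r.
    have := sv_adj x (-1); rewrite addNr => /and3P[_ _ /eqP].
    by rewrite /chnext dE; do ?case: ifP => _ []; rewrite ?dE // => _ -[->].
  by rewrite sv_shift => h _; exists j.+1; move: h; congr (cut (sv x _)); lia.
- by move=> [[[x|]|[x|]]|[b [x|]]].
- by move=> [[[x|]|[x|]]|[b [x|]]]; rewrite /tl -map_comp.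
Qed.

(** The digits that fall from loop position [j] are those below [g (n + j)]; this turns the number
    of exits into the sum over one period. *)
Lemma card_loop_falls : #|loop_falls| = (\sum_(j < p) g (n + j))%N.
Proof.
rewrite card_sig -sum1_card.
rewrite (eq_bigl (fun x : 'I_p * 'I_k => true && (x.2 < g (n + x.1))%N)) //.
rewrite -(pair_big_dep xpredT (fun (j : 'I_p) (a : 'I_k) => a < g (n + j))%N (fun _ _ => 1%N)) /=.
apply: eq_bigr => j _; rewrite sum1_card.
have /eq_card -> : [pred a : 'I_k | (a < g (n + j))%N] =i
    codom (widen_ord (ltnW (ltn_ord (g (n + j))))).
  move=> a; apply/idP/codomP => [ag|[b ->]]; last by rewrite inE /=.
  by exists (Ordinal (ag : a < g (n + j))%N); apply: val_inj.
by rewrite card_codom ?card_ord // => a b /(congr1 val) /= /val_inj.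
Qed.

End standard_system.

(** * The automaton of the beta-expansion *)

(** A finite expansion is replaced by a periodic sequence in the definition, so aperiodicity leaves
    only the other branch. *)
Lemma generating_seq_nper (R : realType) (b : R) : ~ periodic (generating_seq b) ->
  generating_seq b = expansion1 b /\ ~ finite_expansion (expansion1 b).
Proof.
rewrite /generating_seq; case: pselect => // fin nper; exfalso; apply: nper.
case: ex_minnP => k /asboolP k0 _; have [kz|kp] := posnP k; last first.
  by exists k; split => // m _; rewrite modnDr.
(* For [k = 0] the expansion vanishes identically, and the constant sequence 0 has period 1. *)
exists 1%N; split => // m _; rewrite kz !modn0.
by rewrite !k0 ?kz //; do ?case: ifP.
Qed.

Lemma map_iotaS (T : Type) (f : nat -> T) m :
  [seq f j | j <- iota 1 m] = [seq f j.+1 | j <- iota 0 m].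
Proof. by rewrite -[1%N]addn0 iotaDl -map_comp. Qed.

Local Notation frac := Defs.frac.

Section beta_automaton.
Variables (R : realType) (b : R).
Hypothesis b_gt1 : 1 < b.
Implicit Types (t r : R) (w v : seq nat).

Let b_gt0 : 0 < b. Proof. exact: lt_trans ltr01 b_gt1. Qed.

Lemma frac_itv (x : R) : 0 <= frac x < 1.
Proof. by rewrite /frac; have := floor_itv x; rewrite intrD mulr1z; lra. Qed.

Lemma remainderS t m : remainder b t m.+1 = remainder b (frac (b * t)) m.
Proof. exact: iterSr. Qed.

Lemma digitS t m : digit b t m.+1 = digit b (frac (b * t)) m.
Proof. by rewrite /digit remainderS. Qed.

Lemma remainder_itv t m : 0 <= t < 1 -> 0 <= remainder b t m < 1.
Proof. by case: m => // m _; exact: frac_itv. Qed.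

Lemma digit_shift t m j : digit b t (m + j) = digit b (remainder b t m) j.
Proof. by rewrite /digit /remainder addnC iterD. Qed.

Lemma digitE t m : 0 <= t -> (digit b t m)%:R = (Num.floor (b * remainder b t m))%:~R :> R.
Proof.
move=> t0; rewrite /digit natr_absz ger0_norm // floor_ge0 mulr_ge0 ?(ltW b_gt0) //.
by case: m => // m; case/andP: (frac_itv (b * remainder b t m)).
Qed.

Lemma remainder_digit t m : 0 <= t ->
  remainder b t m.+1 = b * remainder b t m - (digit b t m)%:R.
Proof. by move=> t0; rewrite digitE. Qed.

(* After reading a word, the possible remainders of expansions of t in [0, r)
   form an interval [0, r') again. *)
Fixpoint wordok r w : Prop :=
  if w is a :: w' then a%:R < b * r /\ wordok (Num.min 1 (b * r - a%:R)) w' else True.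

Lemma wordokP r w : 0 < r <= 1 -> wordok r w <->
  exists2 t, 0 <= t < r & w = [seq digit b t j | j <- iota 0 (size w)].
Proof.
elim: w r => [|a w IH] r /andP[r0 r1].
  by split=> // _; exists 0; rewrite ?lexx.
have r'01 : a%:R < b * r -> 0 < Num.min 1 (b * r - a%:R) <= 1.
  by move=> ar; rewrite lt_min ge_min lexx /=; lra.
split.
- move=> [ar /(IH _ (r'01 ar))[t' /andP[t0]]]; rewrite lt_min => /andP[t1 tr] we.
  have a0 : 0 <= a%:R :> R by [].
  pose t := (a%:R + t') / b.
  have bt : b * t = a%:R + t' by rewrite /t mulrC divfK // gt_eqF.
  have fl : Num.floor (b * t) = a%:Z.
    by apply: floor_def; rewrite bt intrD mulr1z -[a%:Z%:~R]/(a%:R : R); lra.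
  have ft : frac (b * t) = t'.
    by rewrite /frac fl bt -[a%:Z%:~R]/(a%:R : R); lra.
  exists t.
    by rewrite divr_ge0 ?addr_ge0 ?(ltW b_gt0) //= ltr_pdivrMr //; lra.
  rewrite /= {1}/digit /= fl /=; congr (_ :: _).
  rewrite {1}we map_iotaS.
  by apply: eq_map => j /=; rewrite digitS ft.
- move=> [t /andP[t0 tr] [ea ew]].
  have aE : a%:R = (Num.floor (b * t))%:~R :> R by rewrite ea -(@digitE t 0).
  have := floor_itv (b * t); rewrite -aE intrD mulr1z -aE => /andP[h1 h2].
  have btr : b * t < b * r by rewrite ltr_pM2l.
  have ar : a%:R < b * r by lra.
  split=> //; apply/(IH _ (r'01 ar)); exists (frac (b * t)).
    by case/andP: (frac_itv (b * t)) => -> h; rewrite lt_min h /= /frac -aE; lra.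
  rewrite {1}ew map_iotaS.
  by apply: eq_map => j /=; rewrite digitS.
Qed.

Lemma wordokW r r' w : 0 < r -> r <= r' -> r' <= 1 -> wordok r w -> wordok r' w.
Proof.
move=> r0 rr' r1 /wordokP h; apply/wordokP; first by lra.
have [|t t0 we] := h; first by lra.
by exists t => //; lra.
Qed.

Lemma beta_languageP w : beta_language b w <-> wordok 1 w.
Proof.
split=> [[t t01 [m e]]|/wordokP[|t t01 e]]; last 2 first.
- by rewrite ltr01 lexx.
- by exists t => //; exists 0%N.
apply/wordokP; first by rewrite ltr01 lexx.
exists (remainder b t m); first exact: remainder_itv.
by rewrite {1}e; apply: eq_map => j; rewrite digit_shift.
Qed.

Lemma pow_unbounded (c : R) : exists m : nat, c < b ^+ m.
Proof.
have b1 := b_gt1; have bern m : 1 + m%:R * (b - 1) <= b ^+ m.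
  elim: m => [|m IH]; first by rewrite mul0r addr0 expr0.
  rewrite exprS; apply: (@le_trans _ _ (b * (1 + m%:R * (b - 1)))).
    have m0 : 0 <= m%:R :> R by [].
    have := sqr_ge0 (b - 1); rewrite -natr1 expr2; nra.
  by rewrite ler_pM2l.
exists (Num.bound (`|c| / (b - 1))); apply: lt_le_trans (bern _).
have h : `|c| / (b - 1) < (Num.bound (`|c| / (b - 1)))%:R.
  by apply: archi_boundP; rewrite divr_ge0 // subr_ge0 ltW.
rewrite ltr_pdivrMr ?subr_gt0 // in h.
by have := ler_norm c; lra.
Qed.

Hypothesis nfin : ~ finite_expansion (expansion1 b).

Let e := expansion1 b.
Let rho := remainder b 1.

Lemma digit_nz m : exists2 j, (m <= j)%N & e j <> 0%N.
Proof.
apply: contrapT => h; apply: nfin; exists m; apply/asboolP => j mj.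
by apply: contrapT => ej; apply: h; exists j.
Qed.

Lemma rho_S j : rho j.+1 = b * rho j - (e j)%:R.
Proof. exact: remainder_digit. Qed.

Lemma rho_le1 j : 0 <= rho j <= 1.
Proof. by case: j => [|j]; [rewrite ler01 lexx|case/andP: (frac_itv (b * rho j)) => -> /ltW]. Qed.

Lemma rho_gt0 j : 0 < rho j.
Proof.
have /andP[h _] := rho_le1 j; rewrite lt_neqAle h andbT eq_sym.
apply/eqP => j0; have rz m : rho (m + j)%N = 0.
  by elim: m => // m IH; rewrite addSn /rho /remainder iterS -/(remainder _ _ _) -/rho IH mulr0 /frac floor0 subrr.
have [i ij] := digit_nz j; apply; apply/eqP; rewrite -(eqr_nat R) digitE //.
by rewrite -/rho -(subnK ij) rz mulr0 floor0.
Qed.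

Lemma rho_lt1 j : (0 < j)%N -> rho j < 1.
Proof. by case: j => // j _; case/andP: (frac_itv (b * rho j)). Qed.

Lemma e_bounds j : (e j)%:R < b * rho j < (e j)%:R + 1.
Proof.
have := rho_S j; have := rho_gt0 j.+1; have := @rho_lt1 j.+1 isT; lra.
Qed.

Lemma e_lt_size j : (e j < alphabet_size b)%N.
Proof.
have h : b <= (alphabet_size b)%:R.
  have c0 : 0 <= Num.ceil b by rewrite ceil_ge0; have b1 := b_gt1; lra.
  by rewrite /alphabet_size natr_absz ger0_norm // ceil_ge.
rewrite -(ltr_nat R); apply: lt_le_trans h.
have b1 := b_gt1; have /andP[h1 h2] := rho_le1 j; have /andP[h3 _] := e_bounds j; nra.
Qed.

Lemma e0_gt0 : (0 < e 0)%N.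
Proof.
by have b1 := b_gt1; have /andP[_] := e_bounds 0; rewrite -(ltr_nat R) -[rho 0]/(1 : R); case: (e 0) => [|m]; [lra|rewrite ltr0n].
Qed.

Definition nxt (j a : nat) : nat := if (a < e j)%N then 0%N else j.+1.

(** After a digit below [e j] the whole interval [0, 1) of remainders is possible, which is state 0;
    after [e j] itself the right end is the next remainder. So the automaton needs no states other
    than the remainders of 1. *)
Lemma wordok_cons j a w : wordok (rho j) (a :: w) <->
  (a <= e j)%N /\ wordok (rho (nxt j a)) w.
Proof.
have /andP[h1 h2] := e_bounds j.
have ltE : (a%:R < b * rho j) = (a <= e j)%N.
  apply/idP/idP => h; last by apply: le_lt_trans h1; rewrite ler_nat.
  by rewrite -ltnS -(ltr_nat R) -natr1; apply: lt_trans h2.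
rewrite /= ltE; have minE : (a <= e j)%N -> Num.min 1 (b * rho j - a%:R) = rho (nxt j a).
  move=> ae; rewrite /nxt; case: ltnP => ea.
    apply/min_idPl; suff : a%:R + 1 <= (e j)%:R :> R by lra.
    by rewrite natr1 ler_nat.
  have -> : a = e j by apply/eqP; rewrite eqn_leq ae.
  by rewrite -rho_S; apply/min_idPr/ltW/rho_lt1.
by split=> -[ae]; [rewrite minE|rewrite -minE].
Qed.

Fixpoint run (j : nat) w : nat := if w is a :: w' then run (nxt j a) w' else j.

Lemma wordok_cat j w v : wordok (rho j) (w ++ v) <->
  wordok (rho j) w /\ wordok (rho (run j w)) v.
Proof.
elim: w j => [|a w IH] j; first by split=> [|[]].
rewrite cat_cons !wordok_cons IH; split=> [[? []]|[[]]] //.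
Qed.

Lemma run_cat j w v : run j (w ++ v) = run (run j w) v.
Proof. by elim: w j => //= a w IH j. Qed.

(* State 0 loops under the digit 0, and from any other state a run of zeros
   ends at 0 as soon as a nonzero digit of the expansion is met. *)
Lemma run_zeros j : exists m, run j (nseq m 0%N) = 0%N.
Proof.
have [i] := digit_nz j; move: j; elim/ltn_ind: i => i IH j ji ei.
have [e0j|e0j] := posnP (e j).
  have ij : (j < i)%N.
    by rewrite ltn_neqAle ji andbT; apply/eqP => ij; apply: ei; rewrite -ij.
  have [d dE] : exists d, i = (j + d.+1)%N by exists (i - j).-1; lia.
  move: ei {IH}; rewrite {i ij ji}dE; elim: d j e0j => [|d IHd] j e0j ej.
    exists 2 => /=; rewrite /nxt e0j ltn0 /= ifT //.
    by rewrite lt0n; apply/eqP; rewrite -addn1.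
  have [e1|e1] := posnP (e j.+1).
    have [|m hm] := IHd j.+1 e1; first by rewrite addSnnS.
    by exists m.+1; rewrite /= /nxt e0j ltn0.
  by exists 2; rewrite /= /nxt e0j ltn0 e1.
by exists 1%N; rewrite /= /nxt e0j.
Qed.

Lemma wordok_zeros j m : wordok (rho j) (nseq m 0%N).
Proof. by elim: m j => // m IH j; apply/wordok_cons; split. Qed.

Lemma wordok_expansion j m : wordok (rho j) [seq e (j + i)%N | i <- iota 0 m].
Proof.
elim: m j => // m IH j; rewrite /= addn0; apply/wordok_cons; split => //.
rewrite /nxt ltnn; rewrite map_iotaS.
by have := IH j.+1; congr wordok; apply: eq_map => i /=; rewrite addSnnS.
Qed.

Lemma run_expansion j m : run j [seq e (j + i)%N | i <- iota 0 m] = (j + m)%N.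
Proof.
elim: m j => [|m IH] j; first by rewrite addn0.
rewrite /= addn0 /nxt ltnn map_iotaS.
rewrite addnS -addSn -[RHS]IH; congr run.
by apply: eq_map => i /=; rewrite addSnnS.
Qed.

(** As long as the digits agree, both points are moved by the same affine map of slope b, so their
    distance is multiplied by b at each step and still cannot exceed 1. *)
Lemma digits_close t t' m : 0 <= t -> 0 <= t' -> t <= 1 -> t' <= 1 ->
  (forall j, (j < m)%N -> digit b t j = digit b t' j) ->
  b ^+ m * `|t - t'| <= 1.
Proof.
move=> t0 t0' t1 t1' h.
suff hm : forall i, (i <= m)%N -> b ^+ i * `|t - t'| = `|remainder b t i - remainder b t' i|.
  rewrite hm //; have rb u : 0 <= u -> u <= 1 -> 0 <= remainder b u m <= 1.
    by case: (m) => [|i] u0 u1; [rewrite /= u0|case/andP: (frac_itv (b * remainder b u i)) => -> /ltW].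
  by have := rb t t0 t1; have := rb t' t0' t1'; rewrite ler_norml; lra.
elim=> [|i IH] im; first by rewrite expr0 mul1r.
rewrite exprS -mulrA IH ?(ltnW im) // !remainder_digit // h //.
rewrite -[X in X * _](gtr0_norm b_gt0) -normrM; congr `|_|; ring.
Qed.

Lemma rho_digits i j : (forall m, e (i + m)%N = e (j + m)%N) -> rho i = rho j.
Proof.
move=> h; apply: contrapT => /eqP; rewrite -subr_eq0 -normr_gt0 => d0.
have [m hm] := pow_unbounded (`|rho i - rho j|^-1).
have /andP[i0 i1] := rho_le1 i; have /andP[j0 j1] := rho_le1 j.
have := @digits_close (rho i) (rho j) m i0 j0 i1 j1; rewrite leNgt.
move=> H; have : ~~ (1 < b ^+ m * `|rho i - rho j|).
  by apply: H => l _; rewrite /rho -!digit_shift; exact: h.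
by rewrite -ltr_pdivrMr // div1r hm.
Qed.

(* Words read off a point strictly between the two remainders separate them. *)
Lemma rho_separated i j : rho i < rho j ->
  exists w, wordok (rho j) w /\ ~ wordok (rho i) w.
Proof.
move=> ij; pose t := (rho i + rho j) / 2.
have ti : rho i < t by rewrite /t; lra.
have tj : t < rho j by rewrite /t; lra.
have [m hm] := pow_unbounded ((t - rho i)^-1).
have /andP[i0 i1] := rho_le1 i; have /andP[j0 j1] := rho_le1 j.
exists [seq digit b t l | l <- iota 0 m]; split.
  apply/wordokP; first by rewrite rho_gt0.
  by exists t; rewrite ?size_map ?size_iota //; apply/andP; split; lra.
move/wordokP; rewrite rho_gt0 i1 => /(_ isT)[t' /andP[t0 ti']].
rewrite size_map size_iota => eqd.
have t1 : t <= 1 by lra.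
have t'1 : t' <= 1 by lra.
have t00 : 0 <= t by lra.
have H := @digits_close t t' m t00 t0 t1 t'1.
have : b ^+ m * `|t - t'| <= 1.
  apply: H => l lm; have := congr1 (nth 0%N ^~ l) eqd.
  by rewrite !(nth_map 0%N) ?size_iota // nth_iota.
rewrite ger0_norm; last by lra.
have h1 : 1 < b ^+ m * (t - rho i) by rewrite -ltr_pdivrMr ?subr_gt0 // div1r.
have b0 : 0 < b ^+ m by rewrite exprn_gt0.
move=> h2; have : b ^+ m * (t - rho i) <= b ^+ m * (t - t') by rewrite ler_pM2l //; lra.
by move=> h3; lra.
Qed.

Lemma rho_wordok i j : (forall w, wordok (rho i) w -> wordok (rho j) w) ->
  rho i <= rho j.
Proof.
by move=> h; rewrite leNgt; apply/negP => /rho_separated[w [/h h1 h2]].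
Qed.

End beta_automaton.

(** * The fiber product cover *)

Section cover_system.
Variables (A V : finType) (F : lgraph A V).

Definition cover_adj : rel ((V * V) * A * (V * V))%type := fun f h =>
  [&& f \in edges (fiber_product_cover F), h \in edges (fiber_product_cover F) &
      tgt f == src h].

Fact cover_ptsP (x : int -> (V * V) * A * (V * V)) :
  edge_shift (fiber_product_cover F) x <-> forall i, cover_adj (x i) (x (i + 1)).
Proof.
split=> h i; last by have /and3P[h1 h2 /eqP h3] := h i.
have [h1 h2] := h i; have [h3 _] := h (i + 1).
by rewrite /cover_adj h1 h3 h2 eqxx.
Qed.

Definition cover_sys : sys := @Sys _ (edge_shift (fiber_product_cover F)) cover_adj
  (@edge_shift_shift _ _ _) (@swap_path _ _ F) (@swap_edge _ _)
  cover_ptsP (fun _ _ => erefl) (fun _ _ => erefl).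

End cover_system.

Lemma essential_path (A V : finType) (H : lgraph A V) f : essential H -> f \in edges H ->
  exists x, edge_shift H x /\ x 0 = f.
Proof.
move=> essH fH; pose E := {f | f \in edges H}.
have /choice[nx nxP] : forall f : E, exists h : E, tgt (val f) = src (val h).
  move=> h; have /andP[_ tV] := edges_endpoints (valP h).
  have [[h' h'H h'E] _] := essH _ tV.
  by exists (exist (fun f => f \in edges H) h' h'H); rewrite /= h'E.
have /choice[pv pvP] : forall f : E, exists h : E, tgt (val h) = src (val f).
  move=> h; have /andP[tV _] := edges_endpoints (valP h).
  have [_ [h' h'H h'E]] := essH _ tV.
  by exists (exist (fun f => f \in edges H) h' h'H); rewrite /= h'E.
pose f0 : E := exist (fun f => f \in edges H) f fH.
pose x (t : int) : E := match t with Posz m => iter m nx f0 | Negz m => iter m.+1 pv f0 end.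
exists (fun t => val (x t)); split=> // t; split; first exact: valP.
case: t => [m|[|m]].
- by rewrite -PoszD addn1 /= nxP.
- by rewrite /= pvP.
- have -> : Negz m.+1 + 1 = Negz m by rewrite !NegzE; lia.
  by rewrite /= pvP.
Qed.

Section fischer_cover_structure.
Variables (R : realType) (b : R).
Hypothesis b_gt1 : 1 < b.
Hypothesis nfin : ~ finite_expansion (expansion1 b).
Variables n p : nat.
Hypothesis min_np : minimal_ultimately_periodic (expansion1 b) n p.

Let e := expansion1 b.
Let rho := remainder b 1.
Let k := alphabet_size b.
Let A := 'I_k.
Implicit Types (a : A) (w v : seq A).

Definition edigit (j : nat) : A := Ordinal (e_lt_size b_gt1 nfin j).

Lemma period_gt0 : (0 < p)%N. Proof. by case: min_np => -[]. Qed.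

Let e_digit i m : e (i + m)%N = digit b (rho i) m.
Proof. exact: digit_shift. Qed.

(** Equal remainders at i < j would give the expansion preperiod i and period j - i; minimality of n
    and p then forces j to be at least n + p. *)
Lemma rho_inj i j : (i < n + p)%N -> (j < n + p)%N -> rho i = rho j -> i = j.
Proof.
have aux i' j' : (i' < j')%N -> (j' < n + p)%N -> rho i' <> rho j'.
  move=> ij jN ijr; have [|] := (min_np.2 i' (j' - i')%N); last by lia.
  split; first by lia.
  move=> m im; rewrite -(subnKC im) addnAC subnKC ?(ltnW ij) //.
  by rewrite -!/(e _) !e_digit ijr.
by case: (ltngtP i j) => // ij iN jN; [move=> h|move=> /esym h]; exfalso; exact: (aux _ _ ij) h.
Qed.

Lemma rho_wrap : rho (n + p) = rho n.
Proof.
apply: (rho_digits b_gt1) => m; have [[_ h] _] := min_np.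
by rewrite addnAC h // leq_addr.
Qed.

(** Written as a successor so that [ord0] and [inord] apply. *)
Definition nstates := (n + p).-1.+1.

Lemma nstatesE : nstates = (n + p)%N.
Proof. by rewrite /nstates prednK // addn_gt0 period_gt0 orbT. Qed.

Lemma state_lt (i : 'I_nstates) : (i < n + p)%N.
Proof. by have := ltn_ord i; rewrite {2}nstatesE. Qed.

Definition nx (i : 'I_nstates) a : 'I_nstates :=
  inord (if (a < edigit i)%N then 0%N else if (i.+1 < n + p)%N then i.+1 else n).

Lemma nxE i a : nx i a =
  (if (a < edigit i)%N then 0%N else if (i.+1 < n + p)%N then i.+1 else n) :> nat.
Proof.
rewrite /nx inordK //; have := period_gt0; have := state_lt i.
by do ?case: ifP; lia.
Qed.

Lemma rho_nxE i a : rho (nx i a) = rho (nxt b i a).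
Proof.
rewrite nxE /nxt /=; case: ifP => // _; case: ifP => // h.
by rewrite -rho_wrap; congr rho; have := state_lt i; lia.
Qed.

Lemma rho_nx_min (i : 'I_nstates) a : (a <= e i)%N -> rho (nx i a) = Num.min 1 (b * rho i - a%:R).
Proof.
move=> ai; rewrite rho_nxE /nxt; case: ltnP => h.
  apply/esym/min_idPl; have := e_bounds b_gt1 nfin i.
  rewrite -/rho -/e; suff : a%:R + 1 <= (e i)%:R :> R by lra.
  by rewrite natr1 ler_nat.
have -> : a%:R = (e i)%:R :> R by congr _%:R; apply/eqP; rewrite eqn_leq ai.
by rewrite /rho -rho_S //; apply/esym/min_idPr/ltW/rho_lt1.
Qed.

(** A larger remainder admits more words, and reading a common digit preserves this order. All later
    arguments about pasts compare two coordinates in this way. *)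
Lemma rho_nx_mono (i j : 'I_nstates) a : (a <= e i)%N -> rho i <= rho j ->
  (a <= e j)%N /\ rho (nx i a) <= rho (nx j a).
Proof.
move=> ai ij; have aj : (a <= e j)%N.
  have := e_bounds b_gt1 nfin i; have := e_bounds b_gt1 nfin j; rewrite -/rho -/e => h1 h2.
  rewrite -ltnS -(ltr_nat R) -natr1.
  have : a%:R <= (e i)%:R :> R by rewrite ler_nat.
  have : b * rho i <= b * rho j by rewrite ler_pM2l //; apply: lt_trans b_gt1.
  lra.
split => //; rewrite !rho_nx_min // le_min !ge_min lexx /=; apply/orP; right.
by rewrite lerD2r ler_pM2l //; apply: lt_trans b_gt1.
Qed.

Lemma rho_ord_inj (i j : 'I_nstates) : rho i = rho j -> i = j.
Proof. by move=> h; apply/val_inj/rho_inj; rewrite ?state_lt. Qed.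

Lemma wordok_cons_nx (i : 'I_nstates) a w : wordok b (rho i) (map val (a :: w)) <->
  (a <= e i)%N /\ wordok b (rho (nx i a)) (map val w).
Proof. by rewrite rho_nxE; exact: wordok_cons. Qed.

Definition std_edges : {set 'I_nstates * A * 'I_nstates} :=
  [set x : 'I_nstates * A * 'I_nstates |
    (lab x <= e (src x))%N && (tgt x == nx (src x) (lab x))].

Fact std_endpoints x : x \in std_edges -> 
  (src x \in finset.setTfor 'I_nstates) && (tgt x \in finset.setTfor 'I_nstates).
Proof. by rewrite !finset.inE. Qed.

Definition std_graph : lgraph 'I_k 'I_nstates := LGraph std_endpoints.

Let lang w := wordok b 1 (map val w).

Let labels (y : int -> A) (i : int) m := [seq y (i + j%:Z) | j <- iota 0 m].

Let beta_shiftP (y : int -> A) : beta_shift b y <-> forall i m, lang (labels y i m).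
Proof.
split=> h i m; have := h i m.
  by move/(beta_languageP b_gt1); rewrite /lang /labels -map_comp.
by rewrite /lang /labels -map_comp => /(beta_languageP b_gt1).
Qed.

Let labelsS y i m : labels y i m.+1 = y i :: labels y (i + 1) m.
Proof.
rewrite /labels /= addr0 map_iotaS; congr (_ :: _).
by apply: eq_map => j; rewrite intS addrA.
Qed.

Let labels_cat y i m l : labels y i (m + l) = labels y i m ++ labels y (i + m%:Z) l.
Proof.
elim: m i => [|m IH] i; first by rewrite addr0.
by rewrite addSn !labelsS IH /= intS addrA.
Qed.

Let size_labels y i m : size (labels y i m) = m.
Proof. by rewrite size_map size_iota. Qed.

Let std_path_ok (x : int -> 'I_nstates * A * 'I_nstates) m i : edge_shift std_graph x ->
  wordok b (rho (src (x i))) (map val (labels (label_seq x) i m)).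
Proof.
move=> xG; elim: m i => // m IH i; rewrite labelsS; apply/wordok_cons_nx.
have [] := xG i; rewrite finset.inE => /andP[h1 /eqP h2] h3.
by split => //; rewrite -h2 h3.
Qed.

Let beta_of_std (x : int -> 'I_nstates * A * 'I_nstates) : edge_shift std_graph x ->
  beta_shift b (label_seq x).
Proof.
move=> xG; apply/beta_shiftP => i m; apply: (wordokW b_gt1) (std_path_ok m i xG) => //.
  by apply: rho_gt0.
by have /andP[] := rho_le1 b (src (x i)).
Qed.

Let run_nx (i : 'I_nstates) (j : nat) w : rho i = rho j ->
  rho (foldl nx i w) = rho (run b j (map val w)).
Proof.
elim: w i j => //= a w IH i j ij; apply: IH; rewrite rho_nxE /nxt.
have eij : e i = e j by rewrite -[i : nat]addn0 -[j]addn0 !e_digit ij.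
have eij' : expansion1 b i = expansion1 b j := eij.
rewrite eij'; case: ifP => // _.
by rewrite /rho !rho_S // -/rho -!/(e _) ij eij.
Qed.

(** To lift a point of the beta-shift, run the automaton from state 0 at an early time T. An earlier
    start can only lower the remainder at a fixed later time, and there are finitely many states, so
    the state at each time stabilizes as T decreases; the limits form a path. *)
Lemma std_presents : presents std_graph (beta_shift b).
Proof.
apply/seteqP; split=> [_ [x xG <-]|y yb]; first exact: beta_of_std.
pose S (T : int) m : 'I_nstates := foldl nx ord0 (labels y T m).
have SS T m : S T m.+1 = nx (S T m) (y (T + m%:Z)).
  by rewrite /S -addn1 labels_cat foldl_cat labelsS.
have Sok (T : int) m : (y (T + m%:Z)%R <= e (S T m))%N.
  have := (beta_shiftP y).1 yb T (m + 1)%N; rewrite /lang labels_cat map_cat.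
  rewrite -[1]/(rho 0) => /(wordok_cat b_gt1 nfin)[_].
  rewrite -/rho -(@run_nx ord0 0) // => h.
  by move: h; rewrite labelsS => /wordok_cons_nx[].
have Smono T m : rho (S (T - 1) m.+1) <= rho (S T m).
  elim: m => [|m IH]; first by have /andP[] := rho_le1 b (S (T - 1) 1%N).
  rewrite SS [in leRHS]SS (_ : T - 1 + m.+1%:Z = T + m%:Z); last by lia.
  have := Sok (T - 1) m.+1; rewrite (_ : T - 1 + m.+1%:Z = T + m%:Z); last by lia.
  by move=> h; have [] := rho_nx_mono h IH.
have stab t : exists s, exists M, forall m, (M <= m)%N -> S (t - m%:Z) m = s.
  pose f m := S (t - m%:Z) m.
  have fmono m : rho (f m.+1) <= rho (f m).
    by have := Smono (t - m%:Z) m; rewrite /f (_ : t - m%:Z - 1 = t - m.+1%:Z); last by lia.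
  have fm0 : `[< exists m, f m = f 0%N >] by apply/asboolP; exists 0%N.
  case: (@Order.TotalTheory.arg_minP _ _ _ (f 0%N)
    (fun s => `[< exists m, f m = s >]) (fun s : 'I_nstates => rho s) fm0) => s /asboolP[M fM] smin.
  exists s, M => m Mm; apply: rho_ord_inj; apply/eqP; rewrite eq_le smin ?andbT; last first.
    by apply/asboolP; exists m.
  rewrite -fM -/(f m) -(subnK Mm); elim: (m - M)%N => // d IH.
  by rewrite addSn; apply: le_trans IH; exact: fmono.
have /choice[s sP] := stab.
exists (fun t => (s t, y t, s (t + 1))); last by [].
move=> t; split => //; rewrite finset.inE /src /lab /tgt /=.
have [M hM] := sP t; have [M' hM'] := sP (t + 1).
have h1 := hM (maxn M M') (leq_maxl _ _).
have h2 := hM' (maxn M M').+1 (leqW (leq_maxr _ _)).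
rewrite -h1 -h2 (_ : t + 1 - (maxn M M').+1%:Z = t - (maxn M M')%:Z); last by lia.
rewrite SS subrK eqxx andbT.
by have := Sok (t - (maxn M M')%:Z) (maxn M M'); rewrite subrK.
Qed.

Lemma std_right_resolving : right_resolving std_graph.
Proof.
move=> [[i a] j] [[i' a'] j']; rewrite !finset.inE /src /lab /tgt /=.
by move=> /andP[_ /eqP ->] /andP[_ /eqP ->] -> ->.
Qed.

(* Any word readable from state 0 occurs in a biinfinite point: precede it by
   zeros, follow it by the largest possible digits. *)
Let lang_extend w : lang w -> exists y, beta_shift b y /\ labels y 0 (size w) = w.
Proof.
move=> wl; pose lt_ (s : 'I_nstates) j := nth (edigit s) w j.
pose st := fix st j := if j is j'.+1 then nx (st j') (lt_ (st j') j') else ord0.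
pose zero : A := Ordinal (leq_ltn_trans (leq0n _) (e_lt_size b_gt1 nfin 0)).
pose x (i : int) : 'I_nstates * A * 'I_nstates :=
  if i is Posz j then (st j, lt_ (st j) j, st j.+1) else (ord0, zero, ord0).
have stE j : (j <= size w)%N -> st j = foldl nx ord0 (take j w).
  elim: j => [|j IH] jw /=; first by rewrite take0.
  by rewrite IH ?(ltnW jw) // (take_nth (edigit (foldl nx ord0 (take j w)))) // foldl_rcons.
have xG : edge_shift std_graph x.
  move=> [j|[|j]]; split.
  - rewrite finset.inE /lab /src /tgt /= eqxx andbT /lt_.
    have [jw|jw] := ltnP j (size w); last by rewrite nth_default.
    move: wl; rewrite /lang -{1}(cat_take_drop j w) map_cat.
    rewrite -[1]/(rho 0) => /(wordok_cat b_gt1 nfin)[_].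
    rewrite -/rho -(@run_nx ord0 0) // -stE ?(ltnW jw) //.
    by rewrite (drop_nth (edigit (st j))) // => /wordok_cons_nx[].
  - by rewrite -PoszD addn1.
  - rewrite finset.inE /lab /src /tgt; apply/andP; split; first by [].
    by apply/eqP/val_inj; rewrite [RHS]nxE /= ifT //; exact: e0_gt0.
  - by [].
  - rewrite finset.inE /lab /src /tgt; apply/andP; split; first by [].
    by apply/eqP/val_inj; rewrite [RHS]nxE /= ifT //; exact: e0_gt0.
  - by rewrite (_ : Negz j.+1 + 1 = Negz j) // !NegzE; lia.
exists (label_seq x); split; first exact: beta_of_std.
apply: (@eq_from_nth _ zero); rewrite size_labels // => j jw.
rewrite (nth_map 0%N) ?size_iota // nth_iota // add0n add0r.
by rewrite /label_seq /lab /= /lt_; apply: set_nth_default.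
Qed.

(** * Identification of the right Fischer cover *)

Section cover.
Variables (V : finType) (F : lgraph A V).
Hypothesis Fcover : right_fischer_cover F (beta_shift b).
Let E := (V * A * V)%type.
Implicit Types (x y z : int -> E) (u : V).

Let F_rr : right_resolving F. Proof. by case: Fcover. Qed.

Let path_beta x : edge_shift F x -> beta_shift b (label_seq x).
Proof. by move=> xF; case: Fcover => <- _ _; exists x. Qed.

Let beta_path (y : int -> A) : beta_shift b y -> exists2 x, edge_shift F x & label_seq x = y.
Proof. by case: Fcover => <- _ _ [x xF <-]; exists x. Qed.

Let lbl x i m := labels (label_seq x) i m.

Let lbl_lang x i m : edge_shift F x -> lang (lbl x i m).
Proof. by move=> /path_beta/beta_shiftP; exact. Qed.

Let shiftp (i : int) x : int -> E := fun t => x (t + i).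

Let shiftp_path i x : edge_shift F x -> edge_shift F (shiftp i x).
Proof. by move=> xF t; have := xF (t + i); rewrite /shiftp addrAC. Qed.

Let lbl_shift i x j m : lbl (shiftp i x) j m = lbl x (j + i) m.
Proof. by apply: eq_map => l; rewrite /label_seq /shiftp addrAC. Qed.

Let glue x y : int -> E := fun t => if t < 0 then x t else y t.

Let glue_path x y : edge_shift F x -> edge_shift F y -> src (x 0) = src (y 0) ->
  edge_shift F (glue x y).
Proof.
move=> xF yF xy t; have [xt xt1] := xF t; have [yt yt1] := yF t; rewrite /glue.
have [t0|t0] := ltP t 0; last by rewrite ltNge (_ : 0 <= t + 1) //; lia.
split=> //; have [//|t1] := ltP (t + 1) 0.
have -> : t + 1 = 0 by lia.
by rewrite -xy -[0](_ : t + 1 = 0) //; lia.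
Qed.

Let lbl_glueL x y m : lbl (glue x y) (- m%:Z) m = lbl x (- m%:Z) m.
Proof.
apply/eq_in_map => j; rewrite mem_iota /label_seq /glue => jm.
by rewrite ifT //; lia.
Qed.

Let lbl_glueR x y m : lbl (glue x y) 0 m = lbl y 0 m.
Proof.
by apply/eq_in_map => j _; rewrite /label_seq; congr lab.
Qed.

Let lbl_cat x i m l : lbl x i (m + l) = lbl x i m ++ lbl x (i + m%:Z) l.
Proof. exact: labels_cat. Qed.

Let size_lbl x i m : size (lbl x i m) = m.
Proof. exact: size_labels. Qed.

Let stepF u a : V :=
  if [pick f in edges F | (src f == u) && (lab f == a)] is Some f then tgt f else u.

Let stepFE f : f \in edges F -> stepF (src f) (lab f) = tgt f.
Proof.
move=> fF; rewrite /stepF; case: pickP => [h /andP[hF /andP[/eqP sh /eqP lh]]|/(_ f)].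
  by rewrite (F_rr hF fF sh lh).
by rewrite fF !eqxx.
Qed.

Let src_run x m i : edge_shift F x -> src (x (i + m%:Z)) = foldl stepF (src (x i)) (lbl x i m).
Proof.
move=> xF; elim: m i => [|m IH] i; first by rewrite addr0.
rewrite /lbl labelsS /= -/(lbl _ _ _); have [xi xi1] := xF i.
by rewrite stepFE // xi1 -IH intS addrA.
Qed.

Let reach w : {set V} := [set u : V | `[< exists x, [/\ edge_shift F x,
  src (x 0) = u & lbl x (- (size w)%:Z) (size w) = w] >]].

Let fol u w : Prop := exists x, [/\ edge_shift F x, src (x 0) = u & lbl x 0 (size w) = w].

Let reachP w u : reflect (exists x, [/\ edge_shift F x,
  src (x 0) = u & lbl x (- (size w)%:Z) (size w) = w]) (u \in reach w).
Proof. by rewrite finset.inE; exact: asboolP. Qed.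

Let reach_lang w : lang w -> exists u, u \in reach w.
Proof.
move=> /lang_extend[y [/beta_path[x xF <-] xw]].
exists (src (x (size w)%:Z)); apply/reachP; exists (shiftp (size w)%:Z x); split.
- exact: shiftp_path.
- by rewrite /shiftp add0r.
- by rewrite lbl_shift addNr.
Qed.

Let fol_shift x i m : edge_shift F x -> fol (src (x i)) (lbl x i m).
Proof.
move=> xF; exists (shiftp i x); split; [exact: shiftp_path|by rewrite /shiftp add0r|].
by rewrite lbl_shift add0r size_lbl.
Qed.

Let reach_shift x i m : edge_shift F x -> src (x (i + m%:Z)) \in reach (lbl x i m).
Proof.
move=> xF; apply/reachP; exists (shiftp (i + m%:Z) x); split.
- exact: shiftp_path.
- by rewrite /shiftp add0r.
- by rewrite lbl_shift size_lbl addrC addrK.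
Qed.

Let fol_run u w : fol u w -> exists2 x, edge_shift F x &
  [/\ src (x 0) = u, lbl x 0 (size w) = w & src (x (size w)%:Z) = foldl stepF u w].
Proof.
move=> [x [xF xu xw]]; exists x => //; split => //.
by rewrite -[_%:Z]add0r src_run // xu xw.
Qed.

Let survivors w v : {set V} := [set u : V | (u \in reach w) && `[< fol u v >]].

(* A word extends the set of possible end vertices by a partial function. *)
Let reach_cat w v :
  (#|reach (w ++ v)| <= #|survivors w v|)%N.
Proof.
apply: leq_trans (leq_imset_card (fun u => foldl stepF u v) _).
apply/subset_leq_card/fintype.subsetP => u /reachP[x [xF xu]].
rewrite size_cat lbl_cat => /eqP; rewrite eqseq_cat ?size_lbl // => /andP[/eqP h1 /eqP h2].
have eA : - (size w + size v)%N%:Z + (size w)%:Z = - (size v)%:Z by lia.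
rewrite eA in h2; apply/imsetP; exists (src (x (- (size v)%:Z))); last first.
  by have := @src_run x (size v) (- (size v)%:Z) xF; rewrite addNr xu h2.
rewrite finset.inE; apply/andP; split.
  by rewrite -h1 -eA; exact: reach_shift.
by apply/asboolP; rewrite -h2 size_lbl; exact: fol_shift.
Qed.

Let lang_cat w v : lang (w ++ v) <-> lang w /\ wordok b (rho (run b 0 (map val w))) (map val v).
Proof. by rewrite /lang map_cat; exact: (wordok_cat b_gt1 nfin 0). Qed.

Let zero : A := Ordinal (leq_ltn_trans (leq0n _) (e_lt_size b_gt1 nfin 0)).

Let lang_zeros w : lang w -> exists m, lang (w ++ nseq m zero) /\
  run b 0 (map val (w ++ nseq m zero)) = 0%N.
Proof.
move=> wl; have [m hm] := run_zeros b_gt1 nfin (run b 0 (map val w)); exists m.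
rewrite lang_cat map_cat run_cat map_nseq /=; split => //; split => //.
exact: wordok_zeros.
Qed.

(* A word with the least number of possible end vertices is synchronizing: its
   end vertices must follow every word that can follow it. *)
Let magic_vertex : exists u, forall v, lang v -> fol u v.
Proof.
(* Ending at state 0 lets every word of the language follow [w]. The zeros appended after [v] below
   restore this property, so that minimality can be applied to the longer word. *)
pose P N := exists w, [/\ lang w, run b 0 (map val w) = 0%N & #|reach w| = N].
have [N /asboolP[w [wl w0 wN]] Nmin] : exists2 N, `[< P N >] & forall N', `[< P N' >] -> (N <= N')%N.
  have ex : exists N, `[< P N >] by exists #|reach [::]|; apply/asboolP; exists [::].
  by case: (ex_minnP ex) => N hN hmin; exists N.
have [u uw] := reach_lang wl; exists u => v vl.
have wv : lang (w ++ v) by apply/lang_cat; rewrite w0.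
have [m [ml m0]] := lang_zeros wv; rewrite -catA in ml m0.
have : P #|reach (w ++ (v ++ nseq m zero))| by exists (w ++ (v ++ nseq m zero)).
move=> /asboolP/Nmin h.
pose good := survivors w (v ++ nseq m zero).
have gw : good \subset reach w.
  by apply/fintype.subsetP => u'; rewrite finset.inE => /andP[].
have gE : good = reach w.
  by apply/eqP; rewrite eqEcard gw /= wN; apply: leq_trans h (reach_cat _ _).
have : u \in good by rewrite gE.
rewrite finset.inE uw => /asboolP[x [xF xu]].
rewrite size_cat lbl_cat => /eqP; rewrite eqseq_cat ?size_lbl // => /andP[/eqP h1 _].
by exists x; split.
Qed.

(** From a vertex followed by the whole language, the first i digits of the expansion of 1 lead to a
    vertex whose followers are exactly the words allowed by [rho i]. Different remainders have
    different followers, so these vertices are distinct, and comparison with [std_graph] shows that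
    there are no others. The followers of its target then determine each edge. *)
Theorem fischer_cover_std : exists u : 'I_nstates -> V, injective u /\
  forall f : E, f \in edges F <->
    exists (i : 'I_nstates) a, (a <= e i)%N /\ f = (u i, a, u (nx i a)).
Proof.
have [u0 u0P] := magic_vertex.
have fol_cat v v' : lang v -> fol (foldl stepF u0 v) v' <-> lang (v ++ v').
  move=> vl; split.
    have [x xF [x0 xv xr]] := fol_run (u0P v vl).
    move=> [y [yF y0 yv]].
    have gF : edge_shift F (glue (shiftp (size v)%:Z x) y).
      by apply: glue_path => //; [exact: shiftp_path|rewrite /shiftp add0r xr].
    suff <- : lbl (glue (shiftp (size v)%:Z x) y) (- (size v)%:Z) (size v + size v') = v ++ v'.
      exact: lbl_lang.
    by rewrite lbl_cat addNr lbl_glueL lbl_glueR yv lbl_shift addNr xv.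
  move=> /u0P[x [xF x0]]; rewrite size_cat lbl_cat => /eqP.
  rewrite eqseq_cat ?size_lbl // add0r => /andP[/eqP h1 /eqP h2].
  by rewrite -[X in foldl _ _ X]h1 -x0 -src_run // add0r -[X in fol _ X]h2; exact: fol_shift.
pose G (i : nat) := [seq edigit j | j <- iota 0 i].
have valG i : map val (G i) = [seq e (0 + j)%N | j <- iota 0 i] by rewrite -map_comp.
have langG i : lang (G i) by rewrite /lang valG; exact: (wordok_expansion b_gt1 nfin 0).
pose u (i : 'I_nstates) := foldl stepF u0 (G i).
have folu i v : fol (u i) v <-> wordok b (rho i) (map val v).
  rewrite fol_cat // lang_cat valG run_expansion add0n.
  by split=> [[]|].
have wordval r (w : seq nat) : r <= 1 -> wordok b r w -> exists v : seq A, w = map val v.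
  elim: w r => [|a w IH] r r1; first by exists [::].
  move=> [ar /IH]; rewrite ge_min lexx => /(_ isT)[v ->].
  have ak : (a < k)%N.
    have h : b <= k%:R.
      have c0 : 0 <= Num.ceil b by rewrite ceil_ge0; have b1 := b_gt1; lra.
      by rewrite /k /alphabet_size natr_absz ger0_norm // ceil_ge.
    have b1 := b_gt1; rewrite -(ltr_nat R); apply: lt_le_trans ar _.
    by apply: le_trans h; nra.
  by exists (Ordinal ak :: v).
have rho1 i : rho i <= 1 by have /andP[] := rho_le1 b i.
have fol_eq (i : 'I_nstates) j : (forall v, fol (u i) v <-> wordok b (rho j) (map val v)) -> rho i = rho j.
  move=> h; apply/eqP; rewrite eq_le; apply/andP; split; apply: (rho_wordok b_gt1 nfin).
    by move=> w /[dup] /(wordval _ _ (rho1 i))[v ->] /folu /h.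
  by move=> w /[dup] /(wordval _ _ (rho1 j))[v ->] /h /folu.
have u_inj : injective u.
  by move=> i j ij; apply: rho_ord_inj; apply: fol_eq => v; rewrite ij folu.
have u_past i : exists2 x, edge_shift F x & src (x 0) = u i.
  have [x xF [_ _ xr]] := fol_run (u0P _ (langG i)).
  exists (shiftp (size (G i))%:Z x); first exact: shiftp_path.
  by rewrite /shiftp add0r xr.
have uV i : u i \in vertices F.
  have [x xF <-] := u_past i; have [x0 _] := xF 0.
  by have /andP[] := edges_endpoints x0.
have Vu (v : V) : v \in vertices F -> exists i, v = u i.
  have sub : u @: finset.setTfor 'I_nstates \subset vertices F.
    by apply/fintype.subsetP => _ /imsetP[i _ ->].
  have -> : vertices F = u @: finset.setTfor 'I_nstates.
    apply/esym/eqP; rewrite eqEcard sub card_imset // cardsT card_ord.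
    case: Fcover => _ _ /(_ _ std_graph std_presents std_right_resolving).
    by rewrite /= cardsT card_ord.
  by case/imsetP => i _ ->; exists i.
have edgeu f : f \in edges F -> exists (i : 'I_nstates) a, (a <= e i)%N /\ f = (u i, a, u (nx i a)).
  move=> fF; have /andP[/Vu[i si] /Vu[j tj]] := edges_endpoints fF.
  pose a := lab f.
  have folS v : fol (u j) v <-> fol (u i) (a :: v).
    split.
      move=> [y [yF y0 yv]]; have [x xF x0] := u_past i.
      pose z (t : int) := if t < 0 then x t else if t == 0 then f else y (t - 1).
      have zF : edge_shift F z.
        move=> t; rewrite /z; have [xt xt1] := xF t; have [yt yt1] := yF (t - 1).
        have [t0|t0] := ltP t 0.
          split=> //; have [//|t1] := ltP (t + 1) 0.
          have e0 : t + 1 = 0 by lia.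
          by rewrite xt1 e0 eqxx x0 si.
        have -> : (t + 1 < 0) = false by lia.
        have -> : (t + 1 == 0) = false by lia.
        have [->|tn0] := eqVneq t 0; first by split => //; rewrite addrK y0.
        by rewrite yt1; split => //; congr (src (y _)); lia.
      exists z; split=> //.
      rewrite [size _]/= /lbl labelsS; congr (_ :: _).
      rewrite -[RHS]yv; apply: eq_map => l; rewrite /label_seq /z.
      have -> : (0 + 1 + l%:Z < 0) = false by lia.
      have -> : (0 + 1 + l%:Z == 0) = false by lia.
      by congr (lab (y _)); lia.
    move=> [x [xF x0]]; rewrite [size _]/= /lbl labelsS => -[xa xv].
    have [xe xe1] := xF 0.
    have e1 : x 0 = f by apply: F_rr => //; rewrite x0 si.
    by rewrite -tj -e1 xe1 -xv; exact: fol_shift.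
  have ai : (a <= e i)%N.
    have [y yF y0] := u_past j.
    have : fol (u j) [::] by exists y.
    by rewrite folS folu => /wordok_cons_nx[].
  exists i, a; split=> //; rewrite [f]surjective_pairing [f.1]surjective_pairing.
  rewrite -/(src f) -/(lab f) -/(tgt f) si tj; congr (_, u _).
  apply: rho_ord_inj; apply: fol_eq => v.
  rewrite folS folu; split=> [/wordok_cons_nx[]//|h].
  exact/wordok_cons_nx.
exists u; split=> // f; split; first exact: edgeu.
move=> [i [a [ai ->]]].
have : fol (u i) [:: a] by apply/folu/wordok_cons_nx.
move=> [x [xF x0]]; rewrite [size _]/= /lbl labelsS => -[xa].
have [xe _] := xF 0; have [i' [a' [ai' fe]]] := edgeu _ xe.
by move: xe x0 xa; rewrite /label_seq fe /src /lab /= => xe /u_inj ii <-; rewrite -ii.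
Qed.

End cover.

(** * Pasts in the loop and their partners *)

Hypothesis n_gt0 : (0 < n)%N.

Let b_gt0 : 0 < b. Proof. exact: lt_trans ltr01 b_gt1. Qed.

Let p0 : p%:Z != 0. Proof. by have := period_gt0; case: p. Qed.

(** The loop states indexed by all integer times modulo p, so that any past spent in the loop is a
    translate of [cyc]. *)
Definition cyc (t : int) : 'I_nstates := inord (n + absz (t %% p%:Z)%Z).

Let modp_itv t : 0 <= (t %% p%:Z)%Z < p%:Z.
Proof. by rewrite modz_ge0 // ltz_pmod // ltz_nat period_gt0. Qed.

Let modpS t : ((t + 1) %% p%:Z)%Z =
  if (t %% p%:Z)%Z + 1 < p%:Z then (t %% p%:Z)%Z + 1 else 0.
Proof.
have h := modp_itv t; rewrite -modzDml; case: ifP => h1.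
  by rewrite modz_small //; lia.
by have -> : (t %% p%:Z)%Z + 1 = p%:Z; [lia|rewrite modzz].
Qed.

Lemma cycE t : cyc t = (n + absz (t %% p%:Z)%Z)%N :> nat.
Proof.
by rewrite /cyc inordK // [X in (_ < X)%N]nstatesE ltn_add2l; have := modp_itv t; lia.
Qed.

Lemma cyc_eq s t : (s = t %[mod p%:Z])%Z <-> cyc s = cyc t.
Proof.
split=> [h|]; first by apply: val_inj; rewrite /= !cycE h.
move=> /(congr1 val) /=; rewrite !cycE => /addnI.
by have := modp_itv s; have := modp_itv t; lia.
Qed.

Lemma cyc_nat (i : 'I_nstates) : (n <= i)%N -> i = cyc (i%:Z - n%:Z).
Proof.
move=> ni; apply: val_inj; rewrite /= cycE modz_small; first by lia.
by have := state_lt i; lia.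
Qed.

Lemma cycS t : nx (cyc t) (edigit (cyc t)) = cyc (t + 1).
Proof.
apply: val_inj; rewrite /= nxE ltnn !cycE modpS.
have := modp_itv t; do ?case: ifP; lia.
Qed.

Lemma cyc_shift s t : cyc s = cyc t -> forall r, cyc (s + r) = cyc (t + r).
Proof. by move=> /cyc_eq h r; apply/cyc_eq; rewrite -modzDml h modzDml. Qed.

Let cycBp s : cyc (s - p%:Z) = cyc s.
Proof. by apply/cyc_eq; rewrite -{2}[s](subrK p%:Z) modzDr. Qed.

Let cyc_gt0 t : (0 < cyc t)%N. Proof. by rewrite cycE addn_gt0 n_gt0. Qed.

Let rho_cyc t : rho (cyc t) < 1. Proof. exact: rho_lt1. Qed.

Let rho_S_nx (i : 'I_nstates) : rho (nx i (edigit i)) = b * rho i - (e i)%:R.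
Proof. by rewrite rho_nxE /nxt ltnn /rho rho_S. Qed.

Definition traj (h : int -> 'I_nstates) (a : int -> A) :=
  forall t, t < 0 -> (a t <= e (h t))%N /\ h (t + 1) = nx (h t) (a t).

(* A past that never returns to state 0 has been in the loop forever. *)
Lemma traj_loop h (a : int -> A) : traj h a -> (forall t, t <= 0 -> h t <> ord0) ->
  exists s, (forall t, t <= 0 -> h t = cyc (s + t)) /\
            (forall t, t < 0 -> a t = edigit (h t)).
Proof.
move=> tr h0.
have aE t : t < 0 -> a t = edigit (h t).
  move=> t0; have [ae hE] := tr t t0; apply/val_inj/eqP; rewrite eqn_leq ae /= leqNgt.
  apply/negP => lt; apply: (h0 (t + 1)); first by lia.
  by apply: val_inj; rewrite hE /= nxE lt.
have hn t : t <= 0 -> (n <= h t)%N.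
  move=> t0; rewrite leqNgt; apply/negP; move hv : (h t : nat) => v.
  elim: v t t0 hv => [|v IH] t t0 hv vn.
    by apply: (h0 t t0); apply: val_inj.
  have t1 : t - 1 < 0 by lia.
  have [_] := tr _ t1; rewrite subrK => hE.
  have := congr1 val hE; rewrite /= hv nxE aE // ltnn; case: ifP => _ h1; last by lia.
  by apply: (IH (t - 1)); lia.
exists ((h 0)%:Z - n%:Z); split=> // t t0.
have [m ->] : exists m : nat, t = - m%:Z by exists `|t|%N; lia.
elim: m => [|m IH]; first by rewrite subr0; exact: cyc_nat (hn 0 _).
have m1 : - m.+1%:Z < 0 by lia.
have [_] := tr _ m1; rewrite aE // (_ : - m.+1%:Z + 1 = - m%:Z); last by lia.
rewrite IH; have n1 := hn _ (ltW m1); rewrite {1 2}(cyc_nat n1) cycS => hE.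
rewrite (cyc_nat n1); have := cyc_shift (esym hE) (- 1).
by rewrite addrK => ->; congr cyc; lia.
Qed.

(* In the loop the gap between two remainders is multiplied by b at each step,
   so two different phases of the loop never read the same labels. *)
Lemma traj_uniq i h h' (a : int -> A) : traj i a -> traj h a -> traj h' a ->
  (forall t, t <= 0 -> rho (i t) < rho (h t)) ->
  (forall t, t <= 0 -> rho (i t) < rho (h' t)) -> h 0 = h' 0.
Proof.
have aux q1 q2 : traj i a -> traj q1 a -> traj q2 a ->
    (forall t, t <= 0 -> rho (i t) < rho (q1 t)) -> ~ rho (q1 0) < rho (q2 0).
  move=> ti tk tk' ik kk0.
  (* State 0 has the maximal remainder 1, so no state with a strictly smaller remainder than another
     can be state 0. *)
  have nz (u v : 'I_nstates) : rho u < rho v -> u <> ord0.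
    by move=> uv u0; move: uv; rewrite u0 ltNge; have /andP[_ ->] := rho_le1 b v.
  have kk t : t <= 0 -> rho (q1 t) < rho (q2 t).
    move=> t0; have [m ->] : exists m : nat, t = - m%:Z by exists `|t|%N; lia.
    elim: m => [|m IH]; first by rewrite oppr0.
    have m1 : - m.+1%:Z < 0 by lia.
    rewrite ltNge; apply/negP => le21; have [ae' kE'] := tk' _ m1; have [_ kE] := tk _ m1.
    have [_] := rho_nx_mono ae' le21; rewrite -kE -kE' (_ : - m.+1%:Z + 1 = - m%:Z); last by lia.
    by rewrite leNgt IH.
  have [s [iE iA]] := traj_loop ti (fun t t0 => nz _ _ (ik t t0)).
  have [s' [kE kA]] := traj_loop tk (fun t t0 => nz _ _ (kk t t0)).
  pose D t := rho (q1 t) - rho (i t).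
  have DS t : t < 0 -> D (t + 1) = b * D t.
    move=> t0; have [_ k1] := tk t t0; have [_ i1] := ti t t0.
    rewrite /D k1 i1 {1}kA // {1}iA // !rho_S_nx.
    have ee : e (q1 t) = e (i t) := etrans (esym (congr1 val (kA t t0))) (congr1 val (iA t t0)).
    by rewrite ee; ring.
  have Dpow m : D 0 = b ^+ m * D (- m%:Z).
    elim: m => [|m IH]; first by rewrite expr0 mul1r oppr0.
    rewrite IH exprSr -mulrA; congr (_ * _).
    by rewrite -DS; [congr D; lia|lia].
  have Dp : D (- p%:Z) = D 0.
    have pp : - p%:Z <= 0 by lia.
    rewrite /D !kE // !iE // !addr0.
    by rewrite !cycBp.
  have D0 : 0 < D 0 by rewrite subr_gt0 ik.
  have : D 0 < b ^+ p * D 0 by rewrite ltr_pMl // exprn_egt1 // -lt0n period_gt0.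
  by have := Dpow p; rewrite Dp => <-; rewrite ltxx.
move=> ti th th' ih ih'; apply: rho_ord_inj; apply/eqP; rewrite eq_le !leNgt.
by apply/andP; split; apply/negP; [exact: (aux h' h)|exact: (aux h h')].
Qed.

Let rho_nx_strict (i j : 'I_nstates) : (0 < i)%N -> rho i < rho j ->
  rho (nx i (edigit i)) < 1 ->
  (edigit i <= e j)%N /\ rho (nx i (edigit i)) < rho (nx j (edigit i)).
Proof.
move=> i0 ij i1; have [aj _] := @rho_nx_mono i j (edigit i) (leqnn _) (ltW ij).
split=> //; rewrite (rho_nx_min aj) lt_min i1 rho_S_nx /= ltrD2r.
by rewrite ltr_pM2l.
Qed.

(* The partner of the loop states: follow the path starting at state 0 until it
   becomes periodic. *)
Lemma kap_exists : exists kap : int -> 'I_nstates, forall t,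
  [/\ (edigit (cyc t) <= e (kap t))%N, kap (t + 1) = nx (kap t) (edigit (cyc t)),
      rho (cyc t) < rho (kap t) & kap (t + p%:Z) = kap t].
Proof.
pose J := fix J m := if m is m'.+1 then nx (J m') (edigit (cyc m'%:Z)) else ord0.
have Jlt m : rho (cyc m%:Z) < rho (J m).
  elim: m => [|m IH]; first exact: rho_cyc.
  have h1 : rho (nx (cyc m%:Z) (edigit (cyc m%:Z))) < 1 by rewrite cycS.
  have [_] := rho_nx_strict (cyc_gt0 _) IH h1.
  by rewrite cycS (_ : m%:Z + 1 = m.+1%:Z) //; lia.
have JS m : J m.+1 = nx (J m) (edigit (cyc m%:Z)) by [].
have [m1 [l [l0 lE]]] : exists m1 l, (0 < l)%N /\ J (m1 * p)%N = J ((m1 + l) * p)%N.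
  pose f (m : 'I_nstates.+1) := J (m * p)%N.
  have : ~ injective f by move=> /leq_card; rewrite !card_ord ltnn.
  move=> ninj; apply: contrapT => h; apply: ninj => m m' mm.
  apply/val_inj; case: (ltngtP m m') => [lt|lt|//]; exfalso; apply: h.
    by exists m, (m' - m)%N; rewrite subn_gt0 subnKC ?(ltnW lt).
  by exists m', (m - m')%N; rewrite subn_gt0 subnKC ?(ltnW lt).
pose L := (l * p)%N.
have L0 : (0 < L)%N by rewrite muln_gt0 l0 period_gt0.
pose kap (t : int) := J (m1 * p + absz (t %% L%:Z)%Z)%N.
have mL t : 0 <= (t %% L%:Z)%Z < L%:Z.
  by rewrite modz_ge0 ?ltz_pmod // gt_eqF.
have cycL t : cyc (m1 * p + absz (t %% L%:Z)%Z)%N%:Z = cyc t.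
  apply/cyc_eq; rewrite PoszD PoszM modzMDl.
  have -> : (absz (t %% L%:Z)%Z)%:Z = (t %% L%:Z)%Z by have := mL t; lia.
  rewrite [in RHS](divz_eq t L%:Z) /L PoszM mulrA modzMDl.
  by [].
have kapS t : kap (t + 1) = nx (kap t) (edigit (cyc t)).
  rewrite -(cycL t) /kap -JS; have h := mL t.
  have [h1|h1] := ltP ((t %% L%:Z)%Z + 1) L%:Z.
    by rewrite -addnS; congr (J (_ + _)%N); rewrite -modzDml modz_small; lia.
  have h2 : (t %% L%:Z)%Z + 1 = L%:Z by lia.
  have -> : ((t + 1) %% L%:Z)%Z = 0 by rewrite -modzDml h2 modzz.
  rewrite addn0 lE mulnDl -/L -addnS; congr (J (_ + _)%N); lia.
have kaplt t : rho (cyc t) < rho (kap t) by rewrite -(cycL t); exact: Jlt.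
have kaple t : (edigit (cyc t) <= e (kap t))%N.
  have h1 : rho (nx (cyc t) (edigit (cyc t))) < 1 by rewrite cycS.
  by have [] := rho_nx_strict (cyc_gt0 _) (kaplt t) h1.
exists kap => t; split => //; apply/esym.
have cp s : cyc (s + p%:Z) = cyc s by apply/cyc_eq; rewrite modzDr.
(* So far the period of [kap] is only known to divide [L = l * p]. Its translate by p reads the same
   digits and also lies above the loop, so uniqueness lowers the period to p. *)
have := @traj_uniq (fun s => cyc (t + s)) (fun s => kap (t + s)) (fun s => kap (t + s + p%:Z))
  (fun s => edigit (cyc (t + s))).
rewrite /= addr0; apply => s s0.
- by rewrite cycS addrA.
- by rewrite kaple addrA kapS.
- split; first by rewrite -cp kaple.
  by rewrite -[in RHS](cp (t + s)) -kapS; congr kap; lia.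
- exact: kaplt.
- by rewrite -cp; exact: kaplt.
Qed.

(** The chains A and B lie on the diagonal of the fiber product; the two copies C_b pair each loop
    state with its partner, in either order. *)
Let chv (kap : int -> 'I_nstates) (c : bool + bool) (d : nat) : 'I_nstates * 'I_nstates :=
  match c with
  | inl false => (inord d, inord d)
  | inl true => (cyc d, cyc d)
  | inr true => (cyc d, kap d)
  | inr false => (kap d, cyc d)
  end.

(** * The essential part of the fiber product *)

Section cover_standard.
Variables (V : finType) (F : lgraph A V).
Variable u : 'I_nstates -> V.
Hypothesis u_inj : injective u.
Hypothesis uF : forall f : V * A * V, f \in edges F <->
    exists (i : 'I_nstates) a, (a <= e i)%N /\ f = (u i, a, u (nx i a)).
Variable kap : int -> 'I_nstates.
Hypothesis kapP : forall t,
  [/\ (edigit (cyc t) <= e (kap t))%N, kap (t + 1) = nx (kap t) (edigit (cyc t)),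
      rho (cyc t) < rho (kap t) & kap (t + p%:Z) = kap t].

Let E2 := ((V * V) * A * (V * V))%type.
Let vs := chv kap.
Let len := chlen n p.
Let dig := chdigit edigit n.
Let next := chnext edigit n p.

Let fiberP (f : E2) : f \in fiber_product_edges F <->
  exists (i j : 'I_nstates) a, [/\ (a <= e i)%N, (a <= e j)%N &
    f = ((u i, u j), a, (u (nx i a), u (nx j a)))].
Proof.
rewrite finset.inE; split.
  move=> /andP[/uF[i [a [ai e1]]] /uF[j [a' [aj e2]]]].
  move: f e1 e2 => [[[f1 f2] c] [f3 f4]]; rewrite /src /lab /tgt /=.
  move=> [-> -> ->] [-> aa ->]; subst a'; by exists i, j, a.
move=> [i [j [a [ai aj ->]]]]; rewrite /src /lab /tgt /=.
by apply/andP; split; apply/uF; [exists i, a|exists j, a].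
Qed.

Let cyc_ordE (d : nat) : (d < p)%N -> cyc d%:Z = (n + d)%N :> nat.
Proof. by move=> dp; rewrite cycE modz_small //; lia. Qed.

Let inordE (d : nat) : (d < n)%N -> (inord d : 'I_nstates) = d :> nat.
Proof. by move=> dn; rewrite inordK // [X in (_ < X)%N]nstatesE ltn_addr. Qed.

Let edigit_ext i j : i = j -> edigit i = edigit j. Proof. by move=> ->. Qed.

Let vs_step c d a : (d < len c)%N -> (a <= dig c d)%N ->
  [/\ (a <= e (vs c d).1)%N, (a <= e (vs c d).2)%N &
      (nx (vs c d).1 a, nx (vs c d).2 a) = vs (next c d a).1 (next c d a).2].
Proof.
have fall (i : 'I_nstates) : (a < edigit i)%N -> nx i a = inord 0.
  by move=> ai; apply: val_inj; rewrite /= nxE ai inordE.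
have cycwrap (d' : nat) : (d' < p)%N -> (d'.+1 < p)%N = false -> cyc (d'%:Z + 1) = cyc 0.
  move=> dp dp1; have -> : d'%:Z + 1 = p%:Z by lia.
  by apply/cyc_eq; rewrite modzz mod0z.
have kapwrap (d' : nat) : (d' < p)%N -> (d'.+1 < p)%N = false -> kap (d'%:Z + 1) = kap 0.
  move=> dp dp1; have -> : d'%:Z + 1 = 0 + p%:Z by lia.
  by have [] := kapP 0.
have loop : (d < p)%N -> (a <= edigit (n + d))%N ->
    [/\ (a <= e (cyc d))%N, (a < edigit (cyc d))%N = (a < edigit (n + d))%N &
        (a < edigit (n + d))%N = false -> nx (cyc d) a = cyc (d%:Z + 1)].
  move=> dp ad; have ee := edigit_ext (cyc_ordE dp); split.
  - by rewrite -[e _]/(edigit _ : nat) ee.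
  - by rewrite ee.
  - move=> adf; have -> : a = edigit (cyc d); last exact: cycS.
    by rewrite ee; apply/val_inj/eqP; rewrite eqn_leq ad leqNgt adf.
have loopk : (d < p)%N -> (a <= edigit (n + d))%N ->
    [/\ (a <= e (kap d))%N, (a < edigit (n + d))%N -> (a < edigit (kap d))%N &
        (a < edigit (n + d))%N = false -> nx (kap d) a = kap (d%:Z + 1)].
  move=> dp ad; have ee := edigit_ext (cyc_ordE dp).
  have [h1 h2 _ _] := kapP d; rewrite ee in h1 h2; split.
  - exact: leq_trans ad h1.
  - by move=> lt; apply: leq_trans lt h1.
  - move=> adf; have -> : a = edigit (n + d); last by rewrite h2.
    by apply/val_inj/eqP; rewrite eqn_leq ad leqNgt adf.
have dS : d%:Z + 1 = d.+1%:Z by lia.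
rewrite /next /chnext -/dig -/len; case: c => [[]|[]] /= dl ad.
- have [h1 h2 h3] := loop dl ad; split=> //; rewrite /dig /chdigit.
  case: ifP => af; first by rewrite /= (fall (cyc d)) // h2.
  by case: ifP => df /=; rewrite h3 //; [rewrite dS|rewrite (cycwrap d dl df)].
- have ee := edigit_ext (inordE dl); split.
  + by rewrite -[e _]/(edigit _ : nat) ee.
  + by rewrite -[e _]/(edigit _ : nat) ee.
  + rewrite /dig /chdigit; case: ifP => af; first by rewrite /= (fall (inord d)) // ee.
    suff -> : nx (inord d) a = if (d.+1 < n)%N then inord d.+1 else cyc 0.
      by rewrite /len /=; case: ifP.
    apply: val_inj; rewrite /= nxE ee af inordE // ifT ?(leq_trans dl) ?leq_addr //; last first.
      by have := period_gt0; lia.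
    by case: ifP => dn; [rewrite inordE|rewrite cycE mod0z; lia].
- have [h1 h2 h3] := loop dl ad; have [k1 k2 k3] := loopk dl ad; split=> //; rewrite /dig /chdigit.
  case: ifP => af; first by rewrite /= (fall (cyc d)) ?h2 // (fall (kap d)) // k2.
  by case: ifP => df /=; rewrite h3 // k3 //; [rewrite dS|rewrite (cycwrap d dl df) (kapwrap d dl df)].
- have [h1 h2 h3] := loop dl ad; have [k1 k2 k3] := loopk dl ad; split=> //; rewrite /dig /chdigit.
  case: ifP => af; first by rewrite /= (fall (cyc d)) ?h2 // (fall (kap d)) // k2.
  by case: ifP => df /=; rewrite h3 // k3 //; [rewrite dS|rewrite (cycwrap d dl df) (kapwrap d dl df)].
Qed.

Let len_gt0 c : (0 < len c)%N.
Proof. by case: c => -[]; rewrite /= ?period_gt0. Qed.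

(** The strict inequality between the remainders of [cyc t] and [kap t] separates the copies C_b
    from the diagonal and from each other. *)
Let vs_inj c d c' d' : (d < len c)%N -> (d' < len c')%N -> vs c d = vs c' d' ->
  c = c' /\ d = d'.
Proof.
have off (s t : int) : kap s <> cyc s by have [_ _ + _] := kapP s => /[swap] ->; rewrite ltxx.
have cc (d1 d2 : nat) : (d1 < p)%N -> (d2 < p)%N -> cyc d1 = cyc d2 -> d1 = d2.
  by move=> h1 h2 /(congr1 val) /=; rewrite !cyc_ordE // => /addnI.
have ci (d1 d2 : nat) : (d1 < p)%N -> (d2 < n)%N -> cyc d1 <> inord d2.
  by move=> h1 h2 /(congr1 val) /=; rewrite cyc_ordE // inordE //; lia.
have cross (s t : int) : kap s = cyc t -> kap t = cyc s -> False.
  move=> h1 h2; have [_ _ k1 _] := kapP s; have [_ _ k2 _] := kapP t.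
  by move: k1 k2; rewrite h1 h2 => k1 k2; have := lt_trans k1 k2; rewrite ltxx.
case: c c' => [[]|[]] [[]|[]] /= l1 l2 [] h1 h2.
- by split=> //; exact: cc h1.
- by case: (ci _ _ l1 l2 h1).
- by case: (off d' d'); rewrite -h1 -h2.
- by case: (off d' d'); rewrite -h1 -h2.
- by case: (ci _ _ l2 l1 (esym h1)).
- split=> //; move: (congr1 val h1) => /=; by rewrite !inordE.
- by case: (off d' d'); rewrite -h1 -h2.
- by case: (off d' d'); rewrite -h1 -h2.
- by case: (off d d); rewrite h1 h2.
- by case: (off d d); rewrite h1 h2.
- by split=> //; exact: cc h1.
- by case: (cross d d'); rewrite // h2.
- by case: (off d d); rewrite h1 h2.
- by case: (off d d); rewrite h1 h2.
- by case: (cross d d').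
- by split=> //; exact: cc h2.
Qed.

Let next_lt c d a : (d < len c)%N -> ((next c d a).2 < len (next c d a).1)%N.
Proof.
rewrite /next /chnext -/len => dl; case: ifP => _ /=; first exact: n_gt0.
by case: ifP => //= _; case: (c) => -[]; rewrite /= ?period_gt0.
Qed.

Let vp c d : V * V := (u (vs c d).1, u (vs c d).2).

Let letter := salph k n p.
Let valid (x : letter) := svalid edigit x.
Let depth (x : letter) : nat := x.1.2.

Let emb0 (x : letter) : E2 :=
  let c' := next x.1.1 (depth x) x.2 in (vp x.1.1 (depth x), x.2, vp c'.1 c'.2).

Let vp_inj c d c' d' : (d < len c)%N -> (d' < len c')%N -> vp c d = vp c' d' ->
  c = c' /\ d = d'.
Proof.
move=> h1 h2 [/u_inj e1 /u_inj e2]; apply: vs_inj => //.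
by rewrite [LHS]surjective_pairing e1 e2 -surjective_pairing.
Qed.

Let mk (c : bool + bool) (d : nat) (a : A) : letter := (c, inord d, a).

Let depth_mk c d a : (d < len c)%N -> depth (mk c d a) = d.
Proof.
move=> dl; rewrite /depth /= inordK // ltnS; apply: ltnW; apply: leq_trans dl _.
by case: (c) => -[]; rewrite /= ?leq_addr ?leq_addl.
Qed.

Let emb0_edge x : valid x -> emb0 x \in fiber_product_edges F.
Proof.
move=> /andP[dl ad]; have [h1 h2 h3] := vs_step dl ad.
apply/fiberP; exists (vs x.1.1 (depth x)).1, (vs x.1.1 (depth x)).2, x.2; split=> //.
rewrite /emb0 /vp -h3 //.
Qed.

Let valids : {set letter} := [set x : letter | valid x].
Let std_cover_edges : {set E2} := emb0 @: valids.
Let std_cover_vertices : {set V * V} := (@src _ _) @: std_cover_edges.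

Let prev_ex c d : (d < len c)%N -> exists x, valid x /\ next x.1.1 (depth x) x.2 = (c, d).
Proof.
case: d => [|d] dl; last first.
  exists (mk c d (dig c d)); have dl' := ltnW dl.
  rewrite /valid /svalid -/len -/dig -/(depth _) depth_mk //= dl' leqnn; split=> //.
  by rewrite /next /chnext ltnn dl.
have wrap c' : chsucc c' = c -> exists x, valid x /\ next x.1.1 (depth x) x.2 = (c, 0%N).
  move=> cc'; exists (mk c' (len c').-1 (dig c' (len c').-1)).
  have h : ((len c').-1 < len c')%N by rewrite prednK.
  rewrite /valid /svalid -/len -/dig -/(depth _) depth_mk //= h leqnn; split=> //.
  by rewrite /next /chnext ltnn -/len prednK // ltnn cc'.
case: c dl wrap => [[]|c] dl wrap.
- exact: (wrap (inl true)).
- pose zero : A := Ordinal (leq_ltn_trans (leq0n _) (e_lt_size b_gt1 nfin 0)).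
  exists (mk (inl false) 0 zero); rewrite /valid /svalid -/(depth _) depth_mk //= n_gt0.
  split=> //; rewrite /next /chnext ifT //; exact: e0_gt0.
- exact: (wrap (inr c)).
Qed.

Let self_out c d : (d < len c)%N -> vp c d \in std_cover_vertices.
Proof.
move=> dl; apply/imsetP; exists (emb0 (mk c d (dig c d))).
  apply: imset_f; rewrite finset.inE /valid /svalid -/(depth _) depth_mk //=.
  by rewrite -/len dl leqnn.
by rewrite /emb0 /src depth_mk.
Qed.

Fact std_cover_endpoints f : f \in std_cover_edges ->
  (src f \in std_cover_vertices) && (tgt f \in std_cover_vertices).
Proof.
case/imsetP => x; rewrite finset.inE => /andP[dl ad] ->.
by rewrite /src /tgt /= !self_out //; exact: next_lt.
Qed.

Let std_cover : lgraph A (V * V)%type := LGraph std_cover_endpoints.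

Let emb0_cover x : valid x -> emb0 x \in edges (fiber_product_cover F).
Proof.
move=> xv; rewrite finset.inE; apply/asboolP; exists std_cover; split.
- have sub : std_cover_edges \subset fiber_product_edges F.
    apply/fintype.subsetP => _ /imsetP[y + ->]; rewrite finset.inE; exact: emb0_edge.
  apply/andP; split=> //; apply/fintype.subsetP => _ /imsetP[f fE ->].
  by have /andP[] := fiber_product_endpoints (fintype.subsetP sub _ fE).
- move=> _ /imsetP[_ /imsetP[y + ->] ->]; rewrite finset.inE => yv; split.
    by exists (emb0 y) => //; apply: imset_f; rewrite finset.inE.
  have /andP[dl _] := yv; have [z [zv ze]] := prev_ex dl.
  exists (emb0 z); first by apply: imset_f; rewrite finset.inE.
  by rewrite /tgt /emb0 /= ze.
- by apply: imset_f; rewrite finset.inE.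
Qed.

(** An edge of the cover lies on a biinfinite path. If its two source states differ, the one with
    the smaller remainder had the smaller remainder throughout the past, hence never met state 0 and
    was always in the loop; by [traj_uniq] the other coordinate is then its partner. *)
Let cover_emb0 (f : E2) : f \in edges (fiber_product_cover F) ->
  exists2 x, valid x & f = emb0 x.
Proof.
move=> fP; have [/andP[_ /fintype.subsetP sub] ess _] := max_essential_subgraphP (fiber_product_graph F).
have [x [xP x0]] := essential_path ess fP.
have xf t : exists w : 'I_nstates * 'I_nstates * A, [/\ (w.2 <= e w.1.1)%N, (w.2 <= e w.1.2)%N &
    x t = ((u w.1.1, u w.1.2), w.2, (u (nx w.1.1 w.2), u (nx w.1.2 w.2)))].
  have [/sub/fiberP[i [j [a [h1 h2 h3]]]] _] := xP t.
  by exists (i, j, a).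
have /choice[w wP] := xf.
pose i t := (w t).1.1; pose j t := (w t).1.2; pose a t := (w t).2.
have stepij t : i (t + 1) = nx (i t) (a t) /\ j (t + 1) = nx (j t) (a t).
  have [_] := xP t; have [_ _ ->] := wP t; have [_ _ ->] := wP (t + 1).
  by rewrite /tgt /src /= => -[/u_inj e1 /u_inj e2]; rewrite /i /j e1 e2.
have [ai0 aj0 x0E] := wP 0; rewrite x0 in x0E.
have mkP c d : (d < len c)%N -> vs c d = (i 0, j 0) -> (a 0 <= dig c d)%N ->
    exists2 y, valid y & f = emb0 y.
  move=> dl vE ad; exists (mk c d (a 0)).
    by rewrite /valid /svalid -/(depth _) depth_mk //= dl ad.
  have [_ _] := vs_step dl ad; rewrite /emb0 depth_mk //= /vp => <-.
  by rewrite vE x0E.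
have offdiag (h h' : int -> 'I_nstates) :
    (forall t, (a t <= e (h t))%N) -> (forall t, (a t <= e (h' t))%N) ->
    (forall t, h (t + 1) = nx (h t) (a t)) -> (forall t, h' (t + 1) = nx (h' t) (a t)) ->
    rho (h 0) < rho (h' 0) -> exists d : nat, [/\ (d < p)%N, h 0 = cyc d & h' 0 = kap d].
  move=> ha ha' hS hS' hh0.
  have hh t : t <= 0 -> rho (h t) < rho (h' t).
    move=> t0; have [m ->] : exists m : nat, t = - m%:Z by exists `|t|%N; lia.
    elim: m => [|m IH]; first by rewrite oppr0.
    rewrite ltNge; apply/negP => le21.
    have [_] := rho_nx_mono (ha' (- m.+1%:Z)) le21; rewrite -hS -hS'.
    rewrite (_ : - m.+1%:Z + 1 = - m%:Z); last by lia.
    by rewrite leNgt IH.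
  have th : traj h a by move=> t _.
  have nz t : t <= 0 -> h t <> ord0.
    move=> t0 h0; have := hh t t0; rewrite h0 ltNge.
    by have /andP[_ ->] := rho_le1 b (h' t).
  have [s [hE aE]] := traj_loop th nz.
  exists (absz (s %% p%:Z)%Z); have sm := modp_itv s.
  have se : cyc (absz (s %% p%:Z)%Z) = cyc s.
    by apply/cyc_eq; rewrite gez0_abs ?modz_mod //; lia.
  split; first by lia.
    by rewrite hE // addr0 se.
  have kmod t : kap (absz (t %% p%:Z)%Z) = kap t.
    have per q : forall m, kap (q + m * p%:Z) = kap q.
      apply: int_ind => [|m IH|m]; first by rewrite mul0r addr0.
        by rewrite mulrDl mul1r addrA; have [_ _ _ ->] := kapP (q + m * p%:Z).
      by rewrite mulrDl mul1r addrA; have [_ _ _ ->] := kapP (q + m * p%:Z).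
    have -> : (absz (t %% p%:Z)%Z)%:Z = (t %% p%:Z)%Z by have := modp_itv t; lia.
    by rewrite [in RHS](divz_eq t p%:Z) addrC per.
  rewrite kmod -[s]addr0; apply: (@traj_uniq (fun t => cyc (s + t)) h'
      (fun t => kap (s + t)) (fun t => edigit (cyc (s + t)))).
  - by move=> t t0; rewrite leqnn cycS addrA.
  - move=> t t0; have aa : edigit (cyc (s + t)) = a t by rewrite aE // hE // ltW.
    by rewrite aa.
  - move=> t t0; have [k1 k2 _ _] := kapP (s + t).
    by rewrite addrA k2.
  - by move=> t t0; rewrite -hE // hh.
  - by move=> t t0; have [_ _ + _] := kapP (s + t).
have adig (d : nat) : (d < p)%N -> (a 0 <= e (cyc d))%N -> (a 0 <= edigit (n + d))%N.
  by move=> dp; rewrite -[e _]/(edigit _ : nat) (edigit_ext (cyc_ordE dp)).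
have [ij|ij|ij] := ltgtP (rho (i 0)) (rho (j 0)).
- have [d [dp i0 j0]] := offdiag i j (fun t => let: And3 h _ _ := wP t in h)
    (fun t => let: And3 _ h _ := wP t in h) (fun t => (stepij t).1) (fun t => (stepij t).2) ij.
  apply: (mkP (inr true) d) => //; first by rewrite /vs /= i0 j0.
  by apply: adig => //; rewrite -i0.
- have [d [dp j0 i0]] := offdiag j i (fun t => let: And3 _ h _ := wP t in h)
    (fun t => let: And3 h _ _ := wP t in h) (fun t => (stepij t).2) (fun t => (stepij t).1) ij.
  apply: (mkP (inr false) d) => //; first by rewrite /vs /= i0 j0.
  by apply: adig => //; rewrite -j0.
- have {}ij := rho_ord_inj ij; have [i0n|i0n] := ltnP (i 0) n.
    apply: (mkP (inl false) (i 0)) => //.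
    by rewrite /vs /= -ij; congr (_, _); apply: val_inj; rewrite /= inordE.
  have dp : (i 0%R - n < p)%N by rewrite ltn_subLR // state_lt.
  have ci : cyc (i 0%R - n)%N = i 0 by apply: val_inj; rewrite /= cyc_ordE // subnKC.
  apply: (mkP (inl true) (i 0%R - n)%N) => //; first by rewrite /vs /= -ij ci.
  by apply: adig => //; rewrite ci.
Qed.

Let zero : A := Ordinal (leq_ltn_trans (leq0n _) (e_lt_size b_gt1 nfin 0)).

(* Not an edge, since the digit 0 leads from state 0 to itself. *)
Let junk : E2 := ((u ord0, u ord0), zero, (u (cyc 0), u (cyc 0))).

Let emb (x : letter) : E2 := if valid x then emb0 x else junk.

Let junk_cover : junk \notin edges (fiber_product_cover F).
Proof.
have [/andP[_ /fintype.subsetP sub] _ _] := max_essential_subgraphP (fiber_product_graph F).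
apply/negP => /sub/fiberP[i [j [a [_ _ []]]]] /u_inj <- _ <- /u_inj h _.
have := congr1 val h; rewrite /= cycE mod0z nxE ifT; last exact: e0_gt0.
by move/eqP; rewrite addn_eq0 => /andP[/eqP n0 _]; have := n_gt0; rewrite n0.
Qed.

Let emb_cover x : (emb x \in edges (fiber_product_cover F)) = valid x.
Proof. by rewrite /emb; case: ifP => xv; [exact: emb0_cover|exact: negbTE junk_cover]. Qed.

Let letter_ext (x y : letter) :
  x.1.1 = y.1.1 -> depth x = depth y -> x.2 = y.2 -> x = y.
Proof. by move: x y => [[c d] a] [[c' d'] a']; rewrite /depth /= => -> /val_inj -> ->. Qed.

Lemma std_cover_fe : fe R (std_sys edigit n p) (cover_sys F).
Proof.
apply: (@relabel_fe R (std_sys edigit n p) (cover_sys F) emb).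
- move=> x y x' y' /and3P[xv _ _] /and3P[yv _ _]; rewrite /emb !ifT //.
  move: xv yv => /andP[xl _] /andP[yl _] [h1 h2 h3 _ _].
  have [cc dd] := @vp_inj x.1.1 (depth x) y.1.1 (depth y) xl yl (f_equal2 pair h1 h2).
  exact: letter_ext.
- move=> x y; rewrite /= /cover_adj !emb_cover /sadj -!/(valid _).
  case xv : (valid x) => //; case yv : (valid y) => //=.
  rewrite /emb xv yv /tgt /src /= -/(depth _) -/(depth _) -/(next _ _ _).
  have /andP[xl _] := xv; have /andP[yl _] := yv.
  apply/eqP/eqP => [h|<-//].
  have [e1 e2] := vp_inj (next_lt x.2 xl) yl h.
  by rewrite [RHS]surjective_pairing; congr pair; rewrite ?e1 ?e2.
- move=> x; have /and3P[h _ _] := sv_adj x 0.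
  by have [y yv ->] := cover_emb0 h; exists y; rewrite /emb yv.
- move=> x; rewrite /emb /= [valid _]svalid_flip -/(valid x); case: (valid x) => //.
  have vpf c d : vp (chflip c) d = swap_vertex (vp c d) by case: c => -[].
  rewrite /emb0 /depth /= vpf; congr (_, _, _).
  by rewrite /next chnext_flip /= vpf.
Qed.

End cover_standard.

Theorem cover_std_fe (V : finType) (F : lgraph A V) :
  right_fischer_cover F (beta_shift b) -> fe R (std_sys edigit n p) (cover_sys F).
Proof.
move=> /fischer_cover_std[u [ui uF]]; have [kap kapP] := kap_exists.
exact: (std_cover_fe ui uF kapP).
Qed.

End fischer_cover_structure.

Lemma cover_tail_fe (R : realType) (b : R) (n p : nat) (V : finType)
    (F : lgraph 'I_(alphabet_size b) V) : 1 < b ->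
  ~ periodic (generating_seq b) ->
  minimal_ultimately_periodic (generating_seq b) n p ->
  right_fischer_cover F (beta_shift b) ->
  fe R (cover_sys F) (tail_sys 'I_(\sum_(j < p) generating_seq b (n + j))).
Proof.
move=> b1 nper; have [-> nfin] := generating_seq_nper nper => mup Fc.
have n_gt0 : (0 < n)%N.
  rewrite lt0n; apply/eqP => n0; apply: (nper); have [-> _] := generating_seq_nper nper.
  by exists p; case: mup; rewrite n0.
have p_gt0 := period_gt0 mup.
pose g := edigit b1 nfin.
have cardE : #|loop_falls g n p| = (\sum_(j < p) expansion1 b (n + j))%N.
  exact: card_loop_falls.
(* An exit is needed to absorb the loops at A. Without exits all digits of the period would vanish
   and the expansion would be finite. *)
have S_gt0 : (0 < #|loop_falls g n p|)%N.
  rewrite cardE lt0n; apply/negP; rewrite sum_nat_eq0 => /forallP sum0.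
  have [m nm] := digit_nz nfin n; apply.
  have [[_ up] _] := mup.
  have [j hj] : exists j, m = (n + j)%N by exists (m - n)%N; lia.
  rewrite hj (divn_eq j p); have jp : (j %% p < p)%N by rewrite ltn_mod.
  elim: (j %/ p)%N => [|q IH].
    by rewrite mul0n add0n; have /eqP := sum0 (Ordinal jp).
  rewrite -IH mulSn -[in RHS]up ?leq_addr //; congr (expansion1 b); lia.
rewrite -cardE; apply: fe_trans (fe_sym (tail_sys_fe R _)).
apply: fe_trans (loop_sys_void R (trans_falls g n) S_gt0).
apply: fe_sym; apply: fe_trans (loop_std_fe g n_gt0 p_gt0 R) _.
exact: (cover_std_fe b1 nfin mup n_gt0 Fc).
Qed.

Lemma fe_flow_equivalence (R : realType) (A V A' V' : finType)
    (F : lgraph A V) (F' : lgraph A' V') : fe R (cover_sys F) (cover_sys F') ->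
  exists Phi : susp_cover R F -> susp_cover R F',
    flow_equivalence Phi /\ forall z, Phi (susp_swap z) = susp_swap (Phi z).
Proof.
case=> Phi [hP fP sP]; exists Phi; split=> //; split=> // z.
by have [phi [_ [mphi _ e]]] := fP z; exists phi.
Qed.

(** * Weighted automata and determinants *)

Section jacobi.
Variables (R : comNzRingType) (n : nat).
Implicit Type A : 'M[{poly R}]_n.

Lemma deriv_prod (I : finType) (F : I -> {poly R}) :
  (\prod_i F i)^`() = \sum_i (F i)^`() * \prod_(j | j != i) F j.
Proof.
have h (s : seq I) : uniq s -> (\prod_(i <- s) F i)^`() =
    \sum_(i <- s) (F i)^`() * \prod_(j <- s | j != i) F j.
  elim: s => [|i s IH] /=; first by rewrite !big_nil derivC.
  move=> /andP[is_ us]; rewrite !big_cons eqxx derivM IH //= mulr_sumr; congr (_ + _).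
    congr (_ * _); rewrite big_seq_cond [RHS]big_seq_cond; apply: eq_bigl => j.
    by rewrite andbT; case: (boolP (j \in s)) => //= js; case: eqP js is_ => [->->|].
  rewrite big_seq [RHS]big_seq; apply: eq_bigr => j js.
  rewrite big_cons ifT; last by apply: contraNneq is_ => ->.
  by rewrite mulrCA.
have := h (index_enum I) (index_enum_uniq I); by [].
Qed.

(** The product rule turns the Leibniz sum into one determinant for each row, with that row
    differentiated; expanding along this row produces the cofactors. *)
Lemma jacobi A : (\det A)^`() = \tr (\adj A *m map_mx (@deriv R) A).
Proof.
have rowdet i : \sum_(s : 'S_n) (-1) ^+ s *
    ((A i (s i))^`() * \prod_(j | j != i) A j (s j)) =
    \sum_j (A i j)^`() * cofactor A i j.
  pose B := \matrix_(k, l) if k == i then (A i l)^`() else A k l.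
  have -> : \sum_(s : 'S_n) (-1) ^+ s *
      ((A i (s i))^`() * \prod_(j | j != i) A j (s j)) = \det B.
    apply: eq_bigr => s _; congr (_ * _); rewrite [RHS](bigD1 i) //= mxE eqxx; congr (_ * _).
    by apply: eq_bigr => j /negbTE ji; rewrite mxE ji.
  rewrite (expand_det_row _ i); apply: eq_bigr => j _; rewrite mxE eqxx; congr (_ * _).
  rewrite /cofactor; congr (_ * \det _); apply/matrixP => k l; rewrite !mxE.
  by rewrite eq_sym (negbTE (neq_lift _ _)).
rewrite raddf_sum /=.
transitivity (\sum_i \sum_j (A i j)^`() * cofactor A i j).
  rewrite -(eq_bigr _ (fun i _ => rowdet i)) exchange_big /=; apply: eq_bigr => s _.
  rewrite -mulr_sumr -deriv_prod; case: (s : bool).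
    by rewrite expr1 !mulN1r derivN.
  by rewrite expr0 !mul1r.
rewrite /mxtrace exchange_big /=; apply: eq_bigr => j _; rewrite mxE.
by apply: eq_bigr => i _; rewrite !mxE mulrC.
Qed.

End jacobi.

Section weighted_automaton.
Variables (n : nat) (La : finType) (del : 'I_n -> La -> 'I_n) (e : 'I_n -> La -> nat).
Implicit Types (u v : 'I_n) (w : seq La).

Fixpoint wt u w : nat := if w is a :: w' then (e u a + wt (del u a) w')%N else 0%N.

Definition trans_mx : 'M[int]_n := \matrix_(u, v) \sum_a (del u a == v)%:R.

Let M : 'M[{poly int}]_n := \matrix_(u, v) \sum_a (del u a == v)%:R * 'X^(e u a).

Lemma sum_tuple_cons (V : nmodType) j (F : seq La -> V) :
  \sum_(w : j.+1.-tuple La) F w = \sum_a \sum_(w : j.-tuple La) F (a :: w).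
Proof.
rewrite pair_bigA /= (reindex (fun x : La * j.-tuple La => [tuple of x.1 :: x.2])) //=.
exists (fun w : j.+1.-tuple La => (thead w, [tuple of behead w])) => [[a w] _|w _] /=.
  by congr (_, _); apply: val_inj.
by rewrite [RHS](tuple_eta w); apply: val_inj.
Qed.

Let M_pow j u v : (M ^+ j) u v =
  \sum_(w : j.-tuple La) (foldl del u w == v)%:R * 'X^(wt u w).
Proof.
elim: j u => [|j IH] u.
  rewrite expr0 -[LHS]/(1%:M u v) mxE (big_pred1 [tuple]) /= ?expr0 ?mulr1 ?mulrb //.
  by move=> w; apply/esym/eqP; exact: tuple0.
rewrite exprS -[LHS]/((M *m M ^+ j) u v) mxE (@sum_tuple_cons _ j (fun w => (foldl del u w == v)%:R * 'X^(wt u w))) /=.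
under eq_bigr => v' _ do rewrite mxE mulr_suml.
rewrite exchange_big /=; apply: eq_bigr => a _.
rewrite (bigD1 (del u a)) //= eqxx mul1r big1 ?addr0; last first.
  by move=> v' /negbTE h; rewrite eq_sym h !mul0r.
rewrite IH mulr_sumr; apply: eq_bigr => w _.
by rewrite exprD mulrCA.
Qed.

Variable k : nat.
Hypothesis closed_gt0 : forall u w, w != [::] -> foldl del u w = u -> (0 < wt u w)%N.

Lemma wt_cat u w1 w2 : wt u (w1 ++ w2) = (wt u w1 + wt (foldl del u w1) w2)%N.
Proof. by elim: w1 u => //= a w1 IH u; rewrite IH addnA. Qed.

(* A word of length [n] visits some state twice. *)
Lemma wt_long N u w : (n * N <= size w)%N -> (N <= wt u w)%N.
Proof.
elim: N u w => // N IH u w; rewrite mulnS => nw.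
pose s (t : 'I_n.+1) := foldl del u (take t w).
have /injectivePn[t1 [t2 t12 s12]] : ~~ injectiveb s.
  by apply/injectiveP => /leq_card; rewrite !card_ord ltnn.
have {t12 s12} [i [j [ij jn sij]]] : exists i j, [/\ (i < j)%N, (j <= n)%N &
    foldl del u (take i w) = foldl del u (take j w)].
  have [lt|gt|/val_inj/eqP] := ltngtP t1 t2; last by rewrite (negbTE t12).
    by exists t1, t2; split=> //; rewrite -ltnS.
  by exists t2, t1; split=> //; rewrite -ltnS.
have jw : (j <= size w)%N by lia.
have tE : take i w = take i (take j w) by rewrite take_takel // ltnW.
have wE : w = take i w ++ drop i (take j w) ++ drop j w.
  by rewrite catA tE cat_take_drop cat_take_drop.
rewrite wE !wt_cat; set v := foldl del u (take i w).
have loop : foldl del v (drop i (take j w)) = v.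
  by rewrite {1}/v -foldl_cat tE cat_take_drop -sij.
have := IH (foldl del v (drop i (take j w))) (drop j w).
rewrite size_drop => /(_ _)/wrap[|h]; first by lia.
have : (0 < wt v (drop i (take j w)))%N.
  apply: closed_gt0 loop; rewrite -size_eq0 size_drop size_take_min (minn_idPl jw); lia.
by lia.
Qed.

(** The left side is the coefficient of X^m in the sum of the traces of X M' M^j over j < I, the
    right side the number of points fixed by the m-th power of a full shift on k letters. The bound
    on [I] ensures that the omitted words, being longer than [I], weigh more than [m]. *)
Hypothesis counts : forall m I, (0 < m)%N -> (n * m.+1 <= I)%N ->
  (\sum_(j < I) \sum_a \sum_(w : j.-tuple La)
     \sum_(u | (foldl del u (a :: w) == u) && (wt u (a :: w) == m)) e u a
   = k ^ m)%N.

Let D := \det (1%:M - M).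

Let zero_upto N (q : {poly int}) := forall m, (m < N)%N -> q`_m = 0.

Let zero_uptoM N q q' : zero_upto N q -> zero_upto N (q * q').
Proof.
move=> h m mN; rewrite coefM big1 // => i _; rewrite h ?mul0r //.
by have := ltn_ord i; lia.
Qed.

Let zero_upto_sum N (J : finType) (F : J -> {poly int}) :
  (forall i, zero_upto N (F i)) -> zero_upto N (\sum_i F i).
Proof. by move=> h m mN; rewrite coef_sum big1 // => i _; exact: h. Qed.

Let pow_small N I : (forall u w, size w = I -> (N <= wt u w)%N) ->
  forall u v, zero_upto N ((M ^+ I) u v).
Proof.
move=> h u v; rewrite M_pow; apply: zero_upto_sum => w m mN.
rewrite mulrC; apply: (@zero_uptoM N) => // l lN; rewrite coefXn; case: eqP => // le.
by have := h u w (size_tuple w); lia.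
Qed.

Let geom I : (1 - M) * (\sum_(i < I) M ^+ i) = 1 - M ^+ I.
Proof.
elim: I => [|I IH]; first by rewrite big_ord0 mulr0 expr0 subrr.
by rewrite big_ord_recr /= mulrDr IH exprS mulrBl mul1r addrA subrK.
Qed.

Let N : 'M[{poly int}]_n :=
  \matrix_(u, v) \sum_a (del u a == v)%:R * ((e u a)%:R * 'X^(e u a)).

Let XderivM : 'X *: map_mx (@deriv int) M = N.
Proof.
apply/matrixP => u v; rewrite !mxE raddf_sum mulr_sumr; apply: eq_bigr => a _ /=.
case: (del u a == v); last by rewrite !mul0r deriv0 mulr0.
rewrite !mul1r derivXn; case: (e u a) => [|m]; first by rewrite mulr0n mulr0 mul0r.
by rewrite /= mulrnAr -exprS mulr_natl.
Qed.

Let trace_term j : \tr (N *m M ^+ j) =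
  \sum_a \sum_(w : j.-tuple La) \sum_u
    (foldl del u (a :: w) == u)%:R * ((e u a)%:R * 'X^(wt u (a :: w))).
Proof.
rewrite /mxtrace; under [RHS]eq_bigr => a _ do rewrite exchange_big /=.
rewrite [RHS]exchange_big /=; apply: eq_bigr => u _; rewrite mxE.
under [LHS]eq_bigr => v _ do rewrite [N u v]mxE mulr_suml.
rewrite exchange_big /=; apply: eq_bigr => a _.
rewrite (bigD1 (del u a)) //= eqxx mul1r big1 ?addr0; last first.
  by move=> v /negbTE h; rewrite eq_sym h !mul0r.
rewrite M_pow mulr_sumr; apply: eq_bigr => w _.
by rewrite exprD; ring.
Qed.

Let coef_term b c i m : ((nat_of_bool b)%:R * (c%:R * 'X^i) : {poly int})`_m =
  if b && (i == m) then c%:R else 0.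
Proof.
case: b; last by rewrite mul0r coef0.
rewrite mul1r -polyC_natr coefCM coefXn eq_sym.
by case: eqP; rewrite ?mulr1 ?mulr0.
Qed.

Let U I : {poly int} := \sum_(j < I) \tr (N *m M ^+ j).

Let coefU I m : (U I)`_m = (\sum_(j < I) \sum_a \sum_(w : j.-tuple La)
  \sum_(u | (foldl del u (a :: w) == u) && (wt u (a :: w) == m)) e u a)%N%:R.
Proof.
rewrite natr_sum coef_sum; apply: eq_bigr => j _; rewrite trace_term natr_sum coef_sum.
apply: eq_bigr => a _; rewrite natr_sum coef_sum; apply: eq_bigr => w _.
rewrite natr_sum coef_sum [RHS]big_mkcond; apply: eq_bigr => u _.
exact: coef_term.
Qed.

Let U0 I : (U I)`_0 = 0.
Proof.
rewrite coefU big1 // => j _; rewrite big1 // => a _; rewrite big1 // => w _.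
rewrite big1 // => u /andP[/eqP c /eqP w0].
by have := @closed_gt0 u (a :: w) isT c; rewrite w0.
Qed.

(** The logarithmic derivative of [D] without power series: the geometric series for the inverse of
    1 - M is cut off at [I], and by [wt_long] the last term vanishes to high order when [I] is
    large. *)
Let D_deriv I : - 'X * D^`() = D * U I + \tr (\adj (1%:M - M) *m M ^+ I *m N).
Proof.
have adjE : \adj (1%:M - M) = D *: (\sum_(i < I) M ^+ i) + \adj (1%:M - M) *m M ^+ I.
  have h : D%:M *m (\sum_(i < I) M ^+ i) = \adj (1%:M - M) - \adj (1%:M - M) *m M ^+ I.
    rewrite -mul_adj_mx -mulmxA -[X in _ *m X = _]/((1 - M) * _) geom.
    by rewrite mulmxBr mulmx1.
  by rewrite -mul_scalar_mx h subrK.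
rewrite jacobi.
have -> : map_mx (@deriv int) (1%:M - M) = - map_mx (@deriv int) M.
  apply/matrixP => u v; rewrite !mxE derivB.
  by case: (u == v); rewrite ?derivC ?deriv0 sub0r.
rewrite mulmxN raddfN /= mulNr mulrN opprK -linearZ /= scalemxAr XderivM [in LHS]adjE.
rewrite mulmxDl raddfD /= -scalemxAl linearZ /=; congr (_ * _ + _).
rewrite mulmx_suml raddf_sum; apply: eq_bigr => j _; exact: mxtrace_mulC.
Qed.

(** Comparing coefficients expresses [- l * D_l] as the sum of [D_i * k ^ (l - i)] over i < l.
    Subtracting k times the relation for [m] from that for [m + 1] leaves this recursion, whose
    factor m - 1 kills every coefficient from the second on. *)
Let D_rec m : (m.+1)%:R * D`_m.+1 = k%:R * ((m%:R - 1) * D`_m).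
Proof.
pose I := (n * m.+2)%N.
have small u w : size w = I -> (m.+2 <= wt u w)%N by move=> wI; apply: wt_long; rewrite wI.
have eqs l : (l <= m.+1)%N -> - (l%:R * D`_l) = \sum_(i < l) D`_i * (k ^ (l - i))%:R.
  move=> lm; have := congr1 (fun q : {poly int} => q`_l) (D_deriv I); rewrite coefD /=.
  have -> : (\tr (\adj (1%:M - M) *m M ^+ I *m N))`_l = 0.
    apply: (@zero_upto_sum m.+2) => // i; rewrite mxE; apply: zero_upto_sum => v.
    apply: zero_uptoM; rewrite mxE; apply: zero_upto_sum => v' i' im; rewrite mulrC.
    by apply: (@zero_uptoM m.+2) => //; exact: pow_small.
  rewrite addr0 mulNr coefN coefXM => e1.
  have -> : l%:R * D`_l = (if l == 0%N then 0 else (D^`())`_l.-1).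
    by case: (l) => [|l'] /=; [rewrite mul0r|rewrite coef_deriv mulr_natl].
  rewrite e1 coefM big_ord_recr /= subnn U0 mulr0 addr0; apply: eq_bigr => i _.
  rewrite coefU counts //; first by have := ltn_ord i; lia.
  by rewrite leq_mul2l; have := ltn_ord i; lia.
have e1 := eqs m.+1 (leqnn _); have e0 := eqs m (leqnSn _).
rewrite big_ord_recr /= subSnn expn1 in e1.
have e2 : \sum_(i < m) D`_i * (k ^ (m.+1 - i))%:R = k%:R * (\sum_(i < m) D`_i * (k ^ (m - i))%:R).
  rewrite mulr_sumr; apply: eq_bigr => i _.
  by rewrite subSn 1?ltnW // expnS natrM; ring.
rewrite e2 -e0 in e1; rewrite -[LHS]opprK e1; ring.
Qed.

Let D_eq : D = (D`_0)%:P * (1 - k%:R *: 'X).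
Proof.
have D1 : D`_1 = - k%:R * D`_0.
  by have := D_rec 0; rewrite mul1r sub0r => ->; ring.
have D2 m : D`_m.+2 = 0.
  elim: m => [|m IH].
    have := D_rec 1; rewrite subrr mul0r mulr0 => /eqP.
    by rewrite mulf_eq0 pnatr_eq0 => /eqP.
  have := D_rec m.+2; rewrite IH !mulr0 => /eqP.
  by rewrite mulf_eq0 pnatr_eq0 => /eqP.
apply/polyP => -[|[|m]]; rewrite coefCM coefB coefZ coef1 coefX /= ?D1 ?D2; ring.
Qed.

(* The determinant of an integer matrix that is the identity minus a
   nilpotent matrix is a unit; here the nilpotent matrix is the constant term
   of the weighted transition matrix. *)
Let D0_unit : absz D`_0 = 1%N.
Proof.
pose I := (n * 1)%N.
have small u w : size w = I -> (1 <= wt u w)%N by move=> wI; apply: wt_long; rewrite wI.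
have h : D * \det (\sum_(i < I) M ^+ i) = \det (1%:M - M ^+ I).
  by rewrite -det_mulmx; congr (\det _); exact: geom.
have h0 : (\det (1%:M - M ^+ I)).[0] = 1.
  rewrite -[X in X = _]/(horner_eval 0 _) -det_map_mx map_mxB map_mx1 /=.
  suff -> : map_mx (horner_eval 0) (M ^+ I) = 0 by rewrite subr0 det1.
  apply/matrixP => u v; rewrite !mxE /= horner_evalE horner_coef0.
  by rewrite (pow_small small).
move/(congr1 (fun q : {poly int} => q.[0])): h; rewrite h0 hornerM horner_coef0.
move: (horner _ _) => y /(congr1 absz); rewrite abszM => /eqP.
by rewrite muln_eq1 => /andP[/eqP].
Qed.

Theorem det_trans_mx : absz (\det (1%:M - trans_mx)) = absz (1 - k%:Z).
Proof.
have <- : D.[1] = \det (1%:M - trans_mx).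
  rewrite -[LHS]/(horner_eval 1 _) -det_map_mx map_mxB map_mx1 /=; congr (\det (_ - _)).
  apply/matrixP => u v; rewrite !mxE /= raddf_sum; apply: eq_bigr => a _ /=.
  by rewrite horner_evalE hornerM hornerXn expr1n mulr1 -polyC_natr hornerC.
rewrite D_eq hornerM hornerC hornerD hornerN hornerZ hornerX hornerC mulr1 abszM D0_unit mul1n.
by rewrite natz.
Qed.

End weighted_automaton.

(** * Lifting paths in suspensions *)

Lemma locally_constant_segment (R : realType) (T : Type) (g : R -> T) (a b : R) :
  (forall s, s \in `[a, b] -> exists2 e : R, 0 < e &
     forall t, t \in `[a, b] -> `|t - s| < e -> g t = g s) ->
  forall s t, s \in `[a, b] -> t \in `[a, b] -> g s = g t.
Proof.
move=> h s t sab tab.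
pose A : set R := [set` `[a, b]].
suff e : [set u | A u /\ g u = g s] = A.
  by have : A t := tab; rewrite -e => -[_ ->].
have nearE u : A u -> \forall v \near u, A v -> g v = g u.
  move=> Au; have [e e0 ge] := h u Au; apply/nbhs_ballP; exists e => // v uv Av.
  by apply: ge => //; rewrite distrC.
apply: (@segment_connected R a b); first by exists s.
- exists (interior [set u | A u -> g u = g s]); first exact: open_interior.
  apply/seteqP; split=> u [Au]; last by move=> /nbhs_singleton /(_ Au) gu; split.
  move=> gu; split=> //; rewrite /interior /=.
  by apply: filterS (nearE u Au) => v + Av => /(_ Av) ->.
- exists (~` interior [set u | A u -> g u <> g s]).
    exact/open_closedC/open_interior.
  apply/seteqP; split=> u [Au].
    by move=> gu; split=> // /nbhs_singleton /(_ Au).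
  move=> nu; split=> //; apply: contrapT => gu; apply: nu.
  by rewrite /interior /=; apply: filterS (nearE u Au) => v + Av => /(_ Av) ->.
Qed.

Section displacement.
Variables (R : realType) (X Y : sys).
Implicit Types (x : pts X) (y : pts Y) (r t : R).

Lemma sflow_near (z : susp R X) r0 (U : set (susp R X)) : nbhs (sflow z r0) U ->
  exists2 e : R, 0 < e & forall r, `|r - r0| < e -> U (sflow z r).
Proof.
have [x [t ->]] := spi_surj z; rewrite sflowE => /nbhs_suspP[N [e e0 h]].
exists e => // r rr; rewrite sflowE; apply: h => //.
by rewrite (_ : _ - _ = r - r0) //; ring.
Qed.

Lemma spi_coord_uniq y y' (a a' : R) :
  spi y a = spi y' a' -> `|a - a'| < 1 -> y = y' /\ a = a'.
Proof.
move=> /spi_eq[n [-> ->]] h; suff -> : n = 0 by rewrite shift0 mulr0z subr0.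
by apply: (@small_int R); move: h; rewrite opprB addrC subrK.
Qed.

Lemma sflow_displ_uniq (w : susp R Y) u v :
  sflow w u = sflow w v -> `|u - v| < 1 -> u = v.
Proof.
have [y [a ->]] := spi_surj w; rewrite !sflowE => e uv.
have [|_ /addrI//] := spi_coord_uniq e.
by rewrite (_ : _ - _ = u - v) //; ring.
Qed.

Variable F : susp R X -> susp R Y.
Hypothesis cF : continuous F.

Lemma spi_chart_nbhs y (a : R) N e : 0 < e -> nbhs (spi y a)
  [set w | exists y' a', [/\ w = spi y' a', agree N (sv y) (sv y') & `|a' - a| < e]].
Proof.
by move=> e0; apply/nbhs_suspP; exists N; exists e => // y' a' yy aa; exists y', a'.
Qed.

(** Along the segment the image has representatives with height within 1/8 of [a]. Such heights
    differ by less than 1, so the base point of the representative is locally constant, hence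
    constant, and the displacement is a difference of heights. *)
Lemma chart_path (z : susp R X) (a del : R) : 0 <= del ->
  (forall r, `|r| <= del -> exists y' a', F (sflow z r) = spi y' a' /\ `|a' - a| < 1/8) ->
  forall r, `|r| <= del -> exists2 u, `|u| < 1/4 & F (sflow z r) = sflow (F z) u.
Proof.
move=> del0 h.
have {}h r : exists p : pts Y * R, `|r| <= del ->
    F (sflow z r) = spi p.1 p.2 /\ `|p.2 - a| < 1/8.
  have [rd|rd] := leP `|r| del; last by have [y [b _]] := spi_surj (F z); exists (y, b).
  by have [y' [a' ?]] := h r rd; exists (y', a').
move: h => /choice[p pP].
have abs0 : `|0 : R| <= del by rewrite normr0.
have inE r : (r \in `[- del, del]) = (`|r| <= del) by rewrite in_itv /= ler_norml.
have const r : `|r| <= del -> (p r).1 = (p 0).1.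
  move=> rd; apply/sv_inj/funext => i; rewrite -inE in rd.
  apply: (@locally_constant_segment R _ (fun r => sv (p r).1 i) (- del) del) => //; last by rewrite inE.
  move=> s; rewrite inE => sd; have [Fs as_] := pP s sd.
  have e8 : 0 < 1/8 :> R by lra.
  have nb := @spi_chart_nbhs (p s).1 (p s).2 `|i| _ e8; rewrite -Fs in nb.
  have [e e0 he] := @sflow_near z s (F @^-1` _) (cF nb).
  exists e => // t; rewrite inE => td ts; have [Ft at_] := pP t td.
  have [y' [a' [e1 ag aa]]] := he t ts; rewrite Ft in e1.
  have [|-> _] := spi_coord_uniq e1; last by rewrite ag.
  by move: as_ at_ aa; rewrite !ltr_norml; lra.
move=> r rd; have [Fr ar] := pP r rd; have := pP 0 abs0; rewrite sflow0 => -[F0 a0].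
exists ((p r).2 - (p 0).2); first by move: ar a0; rewrite !ltr_norml; lra.
by rewrite Fr F0 sflowE (const r rd); congr spi; ring.
Qed.

Lemma small_displ : exists M : nat, forall z r, `|r| <= M.+1%:R^-1 ->
  exists2 u, `|u| < 1/4 & F (sflow z r) = sflow (F z) u.
Proof.
pose P (M : nat) z := forall r, `|r| <= M.+1%:R^-1 ->
  exists2 u, `|u| < 1/4 & F (sflow z r) = sflow (F z) u.
have := @susp_compact R X => /compact_near_coveringP/(_ nat \oo P _) h.
suff {h} /h [M _ /(_ M (leqnn _)) hM] : forall z, [set: susp R X] z -> \forall z' \near z & M \near \oo, P M z'.
  by exists M => z; exact: hM.
move=> z _; have [x [t zE]] := spi_surj z; have [y [a wE]] := spi_surj (F z).
have nb : nbhs (F z) [set w | exists y' a', [/\ w = spi y' a', agree 0 (sv y) (sv y') & `|a' - a| < 1/8]].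
  by rewrite wE; apply: spi_chart_nbhs; lra.
have := cF nb; rewrite zE => /nbhs_suspP[N [e e0 he]].
have e2 : 0 < e / 2 by lra.
exists ([set z' | exists x' t', [/\ z' = spi x' t', agree N (sv x) (sv x') & `|t' - t| < e / 2]],
  [set M | M.+1%:R^-1 < e / 2]).
  split=> /=; last exact: near_infty_natSinv_lt (interval_inference.PosNum e2).
  by apply/nbhs_suspP; exists N; exists (e / 2) => // x' t' xx tt; exists x', t'.
move=> [_ M] [/= [x' [t' [-> xx tt]]] Me] r rM.
have del0 : 0 <= M.+1%:R^-1 :> R by rewrite invr_ge0 ler0n.
apply: (@chart_path _ a _ del0) rM => {}r rM.
rewrite sflowE; have [|y' [a' [-> _ aa]]] := he x' (t' + r) xx; last by exists y', a'.
by move: rM tt Me; move: (_^-1) => c; rewrite ler_norml !ltr_norml; lra.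
Qed.

End displacement.

Section lifting.
Variables (R : realType) (X Y : sys) (F : susp R X -> susp R Y).
Hypothesis cF : continuous F.
Implicit Types (x : pts X) (y : pts Y) (r t : R).

Let clamp (c r : R) := Num.min (Num.max r 0) c.

Let clamp_cont c (r0 e : R) : 0 < e ->
  forall r, `|r - r0| < e -> `|clamp c r - clamp c r0| < e.
Proof.
move=> e0 r; rewrite /clamp !ltr_norml /Num.min /Num.max.
by do ?case: ifP; lra.
Qed.

Lemma sum_mul_ord (V : nmodType) q m (g : nat -> V) :
  \sum_(i < q * m) g i = \sum_(j < q) \sum_(k < m) g (j * m + k)%N.
Proof.
elim: q => [|q IH]; first by rewrite !big_ord0.
by rewrite big_ord_recr -IH mulSnr big_split_ord /=.
Qed.

Theorem lift_path : exists d : susp R X -> R,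
  (forall x (e : R), 0 < e -> exists N, forall x', agree N (sv x) (sv x') ->
     `|d (spi x' 0) - d (spi x 0)| < e) /\
  forall z (q : nat), exists s : R -> R, [/\ continuous s, s 0 = 0,
    forall r, 0 <= r <= q%:R -> F (sflow z r) = sflow (F z) (s r) &
    s q%:R = \sum_(i < q) d (sflow z i%:R)].
Proof.
have [M0 hM] := small_displ cF; set M := M0.+1 in hM.
have M_gt0 : 0 < M%:R :> R by rewrite ltr0n.
have del0 : 0 < M%:R^-1 :> R by rewrite invr_gt0.
have /choice[rho' rhoP'] : forall p : susp R X * R, exists u, `|p.2| <= M%:R^-1 ->
    `|u| < 1/4 /\ F (sflow p.1 p.2) = sflow (F p.1) u.
  move=> [z r]; have [/(hM z)[u u4 Fu]|_] := leP `|r| M%:R^-1; first by exists u.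
  by exists 0.
pose rho z r := rho' (z, r).
have rhoP z r : `|r| <= M%:R^-1 ->
    `|rho z r| < 1/4 /\ F (sflow z r) = sflow (F z) (rho z r) := rhoP' (z, r).
clearbody rho; clear rho' rhoP' hM.
(* A displacement of size less than 1/4 is determined by its end points up to
   a small error, so it depends continuously on them. *)
have rho_cont x t r0 (eps : R) : `|r0| <= M%:R^-1 -> 0 < eps ->
    exists N, exists2 e : R, 0 < e & forall x' t' r, agree N (sv x) (sv x') ->
      `|t' - t| < e -> `|r - r0| < e -> `|r| <= M%:R^-1 ->
      `|rho (spi x' t') r - rho (spi x t) r0| < eps.
  move=> r0d eps0; have [r04 Fr0] := rhoP (spi x t) r0 r0d.
  have [y [a ya]] := spi_surj (F (spi x t)); rewrite sflowE ya sflowE in Fr0.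
  pose e1 := Num.min (eps / 2) (1 / 8).
  have e10 : 0 < e1 by rewrite lt_min; apply/andP; split; lra.
  have [e1a e1b] : e1 <= eps / 2 /\ e1 <= 1 / 8 by rewrite !ge_min !lexx orbT.
  have n1 := @spi_chart_nbhs R Y y a 0 _ e10; rewrite -ya in n1.
  have n2 := @spi_chart_nbhs R Y y (a + rho (spi x t) r0) 0 _ e10; rewrite -Fr0 in n2.
  have := cF n1 => /nbhs_suspP[N1 [d1 d10 h1]].
  have := cF n2 => /nbhs_suspP[N2 [d2 d20 h2]].
  exists (maxn N1 N2); exists (Num.min d1 (d2 / 2)); first by rewrite lt_min d10 divr_gt0.
  move=> x' t' r xx; rewrite !lt_min => /andP[tt1 tt2] /andP[rr1 rr2] rd.
  have [y1 [a1 [e1' _ b1]]] := h1 x' t' (agreeW (leq_maxl _ _) xx) tt1.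
  have /(_ _)[|y2 [a2 [e2' _ b2]]] := h2 x' (t' + r) (agreeW (leq_maxr _ _) xx).
    by move: tt2 rr2; rewrite !ltr_norml; lra.
  have [r4 Fr] := rhoP (spi x' t') r rd.
  rewrite sflowE e1' sflowE e2' in Fr; have [|_ e3] := spi_coord_uniq Fr.
    by move: r4 r04 b1 b2; rewrite !ltr_norml; lra.
  by move: b1 b2; rewrite e3 !ltr_norml; lra.
pose d z := \sum_(k < M) rho (sflow z (k%:R / M%:R)) M%:R^-1.
exists d; split.
  move=> x; pose D n x' := \sum_(k < n) rho (sflow (spi x' 0) (k%:R / M%:R)) M%:R^-1.
  suff h n (e : R) : 0 < e -> exists N, forall x', agree N (sv x) (sv x') ->
      `|D n x' - D n x| < e by move=> e; exact: (h M).
  rewrite /D; elim: n e => [|n IH] e e0; first by exists 0%N => x' _; rewrite !big_ord0 subrr normr0.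
  have e2 : 0 < e / 2 by lra.
  have [N1 h1] := IH _ e2.
  have /(_ _)[|N2 [e' e'0 h2]] := @rho_cont x (0 + n%:R / M%:R) M%:R^-1 _ _ e2.
    by rewrite ger0_norm // ltW.
  exists (maxn N1 N2) => x' xx; rewrite !big_ord_recr /= !sflowE.
  have := h1 x' (agreeW (leq_maxl _ _) xx).
  have := h2 x' (0 + n%:R / M%:R) M%:R^-1 (agreeW (leq_maxr _ _) xx).
  rewrite !subrr normr0 (ger0_norm (ltW del0)) => /(_ e'0 e'0 (lexx _)).
  by rewrite !ltr_norml; lra.
move=> z q; have [x [t ->]] := spi_surj z.
(* The i-th piece of [0, r] runs from [f i r] to [f i.+1 r] and is degenerate beyond [r], so one sum
   with a fixed number of terms serves all [r] and is continuous in [r]. *)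
pose f i r := clamp (i%:R / M%:R) r.
have f_step i r : `|f i.+1 r - f i r| <= M%:R^-1.
  rewrite /f -(natr1 i) mulrDl mul1r.
  move: (i%:R / M%:R) => a; move: (M%:R^-1) del0 => b b0.
  by rewrite /clamp ler_norml /Num.min /Num.max; do ?case: ifP; lra.
exists (fun r => \sum_(i < q * M) rho (spi x (t + f i r)) (f i.+1 r - f i r)); split.
- elim: (q * M)%N => [|n IH] r0.
    by rewrite (_ : (fun _ => _) = cst 0); [exact: cst_continuous|apply/funext => r; rewrite big_ord0].
  rewrite (_ : (fun _ => _) = (fun r => \sum_(i < n) rho (spi x (t + f i r)) (f i.+1 r - f i r)) \+
     (fun r => rho (spi x (t + f n r)) (f n.+1 r - f n r))); last first.
    by apply/funext => r; rewrite big_ord_recr.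
  apply: cvgD; first exact: IH.
  apply/cvgrPdist_lt => e e0; apply/nbhs_ballP.
  have [N [e' e'0 h]] := rho_cont x (t + f n r0) (f n.+1 r0 - f n r0) e (f_step _ _) e0.
  have e2 : 0 < e' / 2 by lra.
  have fC i r : `|r - r0| < e' / 2 -> `|f i r - f i r0| < e' / 2 by exact: clamp_cont.
  exists (e' / 2) => // r; rewrite /ball /= distrC => rr; rewrite distrC; apply: h => //.
    by have := fC n r rr; rewrite !ltr_norml; lra.
  by have := fC n r rr; have := fC n.+1 r rr; rewrite !ltr_norml; lra.
- rewrite big1 // => i _; have f0 j : f j 0 = 0.
    by rewrite /f /clamp maxxx min_l // divr_ge0 // ltW.
  have [r4 e] := rhoP (spi x (t + f i 0)) (f i.+1 0 - f i 0) (f_step _ _).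
  rewrite !f0 subr0 addr0 sflow0 in r4 e *.
  apply: (@sflow_displ_uniq R Y (F (spi x t))); rewrite ?sflow0 ?subr0 //.
  by move: r4; rewrite !ltr_norml; lra.
- move=> r /andP[r0 rq]; transitivity (F (sflow (spi x t) (f (q * M)%N r))).
    by rewrite /f /clamp natrM mulfK ?gt_eqF // max_l // min_l.
  elim: (q * M)%N => [|n IH].
    by rewrite big_ord0 /f /clamp mul0r max_l // min_r // !sflow0.
  rewrite big_ord_recr /= -sflowD -IH !sflowE.
  have [_ <-] := rhoP (spi x (t + f n r)) _ (f_step n r).
  by rewrite sflowE; congr (F (spi _ _)); ring.
- pose g i := rho (spi x (t + i%:R / M%:R)) M%:R^-1.
  have fq i : (i <= q * M)%N -> f i q%:R = i%:R / M%:R.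
    by move=> iq; rewrite /f /clamp max_l // min_r // ler_pdivrMr // -natrM ler_nat.
  transitivity (\sum_(i < q * M) g i).
    apply: eq_bigr => i _; have iq := ltn_ord i; rewrite !fq //; last exact: ltnW.
    by rewrite /g -mulrBl -(natr1 i) addrAC subrr add0r mul1r.
  rewrite sum_mul_ord; apply: eq_bigr => j _; apply: eq_bigr => k _.
  rewrite /g !sflowE; congr (rho (spi _ _) _).
  by rewrite natrD natrM mulrDl mulfK ?gt_eqF // addrA.
Qed.
End lifting.

(** * The period cocycle *)

Section minimal_periods.
Variable X : sys.
Implicit Types (x : pts X) (q : nat) (n : int).

Definition minper x q : Prop :=
  (0 < q)%N /\ forall n, shift n x = x <-> (q%:Z %| n)%Z.

Lemma shift_periodM x n k : shift n x = x -> shift (k * n) x = x.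
Proof.
move=> xn; elim/int_ind: k => [|k|k].
- by rewrite mul0r shift0.
- by move=> e; rewrite mulrDl mul1r -shiftD e.
- by rewrite mulrDl mul1r addrC -shiftD xn.
Qed.

Lemma minper_exists x n : n != 0 -> shift n x = x -> exists q, minper x q.
Proof.
move=> n0 xn; pose P q := (0 < q)%N && `[< shift q%:Z x = x >].
have exP : exists q, P q.
  exists `|n|%N; rewrite /P absz_gt0 n0; apply/asboolP.
  have [->//|->] : `|n|%:Z = n \/ `|n|%:Z = - 1 * n by lia.
  exact: shift_periodM.
case: (ex_minnP exP) => q /andP[q0 /asboolP xq] minq; exists q; split=> // m.
split; last by move=> /dvdzP[k ->]; exact: shift_periodM.
move=> xm; have q0' : q%:Z != 0 by lia.
have xr : shift (m %% q)%Z x = x.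
  have := divz_eq m q; set r := (m %% q)%Z; set k := (m %/ q)%Z => mE.
  by move: xm; rewrite mE -shiftD shift_periodM.
have [r0 rq] : 0 <= (m %% q)%Z /\ (m %% q)%Z < q.
  by split; [exact: modz_ge0|exact: ltz_pmod].
apply/dvdz_mod0P; apply/eqP; apply: contraT => rn0.
move: r0 rq xr rn0; case: (m %% q)%Z => // k _ kq xk kn0.
have : P k by rewrite /P; apply/andP; split; [lia|exact/asboolP].
by move/minq; lia.
Qed.

Lemma minper_uniq x q q' : minper x q -> minper x q' -> q = q'.
Proof.
move=> [q0 h] [q0' h']; apply/eqP; rewrite eqn_dvd.
have h1 := (h q').1 ((h' q').2 (dvdzz _)); have h2 := (h' q).1 ((h q).2 (dvdzz _)).
by apply/andP; split; [exact: h1|exact: h2].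
Qed.

Lemma minper_shift x q j : minper x q -> minper (shift j x) q.
Proof.
move=> [q0 h]; split=> // k; rewrite -h shiftD addrC -shiftD; split=> [/shift_inj//|->//].
Qed.

Lemma minper_mod x q j : minper x q -> exists t : 'I_q, shift j x = shift t%:Z x.
Proof.
move=> [q0 h]; have [t tE tq] : exists2 t : nat, (j %% q)%Z = t & (t < q)%N.
  have := ltz_pmod j (_ : 0 < q%:Z); have := modz_ge0 j (_ : q%:Z != 0).
  move=> /(_ _)/wrap[|]; first by lia.
  case: (j %% q)%Z => // t _ /(_ _)/wrap[|tq]; first by lia.
  by exists t.
exists (Ordinal tq); rewrite /= -tE {1}(divz_eq j q) -shiftD.
by rewrite (h ((j %/ q)%Z * q%:Z)).2 // dvdz_mull.
Qed.

End minimal_periods.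

(** * Images of closed orbits *)

Section periodic_orbits.
Variables (R : realType) (X Y : sys) (F : susp R X -> susp R Y).
Hypothesis injF : injective F.
Variables (x : pts X) (q : nat) (y : pts Y) (a : R) (s : R -> R).
Hypothesis xq : minper x q.
Hypothesis cs : continuous s.
Hypothesis s0 : s 0 = 0.
Hypothesis Fs : forall r : R, 0 <= r <= q%:R -> F (spi x r) = spi y (a + s r).

Lemma ivt (f : R -> R) (b c v : R) : continuous f -> b <= c ->
  f b <= v <= f c \/ f c <= v <= f b -> exists2 t, b <= t <= c & f t = v.
Proof.
move=> cf bc h; have [||t] := @IVT R f b c v bc; last by rewrite in_itv; exists t.
  exact: continuous_subspaceT.
by rewrite ge_min le_max; case: h => /andP[-> ->] //; rewrite !orbT.
Qed.

Let q_gt0 : 0 < q%:R :> R. Proof. by rewrite ltr0n; case: xq. Qed.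

(** Heights over [y] that differ by a period of [y] give the same point of the image, so injectivity
    of [F] on one turn of the closed orbit applies. *)
Let lift_inj (r r' : R) (n : int) : 0 <= r < q%:R -> 0 <= r' < q%:R ->
  shift n y = y -> s r' = s r - n%:~R -> r = r'.
Proof.
move=> /andP[r0 rq] /andP[r0' rq'] yn e.
have : F (spi x r) = F (spi x r').
  by rewrite !Fs ?r0 ?r0' ?ltW // e -(spi_shift n y (a + s r)) yn addrA.
move/injF/spi_eq => [m [xm r'E]]; have [_ /(_ m)[/(_ (esym xm)) /dvdzP[k mE] _]] := xq.
have mR : m%:~R = k%:~R * q%:R :> R by rewrite mE intrM.
suff k0 : k = 0 by move: r'E; rewrite mE k0 mul0r mulr0z subr0.
apply: (@small_int R); rewrite -(ltr_pM2r q_gt0) mul1r -[X in _ * X](ger0_norm (ltW q_gt0)).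
rewrite -normrM -mR (_ : m%:~R = r - r'); last by rewrite r'E; ring.
by rewrite ltr_norml; apply/andP; split; move: q_gt0; lra.
Qed.

Let end_period : exists n : int, s q%:R = n%:~R /\ shift n y = y.
Proof.
have [_ /(_ q%:Z)[_ /(_ (dvdzz _)) xqq]] := xq.
have : F (spi x q%:R) = F (spi x 0).
  by congr F; rewrite -(spi_shift q%:Z x) xqq subrr.
rewrite !Fs ?lexx ?ltW // s0 addr0 => /spi_eq[n [yn e]].
by exists n; split => //; move: e; lra.
Qed.

(** If the lift closed up, it would take the value halfway to its value at q/2 both before and after
    q/2, against injectivity. *)
Let end_neq0 : s q%:R != 0.
Proof.
apply/eqP => sq; have qq := q_gt0; pose h : R := q%:R / 2.
have h0 : 0 < h < q%:R by rewrite /h; lra.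
have sh : s h <> 0.
  move=> e; have : h = 0; last by move: h0; lra.
  by apply: (@lift_inj _ _ 0); rewrite ?shift0 // ?subr0 ?e ?s0 //; move: h0; lra.
have [||r1 r1h e1] := @ivt s 0 h (s h / 2) cs; first by move: h0; lra.
  by rewrite s0; have [|] := leP 0 (s h); [left|right]; lra.
have [||r2 r2h e2] := @ivt s h q%:R (s h / 2) cs; first by move: h0; lra.
  by rewrite sq; have [|] := leP 0 (s h); [right|left]; lra.
have r2q : r2 < q%:R.
  rewrite lt_neqAle; case/andP: r2h => _ ->; rewrite andbT.
  by apply/eqP => e; move: e2; rewrite e sq; lra.
have r12 : r1 = r2.
  apply: (@lift_inj _ _ 0); rewrite ?shift0 // ?subr0 ?e1 ?e2 //; move: h0 r1h r2h r2q; lra.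
by apply: sh; move: e1; rewrite r12 (_ : r2 = h); move: r1h r2h; rewrite ?r12; lra.
Qed.

Lemma periodic_image : exists n, n != 0 /\ shift n y = y.
Proof.
have [n [sn yn]] := end_period; exists n; split=> //.
by apply: contraNneq end_neq0 => n0; rewrite sn n0.
Qed.

Variable L : nat.
Hypothesis yL : minper y L.

Let L_gt0 : 0 < L%:R :> R. Proof. by rewrite ltr0n; case: yL. Qed.

(** The end value is a nonzero multiple of L. Were it a larger multiple, the lift would pass L or -L
    strictly before time q, where the image would be back at its starting point. *)
Let end_pm : s q%:R = L%:R \/ s q%:R = - L%:R.
Proof.
have [n [sn yn]] := end_period; have [Lp Ld] := yL.
have := (Ld n).1 yn => /dvdzP[k nE].
have k0 : k != 0 by apply: contraNneq end_neq0 => k0; rewrite sn nE k0 mul0r.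
have sE : s q%:R = k%:~R * L%:R by rewrite sn nE intrM.
have hit (e : int) : s q%:R <> e%:~R * L%:R -> e != 0 ->
    0 <= (e%:~R * L%:R : R) <= s q%:R \/ s q%:R <= (e%:~R * L%:R : R) <= 0 -> False.
  move=> ne e0 be; have [|r /andP[r0 rq] sr] := @ivt s 0 q%:R (e%:~R * L%:R) cs (ltW q_gt0).
    by rewrite s0.
  have {}rq : r < q%:R.
    by rewrite lt_neqAle rq andbT; apply/eqP => rE; apply: ne; rewrite -rE.
  have rr : 0 = r.
    apply: (@lift_inj _ _ (- e * L%:Z)); rewrite ?lexx ?r0 //.
      by apply/Ld; rewrite dvdz_mull.
    by rewrite s0 sr intrM intrN; ring.
  move: sr; rewrite -rr s0 => /esym/eqP; rewrite mulf_eq0 intr_eq0 (negbTE e0) /=.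
  by rewrite gt_eqF.
have [k1|k1] : k = 1 \/ k <> 1 by lia.
  by left; rewrite sE k1 mul1r.
have [k2|k2] : k = -1 \/ k <> -1 by lia.
  by right; rewrite sE k2 mulN1r.
exfalso; have mono (u v : int) : u <= v -> u%:~R * L%:R <= v%:~R * L%:R :> R.
  by move=> uv; rewrite ler_pM2r // ler_int.
have ne (e : int) : k <> e -> s q%:R <> e%:~R * L%:R.
  by move=> ke; rewrite sE => /(mulIf (lt0r_neq0 L_gt0))/eqP; rewrite eqr_int => /eqP.
have [kp|kn] : 1 <= k \/ k <= -1 by lia.
  apply: (hit 1); [exact: ne|by []|left; apply/andP; split].
    by rewrite mul1r ltW.
  by rewrite sE mono.
apply: (hit (-1)); [exact: ne|by []|right; apply/andP; split].
  by rewrite sE mono.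
by rewrite mulN1r oppr_le0 ltW.
Qed.

Variable phi : R -> R.
Hypothesis phi_incr : {homo phi : r t / r < t}.
Hypothesis Fphi : forall r, F (spi x r) = spi y (a + phi r).

Let phi_lift (r : R) : 0 <= r <= q%:R -> exists k : int, phi r = s r + k%:~R * L%:R.
Proof.
move=> rq; have := Fs rq; rewrite Fphi => /spi_eq[n [yn e]].
have [_ /(_ n)[/(_ (esym yn)) /dvdzP[k nE] _]] := yL.
exists k; have : n%:~R = k%:~R * L%:R :> R by rewrite nE intrM.
by move: e; lra.
Qed.

(* Along a closed orbit traversed backwards, an increasing reparametrization
   would have to jump forward by almost a full period at each of arbitrarily
   many steps. *)
Lemma periodic_lift : s q%:R = L%:R.
Proof.
have [//|sq] := end_pm; exfalso; have qq := q_gt0; have LL := L_gt0.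
(* The times at which [s] has dropped by the fraction i/(M + 1) of L. Since [phi - s] takes values
   in the multiples of L, each further drop pushes [phi] up by at least L - L/(M + 1); the M + 1
   drops add up to M L, with M arbitrary. *)
have step (M : nat) i : (i <= M.+1)%N -> exists t, [/\ 0 <= t <= q%:R,
    s t = - (i%:R / M.+1%:R) * L%:R &
    phi 0 + i%:R * (L%:R - L%:R / M.+1%:R) <= phi t].
  have M0 : 0 < M.+1%:R :> R by rewrite ltr0n.
  elim: i => [|i IH] iM; first by exists 0; rewrite lexx ltW // !mul0r oppr0 mul0r s0 addr0.
  have [t [/andP[t0 tq] st phit]] := IH (ltnW iM).
  have iM1 : i.+1%:R / M.+1%:R <= 1 :> R by rewrite ler_pdivrMr // mul1r ler_nat.
  have iE : i.+1%:R / M.+1%:R = i%:R / M.+1%:R + M.+1%:R^-1 :> R.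
    by rewrite -(natr1 i) mulrDl mul1r.
  have Mi : 0 < M.+1%:R^-1 :> R by rewrite invr_gt0.
  have [|t' /andP[tt' tq'] st'] := @ivt s t q%:R (- (i.+1%:R / M.+1%:R) * L%:R) cs tq.
    by right; rewrite sq st; move: iM1; rewrite iE; move: (i%:R / _) => u; move: (_^-1) Mi => v; nra.
  exists t'; split=> //; first by rewrite (le_trans t0).
  have {}tt' : t < t'.
    rewrite lt_neqAle tt' andbT; apply/eqP => e; move: st'; rewrite -e st iE.
    by move: (i%:R / _) => u; move: (_^-1) Mi => v; nra.
  have /phi_lift[k ek] : 0 <= t <= q%:R by rewrite t0.
  have /phi_lift[k' ek'] : 0 <= t' <= q%:R by rewrite (le_trans t0 (ltW tt')).
  have := phi_incr tt'; rewrite ek ek' st st' iE => lt.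
  have kk : k + 1 <= k'.
    rewrite addrC lez1D -(ltr_int R) -(ltr_pM2r LL).
    by move: lt; move: (i%:R / _) => u; move: (_^-1) Mi => v; nra.
  have {}kk : (k%:~R + 1) * L%:R <= k'%:~R * L%:R :> R.
    by rewrite ler_pM2r // -[1]/(1%:~R) -intrD ler_int.
  move: phit; rewrite ek st -(natr1 i); move: (_^-1) (i%:R) => u v.
  by nra.
have [M hM] : exists M : nat, phi q%:R - phi 0 < M%:R * L%:R.
  exists (Num.bound `|(phi q%:R - phi 0) / L%:R|).
  rewrite -ltr_pdivrMr //; apply: le_lt_trans (ler_norm _) _.
  exact/archi_boundP/normr_ge0.
have [t [/andP[t0 tq] _]] := step M M.+1 (leqnn _).
have : phi t <= phi q%:R by move: tq; rewrite le_eqVlt => /orP[/eqP->//|/phi_incr/ltW].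
rewrite mulrBr mulrCA mulfV ?pnatr_eq0 // mulr1 -(natr1 M).
by move: hM; nra.
Qed.

End periodic_orbits.

Section cocycle.
Variables (R : realType) (X Y : sys).
Implicit Types (x : pts X) (y : pts Y).

Lemma uniform_agree (Q : pts X -> pts X -> Prop) :
  (forall x, exists N, forall x1 x2,
     agree N (sv x) (sv x1) -> agree N (sv x) (sv x2) -> Q x1 x2) ->
  exists N, forall x1 x2, agree N (sv x1) (sv x2) -> Q x1 x2.
Proof.
move=> h; pose P (N : nat) x := forall x', agree N (sv x) (sv x') -> Q x x'.
have := @pts_compact X => /compact_near_coveringP/(_ nat \oo P _) cov.
suff {cov} /cov[N _ /(_ N (leqnn _)) hN] :
    forall x, [set: pts X] x -> \forall x' \near x & N \near \oo, P N x'.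
  by exists N => x; exact: hN.
move=> x _; have [N hN] := h x.
exists ([set x' | agree N (sv x) (sv x')], [set M | (N <= M)%N]).
  by split=> /=; [apply/nbhs_ptsP; exists N|exists N].
move=> [x1 M] [/= xx1 NM] x2 x12; apply: hN => //.
exact: agree_trans xx1 (agreeW NM x12).
Qed.

Variable F : susp R X -> susp R Y.
Hypothesis cF : continuous F.

Lemma orbit_image z r : exists u, F (sflow z r) = sflow (F z) u.
Proof.
have [d [_ lift]] := lift_path cF.
have pos z' r' : 0 <= r' -> exists u, F (sflow z' r') = sflow (F z') u.
  move=> r0; have [s [_ _ h _]] := lift z' (Num.bound r').
  by exists (s r'); apply: h; rewrite r0 ltW // archi_boundP.
have [/pos//|r0] := leP 0 r.
have [|u] := pos (sflow z r) (- r); first by lra.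
by rewrite sflowD subrr sflow0 => ->; exists (- u); rewrite sflowD subrr sflow0.
Qed.

Lemma orbit_image_spi x r y (s : R) j r' y' (s' : R) : F (spi x r) = spi y s ->
  F (spi (shift j x) r') = spi y' s' -> exists k, y' = shift k y.
Proof.
move=> e; have [u] := orbit_image (spi x r) (r' + j%:~R - r).
rewrite sflowE e sflowE (_ : r + _ = r' + j%:~R); last by ring.
rewrite -(spi_shift j x) addrK => -> /esym/spi_eq[k [e1 _]].
by exists (- k); rewrite e1 shiftD subrr shift0.
Qed.

Hypothesis injF : injective F.

Lemma image_minper x q y (a : R) : minper x q -> F (spi x 0) = spi y a ->
  exists L, minper y L.
Proof.
move=> xq Fx; have [d [_ lift]] := lift_path cF.
have [s [cs s0 hs _]] := lift (spi x 0) q.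
have Fs (r : R) : 0 <= r <= q%:R -> F (spi x r) = spi y (a + s r).
  by move/hs; rewrite sflowE add0r Fx sflowE.
by have [k [k0 /(minper_exists k0)]] := periodic_image injF xq cs s0 Fs.
Qed.

Hypothesis Fphi : forall z, exists phi : R -> R,
  {homo phi : r s / r < s} /\ forall r, F (sflow z r) = sflow (F z) (phi r).

Let chart : exists N, forall x1 x2, agree N (sv x1) (sv x2) ->
  exists y1 a1 y2 a2, [/\ F (spi x1 0) = spi y1 a1, F (spi x2 0) = spi y2 a2 &
    `|a1 - a2| < 1/8].
Proof.
apply: uniform_agree => x; have [y [a ya]] := spi_surj (F (spi x 0)).
have e16 : 0 < 1/16 :> R by lra.
have nb := @spi_chart_nbhs R Y y a 0 _ e16; rewrite -ya in nb.
have := cF nb => /nbhs_suspP[N [e e0 h]]; exists N => x1 x2 xx1 xx2.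
have n0 : `|0 - 0 : R| < e by rewrite subrr normr0.
have [y1 [a1 [e1 _ b1]]] := h x1 0 xx1 n0.
have [y2 [a2 [e2 _ b2]]] := h x2 0 xx2 n0.
by exists y1, a1, y2, a2; split => //; move: b1 b2; rewrite !ltr_norml; lra.
Qed.

(* The points of a block are lifted close to the lift of a representative of
   that block, which makes the integer [c x] locally constant. *)
Theorem cocycle : exists (c : pts X -> int) N,
  (forall x x', agree N (sv x) (sv x') -> c x = c x') /\
  forall x q y a L, minper x q -> F (spi x 0) = spi y a -> minper y L ->
    \sum_(i < q) c (shift i%:Z x) = L%:Z.
Proof.
have [d [dcont lift]] := lift_path cF.
have [N1 dN1] : exists N, forall x1 x2, agree N (sv x1) (sv x2) ->
    `|d (spi x1 0) - d (spi x2 0)| < 1/4.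
  apply: uniform_agree => x; have [|N hN] := dcont x (1/8); first lra.
  exists N => x1 x2 /hN + /hN; rewrite !ltr_norml; lra.
have [N2 chartN] := chart.
(* The choice is made from a set and not from a point, so that all points with the same block
   receive the same representative. *)
have /choice[rep repP] : forall B : set (pts X), exists o : option (pts X),
    forall x, B x -> exists2 p, o = Some p & B p.
  move=> B; have [[p Bp]|nB] := pselect (exists p, B p).
    by exists (Some p) => x _; exists p.
  by exists None => x Bx; exfalso; apply: nB; exists x.
have /choice[A0 A0P] : forall x, exists ya : pts Y * R, F (spi x 0) = spi ya.1 ya.2.
  by move=> x; have [y [a e]] := spi_surj (F (spi x 0)); exists (y, a).
pose block x := rep [set x' | agree N2 (sv x) (sv x')].
have /choice[A AP] : forall x, exists ya : pts Y * R, F (spi x 0) = spi ya.1 ya.2 /\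
    forall p, block x = Some p -> `|ya.2 - (A0 p).2| < 1/8.
  move=> x; have [p pE xp] := repP [set x' | agree N2 (sv x) (sv x')] x (@agree_refl _ _ _).
  have [y1 [a1 [y2 [a2 [e1 e2 a12]]]]] := chartN x p xp.
  move: e2; rewrite A0P => /spi_eq[n [_ a2E]].
  exists (shift (- n) y1, a1 + n%:~R); split=> /=.
    rewrite e1 -(spi_shift (- n) y1); congr spi; rewrite intrN; ring.
  move=> p'; rewrite /block pE => -[<-]; move: a12; rewrite a2E !ltr_norml; lra.
have Aclose x x' : agree N2 (sv x) (sv x') -> `|(A x).2 - (A x').2| < 1/4.
  move=> xx; have [p pE _] := repP [set x' | agree N2 (sv x) (sv x')] x (@agree_refl _ _ _).
  have pE' : block x' = Some p.
    rewrite -pE; congr rep; apply/seteqP; split=> u /=; first exact: agree_trans.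
    exact/agree_trans/agree_sym.
  by have := (AP x).2 p pE; have := (AP x').2 p pE'; rewrite !ltr_norml; lra.
have spi1 x : spi x 1 = spi (shift 1 x) 0 :> susp R X.
  by rewrite -(spi_shift 1 x) subrr.
have /choice[c cP] : forall x, exists n : int,
    n%:~R = (A x).2 + d (spi x 0) - (A (shift 1 x)).2.
  move=> x; have [s [_ _ /(_ 1) h s1]] := lift (spi x 0) 1%N.
  move: h; rewrite lexx ler01 => /(_ isT); rewrite sflowE add0r spi1.
  rewrite s1 big_ord1 /= mulr0n sflow0 (AP _).1 (AP x).1 sflowE.
  by move/spi_eq => [n [_ e]]; exists (- n); rewrite intrN; move: e; lra.
exists c, (maxn N1 N2.+1); split=> [x x' xx|x q y a L xq Fx yL].
  suff : c x - c x' = 0 by move/eqP; rewrite subr_eq0 => /eqP.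
  apply: (@small_int R); rewrite intrD intrN !cP.
  have h1 := dN1 x x' (agreeW (leq_maxl _ _) xx).
  have h2 := Aclose x x' (agreeW (leq_trans (leqnSn _) (leq_maxr _ _)) xx).
  have /Aclose : agree N2 (sv (shift 1 x)) (sv (shift 1 x')).
    by apply: agree_shift; rewrite addn1; exact: agreeW (leq_maxr _ _) xx.
  by move: h1 h2; rewrite !ltr_norml; lra.
have [s [cs s0 hs sq]] := lift (spi x 0) q.
have [phi [incr hphi]] := Fphi (spi x 0).
have Fs (r : R) : 0 <= r <= q%:R -> F (spi x r) = spi y (a + s r).
  by move/hs; rewrite sflowE add0r Fx sflowE.
have Fp r : F (spi x r) = spi y (a + phi r) by have := hphi r; rewrite sflowE add0r Fx sflowE.
have sL := periodic_lift injF xq cs s0 Fs yL incr Fp.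
apply/eqP; rewrite -(eqr_int R); apply/eqP; rewrite -[RHS]sL sq raddf_sum /=.
(* The heights chosen by [A] enter [c] as a coboundary and cancel around the closed orbit, leaving
   the total displacement. *)
have tele n : \sum_(i < n) (c (shift i%:Z x))%:~R =
    (A x).2 - (A (shift n%:Z x)).2 + \sum_(i < n) d (sflow (spi x 0) i%:R).
  elim: n => [|n IH]; first by rewrite !big_ord0 shift0 subrr addr0.
  rewrite !big_ord_recr /= IH cP shiftD (_ : n%:Z + 1 = n.+1); last by lia.
  rewrite (_ : spi (shift n x) 0 = sflow (spi x 0) n%:R); first by ring.
  by rewrite sflowE add0r -(spi_shift n%:Z x n%:R) subrr.
by rewrite tele (_ : shift q x = x) ?subrr ?add0r //; case: xq => _ /(_ q%:Z)[_]; exact.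
Qed.

End cocycle.

(** * Periodic points of full shifts *)

Definition full_sys (La : finType) : sys :=
  @sft La (fun _ _ => true) id (fun _ _ => id).

Section full_shift.
Variable La : finType.
Notation pt := (pts (full_sys La)).
Implicit Types (x z : pt) (w : seq La).

Definition full_pt (f : int -> La) : pt := @mkpt (full_sys La) f (fun=> isT).

Lemma sv_full f i : sv (full_pt f) i = f i. Proof. by []. Qed.

Definition word x i : seq La := mkseq (fun t => sv x t%:Z) i.

Lemma size_word x i : size (word x i) = i. Proof. exact: size_mkseq. Qed.

Lemma nth_word a x i t : (t < i)%N -> nth a (word x i) t = sv x t%:Z.
Proof. exact: nth_mkseq. Qed.

Lemma wordS x i : word x i.+1 = sv x 0 :: word (shift 1 x) i.
Proof.
rewrite /word /mkseq /= -[1%N]addn0 iotaDl -map_comp; congr (_ :: _).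
by apply: eq_map => t; rewrite /= sv_shift; congr (sv x _); lia.
Qed.

Lemma word_inj x z i : (0 < i)%N -> shift i%:Z x = x -> shift i%:Z z = z ->
  word x i = word z i -> x = z.
Proof.
move=> i0 xi zi xz; apply/sv_inj/funext => j.
have per (y : pt) : shift i%:Z y = y -> sv y j = sv y (j %% i)%Z.
  move=> yi; have {2}<- := shift_periodM (j %/ i)%Z yi.
  by rewrite sv_shift {1}(divz_eq j i) addrC.
have [t tE ti] : exists2 t : nat, (j %% i)%Z = t & (t < i)%N.
  have := ltz_pmod j (_ : 0 < i%:Z); have := modz_ge0 j (_ : i%:Z != 0).
  move=> /(_ _)/wrap[|]; first by lia.
  case: (j %% i)%Z => // t _ /(_ _)/wrap[|ti]; first by lia.
  by exists t.
by rewrite (per x) // (per z) // tE -(nth_word (sv x 0) x ti) -(nth_word (sv x 0) z ti) xz.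
Qed.

Lemma word_surj w : (0 < size w)%N ->
  exists x, shift (size w)%:Z x = x /\ word x (size w) = w.
Proof.
case: w => // a w' _; set w := a :: w'.
exists (full_pt (fun j => nth a w `|(j %% size w)%Z|)); split.
  by apply/sv_inj/funext => j; rewrite sv_shift !sv_full modzDr.
apply: (@eq_from_nth _ a); rewrite size_word // => t tw.
by rewrite nth_word // sv_full modz_small //; lia.
Qed.

Variable m : nat.
Notation n := #|{: m.-tuple La}|.
Implicit Type u : 'I_n.

(** The states of the de Bruijn automaton are the m letters before position 0, so that the letter at
    0 is the next input. *)
Definition win x : 'I_n := enum_rank [tuple sv x (k%:Z - m%:Z) | k < m].

Definition del u (a : La) : 'I_n :=
  enum_rank [tuple of behead (rcons (enum_val u) a)].

Lemma winP x z : win x = win z <-> forall j : int, - m%:Z <= j < 0 -> sv x j = sv z j.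
Proof.
split=> [/enum_rank_inj e j jm|h].
  have jm' : (absz (j + m%:Z)%R < m)%N by lia.
  have := congr1 (fun t : m.-tuple La => tnth t (Ordinal jm')) e.
  by rewrite !tnth_mktuple /= (_ : (absz (j + m%:Z))%:Z - m%:Z = j) //; lia.
by congr enum_rank; apply: eq_from_tnth => k; rewrite !tnth_mktuple h //; have := ltn_ord k; lia.
Qed.

Lemma win_del x : win (shift 1 x) = del (win x) (sv x 0).
Proof.
rewrite /win /del enum_rankK; congr enum_rank; apply: eq_from_tnth => k.
rewrite tnth_mktuple (tnth_nth (sv x 0)) /= nth_behead nth_rcons size_tuple sv_shift.
rewrite card_ord if_same; have km := ltn_ord k; case: ltnP => km'; last by congr (sv x _); lia.
by rewrite (nth_map k) ?size_enum_ord // nth_enum_ord //; congr (sv x _); lia.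
Qed.

Lemma win_word x i : foldl del (win x) (word x i) = win (shift i%:Z x).
Proof.
elim: i x => [|i IH] x; first by rewrite shift0.
by rewrite wordS /= -win_del IH shiftD; congr (win (shift _ x)); lia.
Qed.

Lemma win_word_surj (a : La) u w : exists x, win x = u /\ word x (size w) = w.
Proof.
pose v := tval (enum_val u) ++ w.
have sv_ : size (enum_val u) = m by rewrite size_tuple.
exists (full_pt (fun j => nth a v (absz (j + m%:Z)))); split.
  rewrite -[RHS]enum_valK; congr enum_rank; apply: eq_from_tnth => k; rewrite tnth_mktuple.
  by rewrite sv_full subrK /= nth_cat sv_ ltn_ord -tnth_nth.
apply: (@eq_from_nth _ a); rewrite size_word // => t tw.
by rewrite nth_word // sv_full nth_cat sv_ ltnNge leq_addl /= addnK.
Qed.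

(** The window of a closed walk reappears one turn of [w] later, which determines its letters
    backwards from position 0, even when m exceeds the length of [w]. Thus each nonempty word closes
    up at exactly one state. *)
Lemma closedP u w x : (0 < size w)%N -> shift (size w)%:Z x = x -> word x (size w) = w ->
  foldl del u w = u <-> u = win x.
Proof.
move=> w0 xi xw; split; last by move=> ->; rewrite -[in foldl _ _ w]xw win_word xi.
have [z [<- zw]] := win_word_surj (sv x 0) u w; rewrite -{1}zw win_word => /winP zi.
apply/winP => j /andP[mj j0].
suff h k : forall j : int, - k%:Z <= j -> - m%:Z <= j -> j < (size w)%:Z -> sv z j = sv x j.
  by apply: (h m) => //; lia.
elim: k => [|k IH] {j mj j0} j jk jm js.
  have [t -> tw] : exists2 t : nat, j = t & (t < size w)%N by exists (absz j); lia.
  by rewrite -(nth_word (sv x 0) z tw) -(nth_word (sv x 0) x tw) zw xw.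
have [|jk'] := leP (- k%:Z) j; first by move/IH; apply.
rewrite -zi ?sv_shift; last by lia.
by rewrite IH; [rewrite -[in RHS]xi|lia|lia|lia].
Qed.

Lemma del_reach (a : La) u v : exists w, foldl del u w = v.
Proof.
have [z [zv _]] := win_word_surj a v [::].
pose w := word (shift (- m%:Z) z) m.
have [x [xu xw]] := win_word_surj a u w.
exists w; rewrite -xu -[w]xw win_word -zv; apply/winP => j jm; rewrite sv_shift size_word.
have [t tE tm] : exists2 t : nat, j + m%:Z = t & (t < m)%N by exists (absz (j + m%:Z)); lia.
rewrite tE; move: xw; rewrite size_word => xw.
by rewrite -(nth_word a x tm) xw nth_word // sv_shift -tE addrK.
Qed.

End full_shift.

Section potential.
Variables (Q La : finType) (nx : Q -> La -> Q) (om : Q -> La -> int).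

Fixpoint wtz u (w : seq La) : int :=
  if w is a :: w' then om u a + wtz (nx u a) w' else 0.

Lemma wtz_cat u w1 w2 : wtz u (w1 ++ w2) = wtz u w1 + wtz (foldl nx u w1) w2.
Proof. by elim: w1 u => [|a w1 IH] u /=; rewrite ?add0r // IH addrA. Qed.

(* [W u] is the least weight of a word read from [u]. *)
Lemma potential_exists :
  (forall u v, exists w, foldl nx u w = v) ->
  (forall u w, foldl nx u w = u -> 0 <= wtz u w) ->
  exists W : Q -> int, forall u a, 0 <= om u a + W (nx u a) - W u.
Proof.
move=> reach closed_ge0.
have /choice[ret retP] : forall p : Q * Q, exists w, foldl nx p.1 w = p.2.
  by move=> [u v]; exact: reach.
have lower u : exists W : int, (exists w, wtz u w = W) /\ forall w, W <= wtz u w.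
  (* Closing a word by a fixed return word gives a closed walk of nonnegative weight, so the word
     itself weighs at least [- B]. *)
  pose B : int := \sum_v `|wtz v (ret (v, u))|.
  have BP w : 0 <= wtz u w + B.
    set v := foldl nx u w.
    have := closed_ge0 u (w ++ ret (v, u)); rewrite foldl_cat (retP (v, u)) wtz_cat => /(_ erefl).
    have : `|wtz v (ret (v, u))| <= B by rewrite /B (bigD1 v) //= lerDl sumr_ge0.
    by rewrite ler_norml -/v => /andP[_]; lia.
  have exk : exists k : nat, `[< exists w, wtz u w + B = k%:Z >].
    exists (absz (wtz u [::] + B)); apply/asboolP; exists [::].
    by have := BP [::]; lia.
  case: (ex_minnP exk) => k /asboolP[w wk] kmin; exists (wtz u w); split; first by exists w.
  move=> w'; have := kmin (absz (wtz u w' + B)); have := BP w' => b0.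
  move=> /(_ _)/wrap[|kw]; first by apply/asboolP; exists w'; lia.
  by move: wk b0 kw; lia.
have /choice[W WP] := lower; exists W => u a.
have [[w wE] _] := WP (nx u a); have [_ /(_ (a :: w))] := WP u.
by rewrite /= wE; lia.
Qed.

End potential.

Section orbits.
Variable La : finType.
Notation pt := (pts (full_sys La)).
Implicit Type x : pt.

Definition word_tuple x i : i.-tuple La := Tuple (introT eqP (size_word x i)).

(** A point of period [i] is determined by its first [i] letters, so the q points of the orbit give
    q distinct words. *)
Lemma orbit_sum (V : nmodType) x q i (g : i.-tuple La -> V) :
  minper x q -> (0 < i)%N -> shift i%:Z x = x ->
  \sum_(w : i.-tuple La | `[< exists j, val w = word (shift j x) i >]) g w =
  \sum_(t < q) g (word_tuple (shift t%:Z x) i).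
Proof.
move=> xq i0 xi; have [q0 h] := xq.
have xi' j : shift i%:Z (shift j x) = shift j x by rewrite shiftD addrC -shiftD xi.
have inj : injective (fun t : 'I_q => word_tuple (shift t%:Z x) i).
  move=> t t' /(congr1 val) /= /(word_inj i0 (xi' _) (xi' _)) e.
  have : shift (t%:Z - t'%:Z) x = x.
    by apply: (@shift_inj _ t'%:Z); rewrite shiftD subrK.
  move/h => /dvdzP[k tt]; apply: val_inj => /=.
  have := ltn_ord t; have := ltn_ord t'; move: tt.
  have [->|k1] : k = 0 \/ (1 <= k \/ k <= -1) by lia.
    by lia.
  by case: k1; nia.
rewrite -[RHS](big_imset (h := fun t : 'I_q => word_tuple (shift t%:Z x) i)); last by move=> t t' _ _ /inj.
apply: eq_bigl => w; apply/asboolP/imsetP => [[j wj]|[t _ ->]]; last by exists t%:Z.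
have [t tE] := minper_mod j xq; exists t => //; apply: val_inj.
by rewrite /= wj tE.
Qed.

End orbits.

(** * Counting periodic points along corresponding orbits *)

Section counting.
Variables (La Lb : finType) (a0 : La) (b0 : Lb) (m : nat).
Notation n := #|{: m.-tuple La}|.
Notation ptA := (pts (full_sys La)).
Notation ptB := (pts (full_sys Lb)).
(** [Rel] relates points whose orbits correspond. It is kept abstract for two uses: orbits matched
    by a flow equivalence, and a full shift matched with itself, all weights being 1. *)
Variables (e : 'I_n -> La -> nat) (Rel : ptA -> ptB -> Prop).
Implicit Types (x : ptA) (y : ptB).
Hypothesis Rel_exr : forall x q, minper x q -> exists y L, Rel x y /\ minper y L.
Hypothesis Rel_exl : forall y L, minper y L -> exists x q, Rel x y /\ minper x q.
Hypothesis Rel_orbit : forall x x' y y', Rel x y -> Rel x' y' ->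
  (exists j, x' = shift j x) <-> (exists j, y' = shift j y).
Hypothesis Rel_shift : forall x y j k, Rel x y -> Rel (shift j x) (shift k y).
Hypothesis Rel_sum : forall x y q L, Rel x y -> minper x q -> minper y L ->
  (\sum_(t < q) e (win m (shift t%:Z x)) (sv x t%:Z) = L)%N.

Local Notation wt := (wt (@del La m) e).

Let wt_word x i :
  wt (win m x) (word x i) = (\sum_(t < i) e (win m (shift t%:Z x)) (sv x t%:Z))%N.
Proof.
elim: i x => [|i IH] x; first by rewrite big_ord0.
rewrite wordS big_ord_recl /= shift0 -win_del IH; congr (_ + _)%N.
apply: eq_bigr => t _; rewrite shiftD sv_shift.
by rewrite (_ : 1 + t%:Z = lift ord0 t) ?(addrC t%:Z) //= -intS.
Qed.

Let wt_period x y q L r : Rel x y -> minper x q -> minper y L ->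
  wt (win m x) (word x (r * q)) = (r * L)%N.
Proof.
move=> xy xq yL; rewrite wt_word.
rewrite (@sum_mul_ord nat r q (fun t => e (win m (shift t%:Z x)) (sv x t%:Z))).
transitivity (\sum_(j < r) L)%N; last by rewrite sum_nat_const card_ord.
apply: eq_bigr => j _; rewrite -[RHS](Rel_sum xy xq yL); apply: eq_bigr => k _.
have [_ h] := xq; have xj : shift (j * q)%N%:Z x = x by apply/h; rewrite PoszM dvdz_mull.
have -> : sv x (j * q + k)%N%:Z = sv x k%:Z by rewrite -[in RHS]xj sv_shift addrC.
by rewrite PoszD -shiftD xj.
Qed.

Let closed_period u w x : w != [::] -> shift (size w)%:Z x = x -> word x (size w) = w ->
  foldl (@del La m) u w = u ->
  exists q r y L, [/\ minper x q, Rel x y, minper y L, (0 < r)%N &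
    size w = (r * q)%N /\ wt u w = (r * L)%N].
Proof.
move=> w0 xi xw; have sw : (0 < size w)%N by rewrite lt0n size_eq0.
move/(closedP _ sw xi xw) => ->.
have [|q xq] := minper_exists _ xi; first by lia.
have [y [L [xy yL]]] := Rel_exr xq; have [q0 h] := xq.
have /dvdzP[k kE] := (h _).1 xi.
have [r [rE r0]] : exists r : nat, size w = (r * q)%N /\ (0 < r)%N.
  exists (absz k); have : 0 <= k by nia.
  by case: k kE => // r + _; split; [lia|nia].
exists q, r, y, L; split => //; split => //.
by rewrite -xw rE; exact: wt_period xy xq yL.
Qed.

Let closed_gt0 u w : w != [::] -> foldl (@del La m) u w = u -> (0 < wt u w)%N.
Proof.
move=> w0 uw; have sw : (0 < size w)%N by rewrite lt0n size_eq0.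
have [x [xi xw]] := word_surj sw.
have [q [r [y [L [_ _ [L0 _] r0 [_ ->]]]]]] := closed_period w0 xi xw uw.
by rewrite muln_gt0 r0.
Qed.

Let per_pt (Lc : finType) (c : Lc) : exists p : seq Lc -> pts (full_sys Lc),
  forall w, (0 < size w)%N -> shift (size w)%:Z (p w) = p w /\ word (p w) (size w) = w.
Proof.
have /choice[p pP] : forall w : seq Lc, exists x : pts (full_sys Lc),
    (0 < size w)%N -> shift (size w)%:Z x = x /\ word x (size w) = w.
  move=> w; have [w0|_] := ltnP 0 (size w); last by exists (full_pt (fun=> c)).
  by have [x xw] := word_surj w0; exists x.
by exists p.
Qed.

Let same_orbit (Lc : finType) (p : seq Lc -> pts (full_sys Lc)) (z : pts (full_sys Lc)) w :
  (forall w, (0 < size w)%N -> shift (size w)%:Z (p w) = p w /\ word (p w) (size w) = w) ->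
  (0 < size w)%N -> shift (size w)%:Z z = z ->
  (exists j, p w = shift j z) <-> (exists j, w = word (shift j z) (size w)).
Proof.
move=> pP w0 zw; have [p1 p2] := pP w w0; split=> -[j e1]; exists j.
  by rewrite -e1 p2.
apply: (word_inj w0) => //; last by rewrite p2.
by rewrite shiftD addrC -shiftD zw.
Qed.

(** Double counting of pairs of a closed walk [w] of weight M and a point of the second shift fixed
    by M steps, given by a word [v], on corresponding orbits; the pair counts [G w / Lw v]. For
    fixed [v] the values [G w] add up to the least period [Lw v], so the row contributes 1. For
    fixed [w] there are L words [v], each with [Lw v = L], so the column contributes [G w]. *)
Theorem det_count : absz (\det (1%:M - trans_mx (@del La m))) = absz (1 - #|Lb|%:Z).
Proof.
apply: det_trans_mx closed_gt0 _ => M I M0 nI.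
have [xw xwP] := per_pt a0; have [yw ywP] := per_pt b0.
have /choice[Lw LwP] : forall w : seq Lb, exists L, (0 < size w)%N -> minper (yw w) L.
  move=> w; have [w0|_] := ltnP 0 (size w); last by exists 0%N.
  have [y1 _] := ywP w w0; have [|L yL] := minper_exists _ y1; first by lia.
  by exists L.
pose G w : nat := if wt (win m (xw w)) w == M then e (win m (xw w)) (sv (xw w) 0) else 0%N.
have RelE x y x' : Rel x y -> Rel x' y <-> exists j, x' = shift j x.
  move=> xy; split=> [x'y|[j ->]].
    by apply/(Rel_orbit xy x'y); exists 0; rewrite shift0.
  by have := Rel_shift j 0 xy; rewrite shift0.
have RelE' x y y' : Rel x y -> Rel x y' <-> exists j, y' = shift j y.
  move=> xy; split=> [xy'|[j ->]].
    by apply/(Rel_orbit xy xy'); exists 0; rewrite shift0.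
  by have := Rel_shift 0 j xy; rewrite shift0.
transitivity (\sum_(j < I) \sum_(w : j.+1.-tuple La) G w)%N.
  apply: eq_bigr => j _; rewrite (@sum_tuple_cons La nat j G).
  apply: eq_bigr => a _; apply: eq_bigr => w _.
  have [x1 x2] := xwP (a :: w) isT; rewrite /G.
  rewrite (eq_bigl (fun u => (u == win m (xw (a :: w))) && (wt u (a :: w) == M))); last first.
    move=> u; congr (_ && _); apply/eqP/eqP => h; first exact/(closedP u _ x1 x2).
    exact/(closedP u _ x1 x2).
  case: ifPn => [wM|wM].
    rewrite (big_pred1 (win m (xw (a :: w)))).
      by congr e; have := congr1 (head a) x2; rewrite wordS.
    by move=> u; rewrite /=; case: eqP => // ->; rewrite wM.
  by rewrite big_pred0 // => u; case: eqP => //= ->; rewrite (negbTE wM).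
have rowsum (v : M.-tuple Lb) :
    (\sum_(j < I) \sum_(w : j.+1.-tuple La | `[< Rel (xw w) (yw v) >]) G w = Lw v)%N.
  have v0 : (0 < size v)%N by rewrite size_tuple.
  have [x0 [q [xy xq]]] := Rel_exl (LwP v v0); have [q0 qd] := xq.
  have yL := LwP v v0; have [yv _] := ywP v v0; have [L0 Ld] := yL.
  have /dvdnP[r rE] : (Lw v %| M)%N by have := (Ld (size v)%:Z).1 yv; rewrite size_tuple.
  have r0 : (0 < r)%N by move: M0; rewrite rE; case: (r).
  have relw j (w : j.+1.-tuple La) : Rel (xw w) (yw v) -> wt (win m (xw w)) w = M ->
      j.+1 = (r * q)%N.
    move=> wv wM; have w0 : (0 < size w)%N by rewrite size_tuple.
    have [x1 x2] := xwP w w0.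
    have wq : minper (xw w) q by have /(RelE _ _ _ xy)[k ->] := wv; exact: minper_shift.
    have /dvdnP[r' r'E] : (q %| size w)%N by have [_ h] := wq; exact: (h (size w)%:Z).1 x1.
    have /eqP : (r' * Lw v = r * Lw v)%N.
      rewrite -[RHS]rE -[RHS]wM.
      by rewrite -(wt_period r' wv wq yL) -r'E x2.
    by rewrite eqn_pmul2r // => /eqP <-; rewrite -r'E size_tuple.
  have [j0 j0E] : exists j0, (r * q = j0.+1)%N by exists (r * q).-1; rewrite prednK // muln_gt0 r0.
  have wt0 k : wt (win m (shift k x0)) (word (shift k x0) j0.+1) = M.
    rewrite -j0E rE; apply: (wt_period (y := yw v)) => //; last exact: minper_shift.
    by have := Rel_shift k 0 xy; rewrite shift0.
  have j0I : (j0 < I)%N.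
    rewrite ltnNge; apply/negP => Ij0.
    have := @wt_long _ _ _ _ closed_gt0 M.+1 (win m x0) (word x0 j0.+1).
    rewrite size_word => /(_ _)/wrap[|]; first by lia.
    by have := wt0 0; rewrite shift0 => ->; rewrite ltnn.
  rewrite (bigD1 (Ordinal j0I)) //= [X in (_ + X)%N]big1 ?addn0; last first.
    move=> j jj0; rewrite big1 // => w /asboolP wv; rewrite /G; case: eqP => // /(relw _ _ wv).
    by rewrite j0E => -[jE]; case/eqP: jj0; apply: val_inj.
  have x0j : shift j0.+1%:Z x0 = x0 by apply/qd; rewrite -j0E PoszM dvdz_mull.
  rewrite (eq_bigl (fun w : j0.+1.-tuple La => `[< exists k, val w = word (shift k x0) j0.+1 >])); last first.
    move=> w; have w0 : (0 < size w)%N by rewrite size_tuple.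
    have so := @same_orbit _ _ x0 w xwP w0; rewrite size_tuple in so.
    apply/asboolP/asboolP; first by move/(RelE _ _ _ xy)/(so x0j).
    by move=> h; apply/(RelE _ _ _ xy)/(so x0j).
  transitivity (\sum_(t < q) G (word_tuple (shift t%:Z x0) j0.+1))%N.
    exact: (@orbit_sum La nat x0 q j0.+1 (fun w => G w) xq (ltn0Sn _) x0j).
  rewrite -[RHS](Rel_sum xy xq yL); apply: eq_bigr => t _.
  set w := word_tuple _ _; have w0 : (0 < size w)%N by rewrite size_tuple.
  have [x1 x2] := xwP w w0; rewrite size_tuple in x1 x2.
  have xwE : xw w = shift t%:Z x0.
    by apply: (word_inj (ltn0Sn j0)); rewrite ?x2 // shiftD addrC -shiftD x0j.
  by rewrite /G xwE wt0 eqxx.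
have colsum j (w : j.+1.-tuple La) : wt (win m (xw w)) w = M ->
    \sum_(v : M.-tuple Lb | `[< Rel (xw w) (yw v) >]) (Lw v)%:R^-1 = 1 :> rat.
  move=> wM; have w0 : (0 < size w)%N by rewrite size_tuple.
  have [x1 x2] := xwP w w0.
  have cl : foldl (@del La m) (win m (xw w)) w = win m (xw w) by apply/(closedP _ w0 x1 x2).
  have [|q [r [y [L [xq xy yL r0 [_ wL]]]]]] := closed_period _ x1 x2 cl.
    by rewrite -size_eq0 -lt0n.
  have [L0 Ld] := yL.
  have yM : shift M%:Z y = y by apply/Ld; rewrite -wM wL PoszM dvdz_mull.
  rewrite (eq_bigl (fun v : M.-tuple Lb => `[< exists j, val v = word (shift j y) M >])); last first.
    move=> v; apply/asboolP/asboolP.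
      move/(RelE' _ _ _ xy)/(same_orbit ywP); rewrite size_tuple; exact.
    by move=> h; apply/(RelE' _ _ _ xy)/(same_orbit ywP); rewrite size_tuple.
  rewrite (orbit_sum (fun v : M.-tuple Lb => (Lw v)%:R^-1 : rat) yL M0 yM).
  rewrite (eq_bigr (fun=> L%:R^-1)) ?sumr_const ?card_ord => [|t _].
    by rewrite -[LHS]mulr_natl mulfV // pnatr_eq0 -lt0n.
  have sM : size (word_tuple (shift t%:Z y) M) = M by rewrite size_tuple.
  have [k kE] : exists j, yw (word_tuple (shift t%:Z y) M) = shift j y.
    by apply/(same_orbit ywP); rewrite ?sM //; exists t%:Z.
  have := LwP (word_tuple (shift t%:Z y) M); rewrite sM kE => /(_ M0) h.
  by rewrite (minper_uniq h (minper_shift k yL)).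
apply/eqP; rewrite -(eqr_nat rat); apply/eqP.
rewrite natr_sum; under eq_bigr => j _ do rewrite natr_sum.
transitivity (\sum_(v : M.-tuple Lb) (1 : rat)); last first.
  by rewrite sumr_const card_tuple.
transitivity (\sum_(j < I) \sum_(w : j.+1.-tuple La)
   \sum_(v : M.-tuple Lb | `[< Rel (xw w) (yw v) >]) (G w)%:R * (Lw v)%:R^-1 : rat).
  apply: eq_bigr => j _; apply: eq_bigr => w _; rewrite -mulr_sumr.
  have [/colsum ->|wM] := eqVneq (wt (win m (xw w)) w) M; first by rewrite mulr1.
  by rewrite /G (negbTE wM) mul0r.
under eq_bigr => j _ do (under eq_bigr => w _ do rewrite big_mkcond; rewrite exchange_big).
rewrite exchange_big; apply: eq_bigr => v _ /=.
have Lv0 : (Lw v)%:R != 0 :> rat.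
  by rewrite pnatr_eq0 -lt0n; have [|] := LwP v; rewrite ?size_tuple.
transitivity ((\sum_(j < I) \sum_(w : j.+1.-tuple La | `[< Rel (xw w) (yw v) >]) G w)%N%:R
  / (Lw v)%:R : rat); last by rewrite rowsum mulfV.
rewrite natr_sum mulr_suml; apply: eq_bigr => j _.
rewrite natr_sum mulr_suml [RHS]big_mkcond; apply: eq_bigr => w _.
by case: ifP.
Qed.

End counting.

(** The transition matrix does not involve the weights, so matching the shift with itself, with all
    weights 1, evaluates the same determinant. *)
Lemma det_full (La : finType) (a0 : La) (m : nat) :
  absz (\det (1%:M - trans_mx (@del La m))) = absz (1 - #|La|%:Z).
Proof.
pose Rel (x y : pts (full_sys La)) := exists j, y = shift j x.
apply: (@det_count La La a0 a0 m (fun _ _ => 1%N) Rel).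
- by move=> x q xq; exists x, q; split=> //; exists 0; rewrite shift0.
- by move=> x q xq; exists x, q; split=> //; exists 0; rewrite shift0.
- move=> x x' _ _ [a ->] [b ->]; split=> -[j].
    by move=> ->; exists (j + b - a); rewrite !shiftD; congr (shift _ x); ring.
  move=> /(congr1 (shift (- b))); rewrite !shiftD subrr shift0 => ->.
  by exists (a + (j - b)).
- by move=> x _ j k [i ->]; exists (i + k - j); rewrite !shiftD; congr (shift _ x); ring.
- move=> x _ q L [j ->] xq xL; rewrite sum_nat_const card_ord muln1.
  exact: minper_uniq (minper_shift j xq) xL.
Qed.

(** * Invariance *)

Section full_part.
Variable I : finType.
Notation ptF := (pts (full_sys (option I))).
Implicit Types x y : ptF.

Definition emb x : pts (tail_sys I) :=
  @mkpt (tail_sys I) (fun i => inl (sv x i)) (fun=> isT).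

Lemma emb_shift j x : emb (shift j x) = shift j (emb x).
Proof. exact: sv_inj. Qed.

Lemma emb_inj : injective emb.
Proof.
move=> x y /(congr1 (fun z => sv z)) e; apply/sv_inj/funext => i.
by have [->] := congr1 (fun f : int -> yalph I => f i) e.
Qed.

Lemma emb_flip x : flip (emb x) = emb x.
Proof. by apply/sv_inj/funext => i; rewrite sv_flip. Qed.

Lemma embP (z : pts (tail_sys I)) : flip z = z -> exists x, z = emb x.
Proof.
move=> fz; have /choice[f fP] : forall i, exists o, sv z i = inl o.
  move=> i; have := congr1 (fun z => sv z i) fz; rewrite sv_flip.
  by case: (sv z i) => [o|[b o]]; [exists o|case: b].
by exists (full_pt f); apply/sv_inj/funext => i; rewrite fP.
Qed.

Lemma minper_emb x q : minper (emb x) q <-> minper x q.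
Proof.
have e k : shift k (emb x) = emb x <-> shift k x = x.
  by rewrite -emb_shift; split=> [/emb_inj|->].
by split=> -[q0 h]; split=> // k; rewrite -h e.
Qed.

End full_part.

Section invariance.
Variables (R : realType) (Ia Ib : finType).
Notation Xa := (tail_sys Ia).
Notation Xb := (tail_sys Ib).
Variables (F : susp R Xa -> susp R Xb) (G : susp R Xb -> susp R Xa).
Hypotheses (cF : continuous F) (cG : continuous G).
Hypotheses (FK : cancel F G) (GK : cancel G F).
Hypothesis Fphi : forall z, exists phi : R -> R,
  {homo phi : r s / r < s} /\ forall r, F (sflow z r) = sflow (F z) (phi r).
Hypothesis Fflip : forall z, F (sflip z) = sflip (F z).

Let Gflip z : G (sflip z) = sflip (G z).
Proof. by rewrite -{1}[z]GK -Fflip FK. Qed.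

Let Rel (x : pts (full_sys (option Ia))) (y : pts (full_sys (option Ib))) : Prop :=
  exists r s : R, F (spi (emb x) r) = spi (emb y) s.

(** By equivariance the image of a fixed point is fixed by the involution. The involution keeps
    heights, and representatives at the same height are unique, so the base point is fixed too. *)
Lemma full_image (I J : finType) (H : susp R (tail_sys I) -> susp R (tail_sys J)) x :
  (forall z, H (sflip z) = sflip (H z)) ->
  exists y a, H (spi (emb x) 0) = spi (emb y) a.
Proof.
move=> Hflip; have [y [a ya]] := spi_surj (H (spi (emb x) 0)).
have := Hflip (spi (emb x) 0); rewrite sflipE emb_flip ya sflipE.
by move/esym/spi_eq_same/embP => [y' ->]; exists y', a.
Qed.

Let Rel_exr x q : minper x q -> exists y L, Rel x y /\ minper y L.
Proof.
move=> xq; have [y [a ya]] := full_image x Fflip.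
have [L /minper_emb yL] := image_minper cF (can_inj FK) ((minper_emb x q).2 xq) ya.
by exists y, L; split=> //; exists 0, a.
Qed.

Let Rel_exl y L : minper y L -> exists x q, Rel x y /\ minper x q.
Proof.
move=> yL; have [x [a xa]] := full_image y Gflip.
have [q /minper_emb xq] := image_minper cG (can_inj GK) ((minper_emb y L).2 yL) xa.
by exists x, q; split=> //; exists a, 0; rewrite -xa GK.
Qed.

Let Rel_orbit x x' y y' : Rel x y -> Rel x' y' ->
  (exists j, x' = shift j x) <-> (exists j, y' = shift j y).
Proof.
move=> [r [s e]] [r' [s' e']]; split=> -[j jE].
  rewrite jE emb_shift in e'; have [k kE] := orbit_image_spi cF e e'.
  by exists k; apply: emb_inj; rewrite emb_shift.
rewrite jE emb_shift in e'.
have [k kE] := orbit_image_spi cG (canLR FK (esym e)) (canLR FK (esym e')).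
by exists k; apply: emb_inj; rewrite emb_shift.
Qed.

Let Rel_shift x y j k : Rel x y -> Rel (shift j x) (shift k y).
Proof.
by move=> [r [s e]]; exists (r - j%:~R), (s - k%:~R); rewrite !emb_shift !spi_shift.
Qed.

Theorem card_full_part : #|{: option Ia}| = #|{: option Ib}|.
Proof.
have [c [N [cN csum]]] := cocycle cF (can_inj FK) Fphi.
pose m := (N + N)%N; pose La : finType := option Ia.
(* Shifting by [N] moves the two-sided block of radius [N] onto the m = 2N letters before position 0
   and the letter at 0, that is onto a state of the automaton and its input. *)
pose c' (x : pts (full_sys La)) := c (shift (- N%:Z) (emb x)).
have c'E x x' : (forall j : int, - m%:Z <= j <= 0 -> sv x j = sv x' j) -> c' x = c' x'.
  move=> h; apply: cN => i iN; rewrite !sv_shift; congr inl; apply: h.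
  by rewrite /m; lia.
have c'sum x y q L : Rel x y -> minper x q -> minper y L ->
    \sum_(t < q) c' (shift t%:Z x) = L%:Z.
  move=> [r [s e]] xq yL; pose X := shift (- N%:Z) (emb x).
  have [Y [a XY]] := spi_surj (F (spi X 0)).
  have [k YE] := orbit_image_spi cF e XY.
  have Xq : minper X q by apply/minper_shift/minper_emb.
  have YL : minper Y L by rewrite YE; apply/minper_shift/minper_emb.
  rewrite -(csum _ _ _ _ _ Xq XY YL); apply: eq_bigr => t _.
  by rewrite /c' emb_shift !shiftD addrC.
pose n := #|{: m.-tuple La}|.
have /choice[ext extP] : forall p : 'I_n * La, exists x, win m x = p.1 /\ sv x 0 = p.2.
  move=> [u a]; have [x [xu xa]] := win_word_surj a u [:: a].
  by exists x; split=> //; case: xa.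
pose om (u : 'I_n) (a : La) := c' (ext (u, a)).
have omE x : om (win m x) (sv x 0) = c' x.
  have [e1 e2] := extP (win m x, sv x 0); apply: c'E => j jm.
  have [j0|j0] : j = 0 \/ - m%:Z <= j < 0 by lia.
    by rewrite j0 e2.
  by move/winP: e1; apply.
have wtzE x i : wtz (@del La m) om (win m x) (word x i) = \sum_(t < i) c' (shift t%:Z x).
  elim: i x => [|i IH] x; first by rewrite big_ord0.
  rewrite wordS big_ord_recl /= shift0 -win_del IH omE; congr (_ + _).
  by apply: eq_bigr => t _; rewrite shiftD -intS.
have closed_ge0 u w : foldl (@del La m) u w = u -> 0 <= wtz (@del La m) om u w.
  have [->|w0] := eqVneq w [::]; first by [].
  have sw : (0 < size w)%N by rewrite lt0n size_eq0.
  have [x [xi xw]] := word_surj sw; move/(closedP _ sw xi xw) => ->.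
  have [|q xq] := minper_exists _ xi; first by lia.
  have [y [L [xy yL]]] := Rel_exr xq; have [q0 h] := xq.
  have /dvdnP[r rE] : (q %| size w)%N by exact: (h _).1 xi.
  rewrite -xw wtzE rE (@sum_mul_ord int r q (fun t => c' (shift t%:Z x))).
  apply: sumr_ge0 => j _; rewrite (eq_bigr (fun k : 'I_q => c' (shift k%:Z x))).
    by rewrite (c'sum x y q L).
  move=> k _; rewrite PoszD -shiftD (_ : shift (j * q)%N%:Z x = x) //.
  by apply/h; rewrite PoszM dvdz_mull.
have [W WP] := potential_exists (del_reach None) closed_ge0.
pose e (u : 'I_n) (a : La) : nat := absz (om u a + W (del u a) - W u)%R.
have eE u a : (e u a)%:Z = om u a + W (del u a) - W u by rewrite /e gez0_abs.
have Rel_sum x y q L : Rel x y -> minper x q -> minper y L ->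
    (\sum_(t < q) e (win m (shift t%:Z x)) (sv x t%:Z) = L)%N.
  move=> xy xq yL; apply/eqP; rewrite -eqz_nat -(c'sum x y q L xy xq yL).
  rewrite -[X in X == _]natz natr_sum.
  have tele i : \sum_(t < i) (e (win m (shift t%:Z x)) (sv x t%:Z))%:R =
      \sum_(t < i) c' (shift t%:Z x) + W (win m (shift i%:Z x)) - W (win m x) :> int.
    elim: i => [|i IH]; first by rewrite !big_ord0 shift0 add0r subrr.
    have x0 : sv x i%:Z = sv (shift i%:Z x) 0 by rewrite sv_shift add0r.
    rewrite !big_ord_recr /= IH natz eE x0 omE -win_del shiftD.
    by rewrite (_ : i%:Z + 1 = i.+1); [ring|lia].
  rewrite tele (_ : shift q%:Z x = x) ?addrK //.
  by have [_ h] := xq; apply/h; rewrite dvdzz.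
have d1 := det_count None None Rel_exr Rel_exl Rel_orbit Rel_shift Rel_sum.
(* Both differences are minus the cardinality of an index set, so equality of absolute values
   suffices. *)
have := det_full (None : La) m; rewrite d1 !card_option; lia.
Qed.

End invariance.

Lemma tail_sys_card (R : realType) (A1 V1 A2 V2 I1 I2 : finType)
    (F1 : lgraph A1 V1) (F2 : lgraph A2 V2) :
  fe R (cover_sys F1) (tail_sys I1) -> fe R (cover_sys F2) (tail_sys I2) ->
  (exists Phi : susp_cover R F1 -> susp_cover R F2, flow_equivalence Phi /\
     forall z, Phi (susp_swap z) = susp_swap (Phi z)) ->
  #|I1| = #|I2|.
Proof.
move=> /fe_sym[T [hT fT sT]] [U [hU fU sU]] [Phi [[hP fP] sP]].
have [cF [G [FK GK cG]]] : homeomorphism (U \o Phi \o T).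
  by apply: homeo_comp hT _; exact: homeo_comp hP hU.
have := card_full_part (Ia := I1) (Ib := I2) cF cG FK GK _ _.
rewrite !card_option => h; suff [] : #|I1|.+1 = #|I2|.+1 by [].
apply: h => z /=; last by rewrite sT sP sU.
have [t [_ [mt _ et]]] := fT z; have [p [mp ep]] := fP (T z).
have [u [_ [mu _ eu]]] := fU (Phi (T z)).
exists (u \o p \o t); split=> [r s rs|r] /=; first exact/mu/mp/mt.
by rewrite et ep eu.
Qed.

Theorem proposition4p28 (R : realType) (b1 b2 : R) (hb1 : 1 < b1) (hb2 : 1 < b2)
    (g1_evper : eventually_periodic (generating_seq b1))
    (g1_nper : ~ periodic (generating_seq b1))
    (g2_evper : eventually_periodic (generating_seq b2))
    (g2_nper : ~ periodic (generating_seq b2))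
    (n1 p1 n2 p2 : nat)
    (min1 : minimal_ultimately_periodic (generating_seq b1) n1 p1)
    (min2 : minimal_ultimately_periodic (generating_seq b2) n2 p2)
    (V1 V2 : finType)
    (F1 : lgraph 'I_(alphabet_size b1) V1) (F2 : lgraph 'I_(alphabet_size b2) V2)
    (cover1 : right_fischer_cover F1 (beta_shift b1))
    (cover2 : right_fischer_cover F2 (beta_shift b2)) :
  (exists Phi : susp_cover R F1 -> susp_cover R F2,
     flow_equivalence Phi /\
     forall z, Phi (susp_swap z) = susp_swap (Phi z)) <->
  (\sum_(j < p1) generating_seq b1 (n1 + j) =
   \sum_(j < p2) generating_seq b2 (n2 + j))%N.

Proof.
have T1 := cover_tail_fe hb1 g1_nper min1 cover1.
have T2 := cover_tail_fe hb2 g2_nper min2 cover2.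
split; first by move/(tail_sys_card T1 T2); rewrite !card_ord.
by move=> e; apply: fe_flow_equivalence; apply: fe_trans T1 _; rewrite e; exact: fe_sym.
Qed.
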